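(* Let $\gamma_L,\gamma_R,\alpha_L,\alpha_R,b\in\mathbb{R}$ and consider the planar piecewise linear system $$\begin{cases}\dot x=2\gamma_L x-y-b,\\ \dot y=(1+\gamma_L^2)x-\alpha_L,\end{cases}\ \text{if } x\le 0,\qquad \begin{cases}\dot x=2\gamma_R x-y+b,\\ \dot y=(1+\gamma_R^2)x-\alpha_R,\end{cases}\ \text{if } x>0.$$ The periodic orbit at infinity is hyperbolic and stable (respectively, unstable) whenever $\gamma_L+\gamma_R>0$ (respectively, $\gamma_L+\gamma_R<0$). When $\gamma_L+\gamma_R=0$ the periodic orbit at infinity is non-hyperbolic, so that it behaves like a weak-focus or a center. The possible weak-focus orders are only $1$, $2$ and $3$, and from a weak-focus of order $1$, $2$ and $3$ there exist (arbitrarily small) perturbations of the parameters within this family such that the system exhibits $1$, $2$ and $3$ limit cycles of big amplitude, respectively.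
   Context: On $\Sigma=\{x=0\}$ the system is understood with the Filippov convention; orbits far from the origin cross $\Sigma$. The linear parts have eigenvalues $\gamma_L\pm i$, $\gamma_R\pm i$. Half-return maps. For $y_0>0$ large, the orbit of the left system starting at $(0,y_0)$ reaches, forward in time through $x\le0$, a point $(0,y_1)$ with $y_1<0$; the orbit of the right system through $(0,y_0)$ reaches, backward in time through $x\ge0$, a point $(0,y_2)$ with $y_2<0$. For $u_0=1/y_0>0$ small put $L(u_0)=1/y_1$, $R(u_0)=1/y_2$ and define the displacement map $\Delta(u_0)=L(u_0)-R(u_0)$. These maps extend analytically to $u_0=0$ with value $0$ there, and $\Delta(u_0)=\Delta_1u_0+\Delta_2u_0^2+\Delta_3u_0^3+\cdots$. The value $u_0=0$ represents the periodic orbit at infinity; positive zeros of $\Delta$ near $0$ correspond one-to-one to crossing periodic orbits near infinity. The periodic orbit at infinity is hyperbolic if $\Delta_1\ne0$ (equivalently, the derivative $L'(0)/R'(0)$ at $0$ of the return map $L\circ R^{-1}$ is not $1$). It is stable (unstable) if $y_1-y_2<0$ ($y_1-y_2>0$) for all small $u_0>0$, i.e. nearby orbits move away towards (come away from) infinity. It behaves like a weak-focus of order $i-1$ if $\Delta_1=0$ and $\Delta_i$ is the first non-vanishing coefficient; it behaves like a center if $\Delta\equiv0$ near $0$. A limit cycle of big amplitude is an isolated crossing periodic orbit near infinity, i.e. corresponding to an isolated positive zero of $\Delta$ which tends to $u_0=0$ as the perturbation tends to zero. *)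

(* Defs.v *)
From Stdlib Require Import Reals List.
From Coquelicot Require Import Coquelicot.
Open Scope R_scope.

Record params := Params {
  gammaL : R;
  gammaR : R;
  alphaL : R;
  alphaR : R;
  bb : R
}.

Definition left_field (p : params) (x y : R) : R * R :=
  (2 * gammaL p * x - y - bb p, (1 + gammaL p ^ 2) * x - alphaL p).

Definition right_field (p : params) (x y : R) : R * R :=
  (2 * gammaR p * x - y + bb p, (1 + gammaR p ^ 2) * x - alphaR p).

(* Each of the two fields is affine, so its solutions are defined for all
   times; only the arc lying in the relevant half-plane is used below. *)
Definition is_orbit (F : R -> R -> R * R) (x y : R -> R) : Prop :=
  forall t, is_derive x t (fst (F (x t) (y t))) /\
            is_derive y t (snd (F (x t) (y t))).

(* The half-return maps are functional relations between ordinates on x = 0: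
   the strict sign of x between the endpoints makes the endpoint the first
   return to that line. *)
Definition left_half_return (p : params) (y0 y1 : R) : Prop :=
  exists (x y : R -> R) (T : R),
    is_orbit (left_field p) x y /\ x 0 = 0 /\ y 0 = y0 /\
    0 < T /\ (forall t, 0 < t < T -> x t < 0) /\
    x T = 0 /\ y T = y1 /\ y1 < 0.

Definition right_half_return (p : params) (y0 y2 : R) : Prop :=
  exists (x y : R -> R) (T : R),
    is_orbit (right_field p) x y /\ x 0 = 0 /\ y 0 = y0 /\
    0 < T /\ (forall t, - T < t < 0 -> 0 < x t) /\
    x (- T) = 0 /\ y (- T) = y2 /\ y2 < 0.

(* [l] is the Taylor series at u = 0 of the analytic extension, with value 0
   at 0, of the map u |-> 1/y where y = H (1/u). *)
Definition is_germ_at_infinity (H : R -> R -> Prop) (l : nat -> R) : Prop :=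
  Rbar_lt 0 (CV_radius l) /\ l 0%nat = 0 /\
  exists delta, 0 < delta /\
    forall u, 0 < u < delta -> exists y, H (/ u) y /\ PSeries l u = / y.

(* The graph of the displacement map: [d] is Delta(u). *)
Definition displacement (p : params) (u d : R) : Prop :=
  exists y1 y2, left_half_return p (/ u) y1 /\ right_half_return p (/ u) y2 /\
    d = / y1 - / y2.

(* [a i] is the coefficient Delta_i. *)
Definition displacement_series (p : params) (a : nat -> R) : Prop :=
  exists l r, is_germ_at_infinity (left_half_return p) l /\
    is_germ_at_infinity (right_half_return p) r /\
    forall i, a i = l i - r i.

Definition infinity_hyperbolic (p : params) : Prop :=
  exists a, displacement_series p a /\ a 1%nat <> 0.

Definition infinity_stable (p : params) : Prop :=
  exists delta, 0 < delta /\ forall u, 0 < u < delta ->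
    exists y1 y2, left_half_return p (/ u) y1 /\ right_half_return p (/ u) y2 /\
      y1 - y2 < 0.

Definition infinity_unstable (p : params) : Prop :=
  exists delta, 0 < delta /\ forall u, 0 < u < delta ->
    exists y1 y2, left_half_return p (/ u) y1 /\ right_half_return p (/ u) y2 /\
      y1 - y2 > 0.

(* Order k means that Delta_(k+1) is the first nonzero coefficient. *)
Definition infinity_weak_focus (p : params) (k : nat) : Prop :=
  (1 <= k)%nat /\
  exists a, displacement_series p a /\
    (forall i, (i <= k)%nat -> a i = 0) /\ a (S k) <> 0.

Definition infinity_center (p : params) : Prop :=
  exists delta, 0 < delta /\ forall u, 0 < u < delta -> displacement p u 0.

(* By the Filippov convention an orbit crosses x = 0 at (0, y) exactly when the
   two fields have first components of the same strict sign there. *)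
Definition crossing_point (p : params) (y : R) : Prop :=
  0 < fst (left_field p 0 y) * fst (right_field p 0 y).

(* The crossing periodic orbit through (0, 1/u), made of a left and a right arc
   with the same endpoints. *)
Definition crossing_periodic_orbit (p : params) (u : R) : Prop :=
  0 < u /\ exists y1,
    left_half_return p (/ u) y1 /\ right_half_return p (/ u) y1 /\
    crossing_point p (/ u) /\ crossing_point p y1.

Definition crossing_limit_cycle (p : params) (u : R) : Prop :=
  crossing_periodic_orbit p u /\
  exists r, 0 < r /\ forall v, 0 < v -> 0 < Rabs (v - u) < r ->
    ~ displacement p v 0.

Definition params_close (eps : R) (p q : params) : Prop :=
  Rabs (gammaL q - gammaL p) < eps /\ Rabs (gammaR q - gammaR p) < eps /\
  Rabs (alphaL q - alphaL p) < eps /\ Rabs (alphaR q - alphaR p) < eps /\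
  Rabs (bb q - bb p) < eps.

(* Within a fixed neighbourhood 0 < u < delta of infinity, suitable arbitrarily
   small perturbations of [p] have exactly [k] limit cycles, and these tend to
   infinity (u = 0) as the size eps of the perturbation tends to 0. *)
Definition bifurcates_big_limit_cycles (p : params) (k : nat) : Prop :=
  exists delta, 0 < delta /\ forall eps, 0 < eps ->
    exists q, params_close eps p q /\
      exists us : list R, NoDup us /\ length us = k /\
        (forall u, In u us <-> 0 < u < delta /\ crossing_limit_cycle q u) /\
        (forall u, In u us -> u < eps).

(* Main.v *)
Require Import Defs.
From Stdlib Require Import Reals List.
From Coquelicot Require Import Coquelicot.
From Stdlib Require Import Lra Lia Classical IndefiniteDescription.
Open Scope R_scope.

(* Each linear field has a focus, hence a first integral of the form r exp (- gamma theta).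
   Restricted to x = 0 and written in u = 1/y it is |u| exp (g u) with g elementary, and
   the half-return u |-> u l(u) is determined by ln (- l) + g (u l) - g u = - gamma pi.
   Differentiating gives a nonsingular polynomial ODE for l, so l is analytic, with a
   radius and bounds that are locally uniform in the parameters. The right half-return
   is the left one of the time-reversed system.

   Evaluating the right integral along the left map gives a function "gap" with the same
   zeros and signs as Delta and with gap 0 = (gammaL + gammaR) pi. Its derivative is
   a nonvanishing factor times a polynomial S in u and l. When gammaL + gammaR = 0,
   the first nonzero value among S(0), S'(0), S''(0) gives the order of the weak focus;
   if all three vanish, the system is time-reversible with respect to a coordinate axis
   and Delta vanishes. By Rolle, S^(j) <> 0 near infinity bounds the number of zeros by
   j + 1, uniformly in the parameters. Conversely, changing alphaR and b together, then b,
   then gammaR makes S'(0), S(0) and gap 0 nonzero one after the other, each with the sign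
   that creates one more sign change of gap. *)

(** * Polynomial expressions and power series *)

(** Bifurcation fixes a neighbourhood of infinity before the perturbation is chosen and demands an
    exact count of cycles in it. Analyticity for each single parameter is therefore too weak, and
    radii and constants are produced from a bound [G] on the parameters alone. The unknown is the
    quotient l and not the map v = u l, because the equation of v contains v'/v and 1/u, which are
    singular at u = 0, while that of l has leading coefficient 1 there. Delta itself resists Rolle's
    theorem, since its derivative mixes two half-return maps; [gap] involves only the left one. No
    Delta_i with i >= 2 is computed: orders are read off from two-sided bounds by powers of u.
    Continuity of the return maps in the parameters is avoided as well, by testing signs on the
    explicit first integral. Polynomials are syntax trees because one and the same polynomial is
    evaluated at numbers, evaluated at power series and differentiated formally. *)

Inductive pexpr : Type :=
| Pvar (i : nat)
| Pcst (r : R)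
| Padd (e1 e2 : pexpr)
| Pmul (e1 e2 : pexpr).

Fixpoint peval (v : nat -> R) (e : pexpr) : R :=
  match e with
  | Pvar i => v i
  | Pcst r => r
  | Padd e1 e2 => peval v e1 + peval v e2
  | Pmul e1 e2 => peval v e1 * peval v e2
  end.

Definition PS_const (r : R) (n : nat) : R := match n with O => r | S _ => 0 end.

Definition PS_X (n : nat) : R := match n with 1%nat => 1 | _ => 0 end.

Fixpoint pseval (s : nat -> nat -> R) (e : pexpr) : nat -> R :=
  match e with
  | Pvar i => s i
  | Pcst r => PS_const r
  | Padd e1 e2 => PS_plus (pseval s e1) (pseval s e2)
  | Pmul e1 e2 => PS_mult (pseval s e1) (pseval s e2)
  end.

Lemma peval_bounded (e : pexpr) (G : R) :
  exists C, 0 <= C /\ forall v, (forall i, Rabs (v i) <= G) -> Rabs (peval v e) <= C.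
Proof.
  induction e as [i|r|e1 [C1 [P1 H1]] e2 [C2 [P2 H2]]|e1 [C1 [P1 H1]] e2 [C2 [P2 H2]]]; simpl.
  - exists (Rabs G); split; [apply Rabs_pos|]. intros v Hv.
    eapply Rle_trans; [apply Hv|apply Rle_abs].
  - exists (Rabs r); split; [apply Rabs_pos|]. intros; lra.
  - exists (C1 + C2); split; [lra|]. intros v Hv.
    eapply Rle_trans; [apply Rabs_triang|]. specialize (H1 v Hv); specialize (H2 v Hv); lra.
  - exists (C1 * C2); split; [nra|]. intros v Hv. rewrite Rabs_mult.
    apply Rmult_le_compat; try apply Rabs_pos; auto.
Qed.

Lemma peval_lipschitz (e : pexpr) (G : R) :
  exists C, 0 <= C /\ forall v w d,
    (forall i, Rabs (v i) <= G) -> (forall i, Rabs (w i) <= G) ->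
    (forall i, Rabs (v i - w i) <= d) -> Rabs (peval v e - peval w e) <= C * d.
Proof.
  induction e as [i|r|e1 [C1 [P1 H1]] e2 [C2 [P2 H2]]|e1 [C1 [P1 H1]] e2 [C2 [P2 H2]]]; simpl.
  - exists 1; split; [lra|]. intros v w d _ _ H. rewrite Rmult_1_l. apply H.
  - exists 0; split; [lra|]. intros. rewrite Rminus_diag, Rabs_R0. lra.
  - exists (C1 + C2); split; [lra|]. intros v w d Hv Hw Hd.
    replace (_ - _) with ((peval v e1 - peval w e1) + (peval v e2 - peval w e2)) by ring.
    eapply Rle_trans; [apply Rabs_triang|].
    specialize (H1 v w d Hv Hw Hd); specialize (H2 v w d Hv Hw Hd); lra.
  - destruct (peval_bounded e1 G) as [B1 [Q1 K1]], (peval_bounded e2 G) as [B2 [Q2 K2]].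
    exists (C1 * B2 + B1 * C2); split; [nra|]. intros v w d Hv Hw Hd.
    replace (_ - _) with ((peval v e1 - peval w e1) * peval v e2
                          + peval w e1 * (peval v e2 - peval w e2)) by ring.
    eapply Rle_trans; [apply Rabs_triang|]. rewrite !Rabs_mult.
    rewrite Rmult_plus_distr_r. apply Rplus_le_compat.
    + replace (C1 * B2 * d) with (C1 * d * B2) by ring.
      apply Rmult_le_compat; try apply Rabs_pos; auto.
    + rewrite Rmult_assoc. apply Rmult_le_compat; try apply Rabs_pos; auto.
Qed.

(** * A majorant for power series with polynomial recursions *)

(** The decay 1/(n+1)^2 makes sequences bounded by [M * K ^ n * maj n] stable under Cauchy products
    with the same [K], which plain geometric bounds are not; a product only costs the factor 8 of
    [maj_conv]. *)
Definition maj (n : nat) : R := / (INR n + 1) ^ 2.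

Lemma maj_pos n : 0 < maj n.
Proof. unfold maj. apply Rinv_0_lt_compat. pose proof (pos_INR n). nra. Qed.

Lemma maj_le_1 n : maj n <= 1.
Proof.
  unfold maj. rewrite <- Rinv_1. apply Rinv_le_contravar; [lra|].
  pose proof (pos_INR n). nra.
Qed.

Lemma maj_succ n : maj n <= 4 * maj (S n).
Proof.
  unfold maj. rewrite S_INR. pose proof (pos_INR n).
  apply (Rmult_le_reg_r ((INR n + 1) ^ 2 * (INR n + 1 + 1) ^ 2)); [nra|].
  field_simplify; nra.
Qed.

Lemma sum_maj_le n : sum_f_R0 maj n <= 2 - / (INR n + 1).
Proof.
  induction n as [|n IH].
  - unfold maj; simpl. field_simplify; lra.
  - simpl sum_f_R0. eapply Rle_trans; [apply Rplus_le_compat_r, IH|].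
    unfold maj. rewrite S_INR. pose proof (pos_INR n).
    apply (Rmult_le_reg_r ((INR n + 1) * (INR n + 1 + 1) ^ 2)); [nra|].
    field_simplify; nra.
Qed.

Lemma sum_f_R0_rev (f : nat -> R) n :
  sum_f_R0 (fun k => f (n - k)%nat) n = sum_f_R0 f n.
Proof.
  rewrite <- !sum_n_Reals.
  assert (H : forall m, (m <= n)%nat ->
    sum_n (fun k => f (n - k)%nat) m + (if Nat.eq_dec m n then 0 else sum_n f (n - S m)) = sum_n f n).
  { induction m as [|m IH]; intros Hm.
    - rewrite sum_O, Nat.sub_0_r. destruct (Nat.eq_dec 0 n) as [<-|Hn].
      + rewrite sum_O; ring.
      + destruct n as [|n]; [lia|]. rewrite sum_Sn. unfold plus; cbn -[Nat.eq_dec Nat.sub].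
        replace (S n - 1)%nat with n by lia. ring.
    - rewrite <- (IH ltac:(lia)). rewrite sum_Sn. unfold plus; cbn -[Nat.eq_dec Nat.sub].
      destruct (Nat.eq_dec m n); [lia|].
      destruct (Nat.eq_dec (S m) n) as [<-|Hn].
      + rewrite !Nat.sub_diag, sum_O. ring.
      + replace (n - S m)%nat with (S (n - S (S m))) by lia. rewrite sum_Sn.
        unfold plus; cbn -[Nat.eq_dec Nat.sub]. ring. }
  specialize (H n (le_n n)). destruct (Nat.eq_dec n n); [lra|lia].
Qed.

(* 1/((k+1)(n-k+1)) = (1/(k+1) + 1/(n-k+1))/(n+2), squared. *)
Lemma maj_conv n : sum_f_R0 (fun k => maj k * maj (n - k)) n <= 8 * maj n.
Proof.
  apply Rle_trans with (sum_f_R0 (fun k => maj k * (2 * maj n) + maj (n - k) * (2 * maj n)) n).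
  - apply sum_Rle. intros k Hk. unfold maj. rewrite minus_INR by exact Hk.
    assert (Hk' : INR k <= INR n) by (apply le_INR; exact Hk).
    pose proof (pos_INR k) as P.
    assert (Hx : exists x, x = INR k + 1) by eauto. destruct Hx as [x Hx].
    assert (Hy : exists y, y = INR n - INR k + 1) by eauto. destruct Hy as [y Hy].
    replace (INR n) with (x + y - 2) by lra. replace (x + y - 2 - INR k + 1) with y by lra.
    rewrite <- Hx. replace (x + y - 2 + 1) with (x + y - 1) by ring.
    assert (1 <= x) by lra. assert (1 <= y) by lra. clear Hx Hy P Hk Hk'.
    apply Rminus_le_0.
    replace (_ - _) with ((2 * (x ^ 2 + y ^ 2) - (x + y - 1) ^ 2) * / (x ^ 2 * y ^ 2 * (x + y - 1) ^ 2))
      by (field; lra).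
    apply Rmult_le_pos; [pose proof (pow2_ge_0 (x - y)); nra|]. left. apply Rinv_0_lt_compat.
    apply Rmult_lt_0_compat; [apply Rmult_lt_0_compat|]; nra.
  - rewrite sum_plus, <- !scal_sum.
    rewrite (sum_f_R0_rev maj n).
    pose proof (sum_maj_le n). pose proof (maj_pos n).
    assert (0 < / (INR n + 1)) by (apply Rinv_0_lt_compat; pose proof (pos_INR n); lra).
    nra.
Qed.

Definition majorized (M K : R) (n : nat) (a : nat -> R) : Prop :=
  forall k, (k <= n)%nat -> Rabs (a k) <= M * K ^ k * maj k.

Lemma PS_mult_majorized M1 M2 K n a b : 0 <= M1 -> 0 <= M2 -> 0 <= K ->
  majorized M1 K n a -> majorized M2 K n b ->
  majorized (8 * (M1 * M2)) K n (PS_mult a b).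
Proof.
  intros H1 H2 HK Ha Hb k Hk. unfold PS_mult.
  eapply Rle_trans; [apply Rsum_abs|].
  apply Rle_trans with (sum_f_R0 (fun i => (maj i * maj (k - i)) * (M1 * M2 * K ^ k)) k).
  - apply sum_Rle. intros i Hi. rewrite Rabs_mult.
    replace (K ^ k) with (K ^ i * K ^ (k - i)) by (rewrite <- pow_add; f_equal; lia).
    replace (_ * _ * (_ * _)) with ((M1 * K ^ i * maj i) * (M2 * K ^ (k - i) * maj (k - i))) by ring.
    apply Rmult_le_compat; try apply Rabs_pos; [apply Ha|apply Hb]; lia.
  - rewrite <- scal_sum. pose proof (maj_conv k).
    assert (0 <= M1 * M2 * K ^ k) by (apply Rmult_le_pos; [nra|apply pow_le, HK]). nra.
Qed.

Lemma pseval_majorized (e : pexpr) (G : R) : 0 <= G ->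
  exists M, 0 <= M /\ forall s K n, 1 <= K ->
    (forall i, majorized G K n (s i)) -> majorized M K n (pseval s e).
Proof.
  intros HG.
  induction e as [i|r|e1 [C1 [P1 H1]] e2 [C2 [P2 H2]]|e1 [C1 [P1 H1]] e2 [C2 [P2 H2]]]; simpl.
  - exists G; split; auto.
  - exists (Rabs r); split; [apply Rabs_pos|]. intros s K n HK _ k _.
    destruct k as [|k]; simpl.
    + unfold maj; simpl. right. field.
    + rewrite Rabs_R0. pose proof (Rabs_pos r). pose proof (maj_pos (S k)).
      assert (0 < K ^ S k) by (apply pow_lt; lra). simpl in H1.
      apply Rmult_le_pos; [apply Rmult_le_pos|]; simpl in *; lra.
  - exists (C1 + C2); split; [lra|]. intros s K n HK Hs k Hk. unfold PS_plus.
    eapply Rle_trans; [apply Rabs_triang|].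
    specialize (H1 s K n HK Hs k Hk); specialize (H2 s K n HK Hs k Hk). lra.
  - exists (8 * (C1 * C2)); split; [nra|]. intros s K n HK Hs.
    apply PS_mult_majorized; try lra; auto.
Qed.

(** It makes [ode_step] insensitive to the unfinished part of a sequence, as [course_of_values_succ]
    demands. *)
Lemma pseval_causal (e : pexpr) s s' n :
  (forall i k, (k <= n)%nat -> s i k = s' i k) ->
  forall k, (k <= n)%nat -> pseval s e k = pseval s' e k.
Proof.
  intros H. induction e as [i|r|e1 IH1 e2 IH2|e1 IH1 e2 IH2]; simpl; intros k Hk; auto.
  - unfold PS_plus. now rewrite IH1, IH2.
  - unfold PS_mult. apply sum_eq. intros i Hi. now rewrite IH1, IH2 by lia.
Qed.

Lemma geometric_bound (a : nat -> R) (M K : R) : 0 <= M -> 0 < K ->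
  (forall n, Rabs (a n) <= M * K ^ n) ->
  forall x, Rabs x <= / (2 * K) ->
    Rbar_lt (Rabs x) (CV_radius a) /\ Rabs (PSeries a x) <= 2 * M.
Proof.
  intros HM HK Ha x Hx. split.
  - apply Rbar_lt_le_trans with (/ K).
    + simpl. eapply Rle_lt_trans; [exact Hx|]. apply Rinv_lt_contravar; nra.
    + apply CV_radius_bounded. exists M. intros n. rewrite Rabs_mult.
      rewrite (Rabs_pos_eq ((/ K) ^ n)) by (apply pow_le; left; apply Rinv_0_lt_compat, HK).
      rewrite pow_inv. apply Rmult_le_reg_r with (K ^ n); [apply pow_lt, HK|].
      rewrite Rmult_assoc, Rinv_l, Rmult_1_r; [apply Ha|]. apply pow_nonzero; lra.
  - assert (Hn : forall n, 0 <= Rabs (a n * x ^ n) <= M * (/ 2) ^ n).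
    { intros n. split; [apply Rabs_pos|]. rewrite Rabs_mult, <- RPow_abs.
      apply Rle_trans with (M * K ^ n * (/ (2 * K)) ^ n).
      - apply Rmult_le_compat; [apply Rabs_pos|apply pow_le, Rabs_pos|apply Ha|].
        apply pow_incr. split; [apply Rabs_pos|exact Hx].
      - rewrite Rmult_assoc, <- Rpow_mult_distr. right. do 2 f_equal. field. lra. }
    assert (G : ex_series (fun n => M * (/ 2) ^ n)).
    { apply (ex_series_scal (K := R_AbsRing) (V := R_NormedModule)).
      apply ex_series_geom. rewrite Rabs_pos_eq; lra. }
    unfold PSeries. eapply Rle_trans; [apply Series_Rabs|].
    + apply (ex_series_le (K := R_AbsRing) (V := R_CompleteNormedModule)) with (2 := G).
      intros n. unfold norm; simpl. unfold abs; simpl. rewrite Rabs_Rabsolu. apply Hn.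
    + eapply Rle_trans; [apply Series_le; [apply Hn|exact G]|].
      rewrite Series_scal_l, Series_geom by (rewrite Rabs_pos_eq; lra). right. field.
Qed.

(** [F] takes a whole sequence, so stage n is a total table: its entries up to n are final, the
    later ones repeat the last value and mean nothing. For an [F] that ignores them the recursion
    [course_of_values_succ] holds. *)
Fixpoint course (F : (nat -> R) -> nat -> R) (c0 : R) (n : nat) : nat -> R :=
  match n with
  | O => fun _ => c0
  | S m => fun k => if (k <=? m)%nat then course F c0 m k else F (course F c0 m) m
  end.

Definition course_of_values F c0 (n : nat) : R := course F c0 n n.

Lemma course_stable F c0 n k : (k <= n)%nat -> course F c0 n k = course_of_values F c0 k.
Proof.
  induction n as [|n IH]; intros H; unfold course_of_values.
  - now replace k with 0%nat by lia.
  - destruct (Nat.eq_dec k (S n)) as [->|Hk]; [reflexivity|].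
    simpl. destruct (Nat.leb_spec k n); [apply IH; lia|lia].
Qed.

Lemma course_of_values_succ F c0 n :
  (forall a b m, (forall k, (k <= m)%nat -> a k = b k) -> F a m = F b m) ->
  course_of_values F c0 (S n) = F (course_of_values F c0) n.
Proof.
  intros HF. unfold course_of_values at 1. cbn [course].
  destruct (Nat.leb_spec (S n) n); [lia|]. apply HF. intros k Hk. now apply course_stable.
Qed.

(* Variable 0 is the independent variable u, variable 1 the unknown function,
   and the variables from 2 on are parameters. *)
Definition env (u y : R) (par : nat -> R) (i : nat) : R :=
  match i with O => u | S O => y | S (S j) => par j end.

Definition senv (y : nat -> R) (par : nat -> R) (i : nat) : nat -> R :=
  match i with O => PS_X | S O => y | S (S j) => PS_const (par j) end.

(** Comparison of the coefficients of u^n: u y' has coefficients k c_k, so the factor u before Q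
    keeps c_(n+1) out of the product and the recursion is explicit. *)
Definition ode_step (P Q : pexpr) (par c : nat -> R) (n : nat) : R :=
  (pseval (senv c par) P n
   - PS_mult (pseval (senv c par) Q) (fun k => INR k * c k) n) / INR (S n).

(* The Taylor coefficients of the solution of (1 + u Q(u,y)) y' = P(u,y), y(0) = c0. *)
Definition ode_coef (P Q : pexpr) (par : nat -> R) (c0 : R) : nat -> R :=
  course_of_values (ode_step P Q par) c0.

Lemma ode_coef_succ P Q par c0 n :
  ode_coef P Q par c0 (S n) = ode_step P Q par (ode_coef P Q par c0) n.
Proof.
  apply course_of_values_succ. intros a b m H. unfold ode_step. f_equal.
  assert (Hs : forall i k, (k <= m)%nat -> senv a par i k = senv b par i k).
  { intros [|[|i]] k Hk; simpl; auto. }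
  f_equal.
  - apply (pseval_causal P _ _ m Hs). lia.
  - unfold PS_mult. apply sum_eq. intros i Hi.
    now rewrite (pseval_causal Q _ _ m Hs i Hi), H by lia.
Qed.

(** Induction on n: in the product with k c_k the factor k is at most n + 1 and is cancelled by the
    division by n + 1. The convolution costs 8 and the passage from n to n + 1 costs 4 by
    [maj_succ]; [K] is chosen to pay for both. *)
Lemma ode_coef_majorized (P Q : pexpr) (G : R) : 4 <= G ->
  exists K, 1 <= K /\ forall par c0, (forall i, Rabs (par i) <= G) -> Rabs c0 <= G ->
    forall n, majorized G K n (ode_coef P Q par c0).
Proof.
  intros HG.
  destruct (pseval_majorized P G ltac:(lra)) as [MP [HP0 HP]].
  destruct (pseval_majorized Q G ltac:(lra)) as [MQ [HQ0 HQ]].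
  exists (1 + 4 * (MP + 8 * (MQ * G))).
  set (K := 1 + 4 * (MP + 8 * (MQ * G))).
  assert (HK : 1 <= K) by (unfold K; nra).
  split; [exact HK|]. intros par c0 Hpar Hc0.
  set (c := ode_coef P Q par c0).
  induction n as [|n IH].
  - intros k Hk. replace k with 0%nat by lia. simpl. unfold maj; simpl.
    unfold c, ode_coef, course_of_values; simpl. field_simplify; lra.
  - intros k Hk. destruct (Nat.eq_dec k (S n)) as [->|Hkn]; [|apply IH; lia].
    assert (Hpow : forall m, 1 <= K ^ m) by (intros m; apply pow_R1_Rle; exact HK).
    assert (Hs : forall i, majorized G K n (senv c par i)).
    { intros [|[|i]]; simpl; auto.
      - intros [|[|j]] Hj; unfold PS_X.
        + rewrite Rabs_R0. pose proof (maj_pos 0); simpl; nra.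
        (* [maj 1] is 1/4, so the coefficient 1 in the series of u calls for [4 <= G]. *)
        + rewrite Rabs_R1. unfold maj; simpl. field_simplify; nra.
        + rewrite Rabs_R0. pose proof (maj_pos (S (S j))). specialize (Hpow (S (S j))).
          apply Rmult_le_pos; [apply Rmult_le_pos|]; lra.
      - intros [|j] Hj; simpl.
        + unfold maj; simpl. replace (_ * _ * _) with G by field. auto.
        + rewrite Rabs_R0. pose proof (maj_pos (S j)). specialize (Hpow (S j)).
          apply Rmult_le_pos; [apply Rmult_le_pos|]; simpl in *; lra. }
    specialize (HP _ _ _ HK Hs). specialize (HQ _ _ _ HK Hs).
    unfold c. rewrite ode_coef_succ. fold c. unfold ode_step.
    assert (Hn : 1 <= INR (S n)) by (rewrite S_INR; pose proof (pos_INR n); lra).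
    set (p := pseval (senv c par) P) in *. set (q := pseval (senv c par) Q) in *.
    assert (H2 : Rabs (PS_mult q (fun k => INR k * c k) n)
                 <= INR (S n) * (8 * (MQ * G) * K ^ n * maj n)).
    { unfold PS_mult. eapply Rle_trans; [apply Rsum_abs|].
      apply Rle_trans with
        (sum_f_R0 (fun i => (maj i * maj (n - i)) * (INR (S n) * (MQ * G * K ^ n))) n).
      - apply sum_Rle. intros i Hi. rewrite !Rabs_mult.
        rewrite (Rabs_pos_eq (INR _)) by apply pos_INR.
        replace (K ^ n) with (K ^ i * K ^ (n - i)) by (rewrite <- pow_add; f_equal; lia).
        replace (maj i * _ * _) with
          ((MQ * K ^ i * maj i) * (INR (S n) * (G * K ^ (n - i) * maj (n - i)))) by ring.
        apply Rmult_le_compat; [apply Rabs_pos| |apply HQ, Hi|].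
        + apply Rmult_le_pos; [apply pos_INR|apply Rabs_pos].
        + apply Rmult_le_compat; [apply pos_INR|apply Rabs_pos| |apply IH; lia].
          apply le_INR; lia.
      - rewrite <- scal_sum. pose proof (maj_conv n).
        assert (0 <= INR (S n) * (MQ * G * K ^ n)).
        { apply Rmult_le_pos; [lra|]. apply Rmult_le_pos; [nra|]. specialize (Hpow n); lra. }
        nra. }
    unfold Rdiv. rewrite Rabs_mult, (Rabs_pos_eq (/ _)) by (left; apply Rinv_0_lt_compat; lra).
    apply (Rmult_le_reg_r (INR (S n))); [lra|]. rewrite Rmult_assoc, Rinv_l, Rmult_1_r by lra.
    eapply Rle_trans; [apply Rabs_triang|]. rewrite Rabs_Ropp.
    specialize (HP n (le_n n)). pose proof (maj_succ n) as Hm. specialize (Hpow n).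
    pose proof (maj_pos n). pose proof (maj_pos (S n)).
    assert (H3 : MP * K ^ n * maj n <= INR (S n) * (MP * K ^ n * maj n)).
    { assert (0 <= MP * K ^ n * maj n) by (apply Rmult_le_pos; [apply Rmult_le_pos|]; lra). nra. }
    apply Rle_trans with (INR (S n) * ((MP + 8 * (MQ * G)) * K ^ n * maj n)); [nra|].
    rewrite (Rmult_comm _ (INR (S n))). apply Rmult_le_compat_l; [lra|].
    apply Rle_trans with ((MP + 8 * (MQ * G)) * K ^ n * (4 * maj (S n))).
    + apply Rmult_le_compat_l; [|exact Hm]. apply Rmult_le_pos; [|lra].
      assert (0 <= MQ * G) by nra. lra.
    + simpl pow. replace (G * (K * K ^ n) * maj (S n)) with (G * K * (K ^ n * maj (S n))) by ring.
      replace (_ * _ * (_ * _)) with (4 * (MP + 8 * (MQ * G)) * (K ^ n * maj (S n))) by ring.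
      apply Rmult_le_compat_r; [apply Rmult_le_pos; lra|]. unfold K.
      assert (0 <= MQ * G) by nra. nra.
Qed.

Lemma Rbar_lt_between (x : R) (r : Rbar) : Rbar_lt x r -> exists y : R, x < y /\ Rbar_lt y r.
Proof.
  destruct r as [r| |]; simpl; intros H; [|exists (x + 1); lra|contradiction].
  exists ((x + r) / 2); lra.
Qed.

Lemma ex_pseries_CV_radius (a : nat -> R) (x : R) :
  ex_pseries a x -> Rbar_le (Rabs x) (CV_radius a).
Proof.
  intros H. apply Rbar_not_lt_le. intros Hlt.
  apply (CV_disk_outside a x Hlt). apply ex_series_lim_0.
  apply (ex_series_ext (K := R_AbsRing) (V := R_NormedModule)) with (2 := H).
  intros n. unfold scal; simpl. unfold mult; simpl. rewrite pow_n_pow. ring.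
Qed.

Lemma CV_radius_mult_gt (a b : nat -> R) (x : R) :
  Rbar_lt (Rabs x) (CV_radius a) -> Rbar_lt (Rabs x) (CV_radius b) ->
  Rbar_lt (Rabs x) (CV_radius (PS_mult a b)).
Proof.
  intros Ha Hb.
  destruct (Rbar_lt_between _ _ Ha) as [y [Hy1 Hy2]].
  destruct (Rbar_lt_between _ _ Hb) as [z [Hz1 Hz2]].
  pose proof (Rabs_pos x).
  assert (Hm : Rabs x < Rmin y z) by (apply Rmin_glb_lt; assumption).
  apply Rbar_lt_le_trans with (Rabs (Rmin y z)); [simpl; rewrite (Rabs_pos_eq (Rmin y z)); lra|].
  apply ex_pseries_CV_radius, ex_pseries_mult; rewrite Rabs_pos_eq by lra.
  - eapply Rbar_le_lt_trans; [|exact Hy2]. apply Rmin_l.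
  - eapply Rbar_le_lt_trans; [|exact Hz2]. apply Rmin_r.
Qed.

Lemma PS_const_PSeries r x :
  Rbar_lt (Rabs x) (CV_radius (PS_const r)) /\ PSeries (PS_const r) x = r.
Proof.
  destruct (geometric_bound (PS_const r) (Rabs r) (/ (2 * (Rabs x + 1)))) with (x := x) as [H _].
  - apply Rabs_pos.
  - pose proof (Rabs_pos x). apply Rinv_0_lt_compat; lra.
  - intros [|n]; simpl; [lra|]. rewrite Rabs_R0. apply Rmult_le_pos; [apply Rabs_pos|].
    change (0 <= (/ (2 * (Rabs x + 1))) ^ S n). pose proof (Rabs_pos x). apply pow_le. left.
    apply Rinv_0_lt_compat; lra.
  - pose proof (Rabs_pos x).
    replace (/ (2 * / (2 * (Rabs x + 1)))) with (Rabs x + 1) by (field; lra). lra.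
  - split; [exact H|]. rewrite PSeries_decr_1 by now apply CV_radius_inside.
    simpl. rewrite (PSeries_ext _ (fun _ => 0)) by reflexivity. rewrite PSeries_const_0. ring.
Qed.

Lemma PS_X_PSeries x :
  Rbar_lt (Rabs x) (CV_radius PS_X) /\ PSeries PS_X x = x.
Proof.
  assert (E : forall n, PS_X n = PS_incr_1 (PS_const 1) n) by (intros [|[|n]]; reflexivity).
  destruct (PS_const_PSeries 1 x) as [H1 H2].
  rewrite (CV_radius_ext _ _ E), (PSeries_ext _ _ x E), PSeries_incr_1, H2.
  split; [|ring]. now rewrite CV_radius_incr_1.
Qed.

Lemma pseval_PSeries (e : pexpr) s v x :
  (forall i, Rbar_lt (Rabs x) (CV_radius (s i)) /\ PSeries (s i) x = v i) ->
  Rbar_lt (Rabs x) (CV_radius (pseval s e)) /\ PSeries (pseval s e) x = peval v e.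
Proof.
  intros H.
  induction e as [i|r|e1 [R1 E1] e2 [R2 E2]|e1 [R1 E1] e2 [R2 E2]]; simpl.
  - apply H.
  - apply PS_const_PSeries.
  - split.
    + refine (Rbar_lt_le_trans (Finite (Rabs x)) _ _ _ (CV_radius_plus _ _)).
      destruct (CV_radius (pseval s e1)), (CV_radius (pseval s e2)); simpl in *; auto.
      apply Rmin_glb_lt; auto.
    + rewrite PSeries_plus; [now rewrite E1, E2|now apply CV_radius_inside|now apply CV_radius_inside].
  - split; [now apply CV_radius_mult_gt|]. now rewrite PSeries_mult, E1, E2.
Qed.

(** The weights [maj] absorb the factors n + 1 and (n + 1)(n + 2) of two differentiations, so the
    series and its first two derivatives share one geometric bound, with [K ^ 2] for the shift of
    the index; half of the radius 1/K serves all three. *)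
Theorem ode_analytic_solution (P Q : pexpr) (G : R) : 4 <= G ->
  exists r M, 0 < r /\ 0 <= M /\ forall par c0, (forall i, Rabs (par i) <= G) -> Rabs c0 <= G ->
    let c := ode_coef P Q par c0 in
    PSeries c 0 = c0 /\
    forall u, Rabs u <= r ->
      Rbar_lt (Rabs u) (CV_radius c) /\
      Rabs (PSeries c u) <= M /\ Rabs (PSeries (PS_derive c) u) <= M /\
      Rabs (PSeries (PS_derive (PS_derive c)) u) <= M /\
      is_derive (PSeries c) u (PSeries (PS_derive c) u) /\
      is_derive (PSeries (PS_derive c)) u (PSeries (PS_derive (PS_derive c)) u) /\
      let v := env u (PSeries c u) par in
      (1 + u * peval v Q) * PSeries (PS_derive c) u = peval v P.
Proof.
  intros HG. destruct (ode_coef_majorized P Q G HG) as [K [HK Hmaj]].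
  exists (/ (2 * K)), (2 * (G * K ^ 2)).
  split; [apply Rinv_0_lt_compat; lra|]. split; [nra|].
  intros par c0 Hpar Hc0 c.
  assert (Hc : forall n, Rabs (c n) <= G * K ^ n * maj n)
    by (intros n; exact (Hmaj par c0 Hpar Hc0 n n (le_n n))).
  assert (Hpow : forall m, 1 <= K ^ m) by (intros m; apply pow_R1_Rle; exact HK).
  split.
  { rewrite PSeries_0. reflexivity. }
  intros u Hu.
  assert (H0 : forall n, Rabs (c n) <= G * K ^ 2 * K ^ n).
  { intros n. eapply Rle_trans; [apply Hc|]. pose proof (maj_le_1 n). pose proof (maj_pos n).
    pose proof (Hpow n). pose proof (Hpow 2%nat).
    assert (0 <= G * K ^ n) by nra. apply Rle_trans with (G * K ^ n); [nra|].
    replace (G * K ^ 2 * K ^ n) with (G * K ^ n * K ^ 2) by ring. nra. }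
  assert (H1 : forall n, Rabs (PS_derive c n) <= G * K ^ 2 * K ^ n).
  { intros n. unfold PS_derive. rewrite Rabs_mult, Rabs_pos_eq by apply pos_INR.
    pose proof (pos_INR (S n)). pose proof (Hpow n).
    eapply Rle_trans; [apply Rmult_le_compat_l; [lra|apply Hc]|].
    replace (INR (S n) * (G * K ^ S n * maj (S n))) with (G * K ^ S n * (INR (S n) * maj (S n))) by ring.
    assert (INR (S n) * maj (S n) <= 1).
    { unfold maj. apply (Rmult_le_reg_r ((INR (S n) + 1) ^ 2)); [nra|].
      rewrite Rmult_assoc, Rinv_l by nra. nra. }
    replace (G * K ^ 2 * K ^ n) with (G * K ^ S n * K) by (simpl; ring).
    assert (0 <= G * K ^ S n) by (pose proof (Hpow (S n)); nra). nra. }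
  assert (H2 : forall n, Rabs (PS_derive (PS_derive c) n) <= G * K ^ 2 * K ^ n).
  { intros n. unfold PS_derive. rewrite !Rabs_mult, !Rabs_pos_eq by apply pos_INR.
    pose proof (pos_INR (S n)). pose proof (pos_INR (S (S n))).
    replace (G * K ^ 2 * K ^ n) with (G * K ^ S (S n)) by (simpl; ring).
    rewrite <- Rmult_assoc.
    eapply Rle_trans; [apply Rmult_le_compat_l; [nra|apply Hc]|].
    assert (INR (S n) * INR (S (S n)) * maj (S (S n)) <= 1).
    { unfold maj. rewrite !S_INR in *. apply (Rmult_le_reg_r ((INR n + 1 + 1 + 1) ^ 2)); [nra|].
      rewrite Rmult_assoc, Rinv_l by nra. nra. }
    assert (0 <= G * K ^ S (S n)) by (pose proof (Hpow (S (S n))); nra). nra. }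
  assert (HGK : 0 <= G * K ^ 2) by (pose proof (Hpow 2%nat); nra).
  destruct (geometric_bound c _ K HGK ltac:(lra) H0 u Hu) as [R0 B0].
  destruct (geometric_bound _ _ K HGK ltac:(lra) H1 u Hu) as [R1 B1].
  destruct (geometric_bound _ _ K HGK ltac:(lra) H2 u Hu) as [R2 B2].
  assert (Hs : forall i, Rbar_lt (Rabs u) (CV_radius (senv c par i)) /\
                         PSeries (senv c par i) u = env u (PSeries c u) par i).
  { intros [|[|i]]; simpl; [apply PS_X_PSeries|auto|apply PS_const_PSeries]. }
  repeat (split; [assumption || apply is_derive_PSeries; assumption|]).
  intros v.
  destruct (pseval_PSeries P _ _ u Hs) as [RP EP].
  destruct (pseval_PSeries Q _ _ u Hs) as [RQ EQ].
  fold v in EP, EQ.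
  assert (HT : forall n, INR n * c n = PS_incr_1 (PS_derive c) n).
  { intros [|n]; simpl; [unfold zero; simpl; ring|reflexivity]. }
  assert (Hsum : forall n, PS_derive c n =
     PS_minus (pseval (senv c par) P)
              (PS_mult (pseval (senv c par) Q) (PS_incr_1 (PS_derive c))) n).
  { intros n. unfold PS_derive at 1. unfold c at 1. rewrite ode_coef_succ. fold c.
    unfold ode_step. unfold PS_minus, PS_plus, PS_opp, plus, opp; simpl opp; simpl.
    unfold PS_mult. rewrite (sum_eq (fun k => _ * (INR (n - k) * _))
      (fun k => pseval (senv c par) Q k * PS_incr_1 (PS_derive c) (n - k))).
    2: { intros i _. now rewrite HT. }
    field. apply (not_INR (S n) 0). lia. }
  rewrite (Rmult_plus_distr_r 1).
  rewrite (PSeries_ext _ _ u Hsum) at 1.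
  assert (RI : Rbar_lt (Rabs u) (CV_radius (PS_incr_1 (PS_derive c)))).
  { rewrite CV_radius_incr_1. exact R1. }
  rewrite PSeries_minus, PSeries_mult, PSeries_incr_1, EP, EQ; auto.
  - ring.
  - now apply CV_radius_inside.
  - now apply ex_pseries_mult.
Qed.

(** * The left half-return map near infinity *)

(* The left field is Z' = (gammaL - i) Z in a complex coordinate Z, centred at its
   focus (A, 2 gammaL A - b), in which the point (0, y) is -(A + i (y + B)). *)
Definition cA (p : params) : R := alphaL p / (1 + gammaL p ^ 2).
Definition cB (p : params) : R := bb p - gammaL p * cA p.
Definition cC (p : params) : R := cA p ^ 2 + cB p ^ 2.
Definition cE (p : params) (x : R) : R := 1 + 2 * cB p * x + cC p * x ^ 2.

(** Up to sign and an additive constant on each half-axis, ln |x| + [log_spiral p x] is the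
    logarithm of the first integral at (0, 1/x): [cE p x] is x^2 times the squared modulus of Z, and
    the arctangent is the angle of Z with the imaginary axis. The half-turn between the two
    half-axes accounts for the term gammaL pi in [rf_int]. *)
Definition log_spiral (p : params) (x : R) : R :=
  - / 2 * ln (cE p x) + gammaL p * atan (cA p * x / (1 + cB p * x)).

Definition pbound (G : R) (p : params) : Prop :=
  Rabs (gammaL p) <= G /\ Rabs (gammaR p) <= G /\ Rabs (alphaL p) <= G /\
  Rabs (alphaR p) <= G /\ Rabs (bb p) <= G.

(** Up to this modulus of x, the products of x with [cA p], [cB p] and [bb p] are at most 1/8 in
    modulus; 1 + G + G^2 dominates all three coefficients under [pbound G p]. *)
Definition safe (G : R) : R := / (8 * (1 + G + G ^ 2)).

Lemma cA_bound G p : pbound G p -> Rabs (cA p) <= G.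
Proof.
  intros (_ & _ & H & _). unfold cA, Rdiv. rewrite Rabs_mult.
  assert (0 < 1 + gammaL p ^ 2) by (pose proof (pow2_ge_0 (gammaL p)); lra).
  rewrite (Rabs_pos_eq (/ _)) by (left; now apply Rinv_0_lt_compat).
  pose proof (Rabs_pos (alphaL p)).
  assert (/ (1 + gammaL p ^ 2) <= 1).
  { rewrite <- Rinv_1. apply Rinv_le_contravar; [lra|]. pose proof (pow2_ge_0 (gammaL p)); lra. }
  nra.
Qed.

Lemma cB_bound G p : pbound G p -> Rabs (cB p) <= G + G ^ 2.
Proof.
  intros H. pose proof (cA_bound G p H) as HA. destruct H as (Hg & _ & _ & _ & Hb).
  unfold cB. eapply Rle_trans; [apply Rabs_triang|]. rewrite Rabs_Ropp, Rabs_mult.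
  pose proof (Rabs_pos (cA p)). pose proof (Rabs_pos (gammaL p)). nra.
Qed.

Lemma pbound_pos G p : pbound G p -> 0 <= G.
Proof. intros (H & _). pose proof (Rabs_pos (gammaL p)). lra. Qed.

Lemma cC_bound G p : pbound G p -> Rabs (cC p) <= G ^ 2 + (G + G ^ 2) ^ 2.
Proof.
  intros H. pose proof (cA_bound G p H) as HA. pose proof (cB_bound G p H) as HB.
  unfold cC. rewrite Rabs_pos_eq by nra.
  rewrite <- (pow2_abs (cA p)), <- (pow2_abs (cB p)).
  pose proof (Rabs_pos (cA p)). pose proof (Rabs_pos (cB p)).
  apply Rplus_le_compat; apply pow_incr; lra.
Qed.

Lemma safe_pos G : 0 <= G -> 0 < safe G.
Proof. intros. apply Rinv_0_lt_compat. nra. Qed.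

Lemma mult_safe G a x : 0 <= G -> Rabs a <= G + G ^ 2 -> Rabs x <= safe G ->
  Rabs (a * x) <= / 8.
Proof.
  intros HG Ha Hx. rewrite Rabs_mult.
  apply Rle_trans with ((1 + G + G ^ 2) * safe G).
  - apply Rmult_le_compat; try apply Rabs_pos; lra.
  - unfold safe. right. field. nra.
Qed.

Lemma safe_bounds G p x : pbound G p -> Rabs x <= safe G ->
  / 2 <= 1 + cB p * x /\ / 2 <= 1 + bb p * x /\ Rabs (cA p * x) <= / 8.
Proof.
  intros Hp Hx. pose proof (pbound_pos G p Hp) as HG.
  assert (HA := cA_bound G p Hp). assert (HB := cB_bound G p Hp).
  assert (Hb : Rabs (bb p) <= G) by apply Hp.
  assert (HA' : Rabs (cA p) <= G + G ^ 2) by nra.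
  assert (Hb' : Rabs (bb p) <= G + G ^ 2) by nra.
  pose proof (mult_safe G _ x HG HA' Hx). pose proof (mult_safe G _ x HG HB Hx) as H1.
  pose proof (mult_safe G _ x HG Hb' Hx) as H2.
  apply Rabs_le_between in H1. apply Rabs_le_between in H2.
  repeat split; lra.
Qed.

Lemma cE_squares p x : cE p x = (1 + cB p * x) ^ 2 + (cA p * x) ^ 2.
Proof. unfold cE, cC. ring. Qed.

Lemma cE_pos p x : / 2 <= 1 + cB p * x -> / 4 <= cE p x.
Proof. intros. rewrite cE_squares. pose proof (pow2_ge_0 (cA p * x)). nra. Qed.

Lemma is_derive_log_spiral p x : / 2 <= 1 + cB p * x ->
  is_derive (log_spiral p) x ((bb p - 2 * cB p - cC p * x) / cE p x).
Proof.
  intros H. pose proof (cE_pos p x H) as HE. unfold log_spiral, cE in *.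
  auto_derive.
  - split; [lra|]. split; [lra|trivial].
  - assert (Hx : (1 + cB p * x) ^ 2 + (cA p * x) ^ 2 = 1 + 2 * cB p * x + cC p * x ^ 2)
      by (unfold cC; ring).
    replace (bb p) with (cB p + gammaL p * cA p) by (unfold cB; ring).
    unfold cC in *. field. repeat split; nra.
Qed.

(** In both polynomials [Pvar 2], [Pvar 3], [Pvar 4] stand for [cB], [cC], [bb], as [env] places the
    entries of [rpar] after u and l. [rQ] is made so that 1 + u Q = (1 + b u l) E(u). *)
Definition rP : pexpr :=
  Pmul (Pmul (Pvar 1) (Padd (Pvar 1) (Pcst (-1))))
    (Padd (Padd (Pmul (Pcst 2) (Pvar 2)) (Pmul (Pcst (-1)) (Pvar 4)))
      (Padd (Pmul (Pvar 3) (Pmul (Padd (Pcst 1) (Pvar 1)) (Pvar 0)))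
        (Pmul (Pmul (Pvar 4) (Pvar 3)) (Pmul (Pvar 1) (Pmul (Pvar 0) (Pvar 0)))))).

Definition rQ : pexpr :=
  Padd (Padd (Pmul (Pcst 2) (Pvar 2)) (Pmul (Pvar 3) (Pvar 0)))
    (Pmul (Pmul (Pvar 4) (Pvar 1))
      (Padd (Pcst 1) (Padd (Pmul (Pcst 2) (Pmul (Pvar 2) (Pvar 0)))
                           (Pmul (Pvar 3) (Pmul (Pvar 0) (Pvar 0)))))).

Definition rpar (p : params) (j : nat) : R :=
  match j with 0%nat => cB p | 1%nat => cC p | 2%nat => bb p | _ => 0 end.

(** Far out the flow is that of a homogeneous focus, whose half-turn multiplies y by - exp (gammaL
    pi); in u = 1/y the factor is inverted. *)
Definition slope0 (p : params) : R := - exp (- gammaL p * PI).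

(* The half-return map is u |-> u l(u). Differentiating the first integral gives
   (1 + b u l) E(u) l' = l (l - 1) ((2B - b) + C (1 + l) u + b C l u^2). *)
Definition ret_coef (p : params) : nat -> R := ode_coef rP rQ (rpar p) (slope0 p).

Definition ret_slope (p : params) (u : R) : R := PSeries (ret_coef p) u.
Definition ret_slope' (p : params) (u : R) : R := PSeries (PS_derive (ret_coef p)) u.
Definition ret_slope'' (p : params) (u : R) : R := PSeries (PS_derive (PS_derive (ret_coef p))) u.
Definition ret (p : params) (u : R) : R := u * ret_slope p u.

(** [rf_safe] and [rf_safe_ret] keep [log_spiral] regular at u and at its image; [rf_neg] keeps the
    argument of the logarithm in [rf_int] away from 0. *)
Record ret_facts (G M : R) (p : params) (u : R) : Prop := {
  rf_radius : Rbar_lt (Rabs u) (CV_radius (ret_coef p));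
  rf_bound : Rabs (ret_slope p u) <= M;
  rf_bound' : Rabs (ret_slope' p u) <= M;
  rf_bound'' : Rabs (ret_slope'' p u) <= M;
  rf_der : is_derive (ret_slope p) u (ret_slope' p u);
  rf_der' : is_derive (ret_slope' p) u (ret_slope'' p u);
  rf_safe : Rabs u <= safe G;
  rf_safe_ret : Rabs (ret p u) <= safe G;
  rf_near : Rabs (ret_slope p u - slope0 p) <= M * Rabs u;
  rf_neg : ret_slope p u <= - (exp (- (G * PI)) / 2);
  rf_ode : (1 + bb p * ret p u) * cE p u * ret_slope' p u =
     ret_slope p u * (ret_slope p u - 1) *
     ((2 * cB p - bb p) + cC p * (1 + ret_slope p u) * u + bb p * cC p * ret_slope p u * u ^ 2);
  rf_int : ln (- ret_slope p u) + log_spiral p (ret p u) = log_spiral p u - gammaL p * PI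
}.

Lemma exp_le_compat x y : x <= y -> exp x <= exp y.
Proof. intros [H| ->]; [left; now apply exp_increasing|lra]. Qed.

Lemma slope0_bounds G p : pbound G p -> exp (- (G * PI)) <= - slope0 p <= exp (G * PI).
Proof.
  intros (H & _). apply Rabs_le_between in H. unfold slope0. rewrite Ropp_involutive.
  pose proof PI_RGT_0. split; apply exp_le_compat; nra.
Qed.

Lemma ret_slope_0 p : ret_slope p 0 = slope0 p.
Proof. unfold ret_slope. rewrite PSeries_0. reflexivity. Qed.

Lemma const_of_is_derive_0 (f : R -> R) (r x : R) :
  (forall t, Rabs t <= r -> is_derive f t 0) -> Rabs x <= r -> f x = f 0.
Proof.
  intros Hf Hx. destruct (Rtotal_order 0 x) as [H|[<-|H]]; [|reflexivity|].
  - symmetry. apply (eq_is_derive f); [|exact H]. intros t Ht. apply Hf.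
    rewrite Rabs_pos_eq in * by lra. lra.
  - apply (eq_is_derive f); [|exact H]. intros t Ht. apply Hf.
    apply Rabs_le_between in Hx. apply Rabs_le; lra.
Qed.

Lemma Rabs_diff_le_of_derive (f df : R -> R) (r M x : R) :
  (forall t, Rabs t <= r -> is_derive f t (df t) /\ Rabs (df t) <= M) -> Rabs x <= r ->
  Rabs (f x - f 0) <= M * Rabs x.
Proof.
  intros Hf Hx.
  assert (Hin : forall t, Rmin 0 x <= t <= Rmax 0 x -> Rabs t <= r).
  { intros t Ht. apply Rabs_le_between in Hx.
    unfold Rmin, Rmax in Ht. destruct (Rle_dec 0 x); apply Rabs_le; lra. }
  destruct (MVT_gen f 0 x df) as [c [Hc E]].
  - intros t Ht. apply Hf, Hin; lra.
  - intros t Ht. apply continuity_pt_filterlim.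
    apply (ex_derive_continuous (K := R_AbsRing) (V := R_NormedModule)). exists (df t). now apply Hf, Hin.
  - rewrite E, Rminus_0_r, Rabs_mult. apply Rmult_le_compat_r; [apply Rabs_pos|].
    apply Hf, Hin, Hc.
Qed.

Theorem ret_facts_uniform (G : R) : 0 <= G ->
  exists r M, 0 < r /\ 0 <= M /\
    forall p u, pbound G p -> Rabs u <= r -> ret_facts G M p u.
Proof.
  intros HG.
  set (G' := 4 + (G + G ^ 2) + (G ^ 2 + (G + G ^ 2) ^ 2) + exp (G * PI)).
  assert (He := exp_pos (G * PI)).
  assert (HG' : 4 <= G') by (unfold G'; nra).
  destruct (ode_analytic_solution rP rQ G' HG') as [r1 [M [Hr1 [HM Hsol]]]].
  set (d := exp (- (G * PI))).
  assert (Hd : 0 < d) by apply exp_pos.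
  assert (Hsafe := safe_pos G HG).
  (* Four demands: convergence of the series, u safe, u l safe as |l| <= M, and M r <= d/2, which
     keeps l below - d/2 because [slope0 p] is at most - d. *)
  set (r := Rmin (Rmin r1 (safe G)) (Rmin (safe G / (M + 1)) (d / (2 * (M + 1))))).
  assert (Ha : 0 < safe G / (M + 1)) by (apply Rdiv_lt_0_compat; lra).
  assert (Hb : 0 < d / (2 * (M + 1))) by (apply Rdiv_lt_0_compat; lra).
  assert (Hr : 0 < r) by (unfold r; repeat apply Rmin_glb_lt; lra).
  assert (Hrr1 : r <= r1) by (unfold r; eapply Rle_trans; [apply Rmin_l|apply Rmin_l]).
  assert (Hrs : r <= safe G) by (unfold r; eapply Rle_trans; [apply Rmin_l|apply Rmin_r]).
  assert (Hra : r <= safe G / (M + 1)) by (unfold r; eapply Rle_trans; [apply Rmin_r|apply Rmin_l]).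
  assert (Hrb : r <= d / (2 * (M + 1))) by (unfold r; eapply Rle_trans; [apply Rmin_r|apply Rmin_r]).
  exists r, M. split; [exact Hr|]. split; [exact HM|]. intros p u Hp Hu.
  assert (HB := cB_bound G p Hp). assert (HC := cC_bound G p Hp).
  assert (Hbb : Rabs (bb p) <= G) by apply Hp.
  assert (Hs := slope0_bounds G p Hp). fold d in Hs.
  assert (Hpar : forall i, Rabs (rpar p i) <= G').
  { assert (0 <= G ^ 2 + (G + G ^ 2) ^ 2) by nra.
    intros [|[|[|i]]]; simpl rpar; unfold G'; try nra. rewrite Rabs_R0. nra. }
  assert (Hc0 : Rabs (slope0 p) <= G').
  { rewrite Rabs_left by lra. unfold G'. nra. }
  destruct (Hsol (rpar p) (slope0 p) Hpar Hc0) as [_ Hall]. fold (ret_coef p) in Hall.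
  assert (Hder : forall t, Rabs t <= r -> is_derive (ret_slope p) t (ret_slope' p t) /\
                   Rabs (ret_slope' p t) <= M).
  { intros t Ht. destruct (Hall t ltac:(lra)) as (_ & _ & H1 & _ & H2 & _). now split. }
  assert (Hnear : forall t, Rabs t <= r -> Rabs (ret_slope p t - slope0 p) <= M * Rabs t).
  { intros t Ht. rewrite <- (ret_slope_0 p). exact (Rabs_diff_le_of_derive _ _ r M t Hder Ht). }
  assert (Hneg : forall t, Rabs t <= r -> ret_slope p t <= - (d / 2)).
  { intros t Ht. specialize (Hnear t Ht). apply Rabs_le_between in Hnear.
    assert (M * Rabs t <= d / 2).
    { apply Rle_trans with ((M + 1) * (d / (2 * (M + 1)))).
      - apply Rmult_le_compat; try lra. apply Rabs_pos.
      - right. field. lra. }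
    lra. }
  assert (Hret : forall t, Rabs t <= r -> Rabs (ret p t) <= safe G).
  { intros t Ht. unfold ret. rewrite Rabs_mult.
    destruct (Hall t ltac:(lra)) as (_ & H1 & _). fold (ret_slope p t) in H1.
    apply Rle_trans with ((safe G / (M + 1)) * (M + 1)).
    - apply Rmult_le_compat; try apply Rabs_pos; lra.
    - right. field. lra. }
  assert (Hode : forall t, Rabs t <= r ->
     (1 + bb p * ret p t) * cE p t * ret_slope' p t =
     ret_slope p t * (ret_slope p t - 1) *
     ((2 * cB p - bb p) + cC p * (1 + ret_slope p t) * t + bb p * cC p * ret_slope p t * t ^ 2)).
  { intros t Ht. destruct (Hall t ltac:(lra)) as (_ & _ & _ & _ & _ & _ & E). simpl in E.
    fold (ret_slope p t) (ret_slope' p t) in E. unfold ret, cE.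
    ring_simplify. ring_simplify in E. lra. }
  destruct (Hall u ltac:(lra)) as (F1 & F2 & F3 & F4 & F5 & F6 & _).
  split; auto; try lra.
  (* The differential equation says exactly that h' = 0, and at 0 only ln (- l) = - gammaL pi
     remains. *)
  pose (h := fun t => ln (- ret_slope p t) + log_spiral p (ret p t) - log_spiral p t).
  enough (E : h u = h 0).
  { unfold h in E. rewrite ret_slope_0 in E. unfold ret at 2 in E. rewrite Rmult_0_l in E.
    unfold slope0 in E. rewrite Ropp_involutive, ln_exp in E. lra. }
  apply (const_of_is_derive_0 h r); [|exact Hu]. intros t Ht.
  destruct (safe_bounds G p t Hp ltac:(lra)) as [S1 [S2 _]].
  destruct (safe_bounds G p (ret p t) Hp (Hret t Ht)) as [S3 [S4 _]].
  assert (E1 := cE_pos p _ S1). assert (E2 := cE_pos p _ S3).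
  assert (D1 := is_derive_log_spiral p _ S1). assert (D2 := is_derive_log_spiral p _ S3).
  destruct (Hder t Ht) as [D3 _]. specialize (Hneg t Ht). specialize (Hode t Ht).
  assert (D4 : is_derive (ret p) t (ret_slope p t + t * ret_slope' p t)).
  { unfold ret. evar_last.
    - apply (is_derive_mult (fun x => x) (ret_slope p)); [apply is_derive_id|exact D3|].
      intros; apply Rmult_comm.
    - unfold plus, mult, one; simpl. ring. }
  unfold h. evar_last.
  - apply (is_derive_minus (K := R_AbsRing) (V := R_NormedModule)); [|exact D1].
    apply (is_derive_plus (K := R_AbsRing) (V := R_NormedModule)).
    + apply (is_derive_comp ln (fun t => - ret_slope p t)).
      * apply is_derive_ln. lra.
      * apply (is_derive_opp (K := R_AbsRing) (V := R_NormedModule)). exact D3.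
    + apply (is_derive_comp (log_spiral p) (ret p)); [exact D2|exact D4].
  - unfold minus, plus, opp, scal; simpl. unfold mult; simpl.
    assert (Hsl : ret_slope' p t = ret_slope p t * (ret_slope p t - 1) *
     ((2 * cB p - bb p) + cC p * (1 + ret_slope p t) * t + bb p * cC p * ret_slope p t * t ^ 2)
       / ((1 + bb p * ret p t) * cE p t)).
    { rewrite <- Hode. field. lra. }
    rewrite Hsl. unfold ret, cE in *. field. repeat split; lra.
Qed.

(** * Orbits of the left system: uniqueness and explicit half-turns *)

Lemma zero_derive_const (f : R -> R) :
  (forall t, is_derive f t 0) -> forall x, f x = f 0.
Proof. intros Hf x. apply (const_of_is_derive_0 f (Rabs x)); [auto|lra]. Qed.

(* The squared modulus in the coordinate Z, discounted by exp (2 g t), is a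
   constant of motion. *)
Lemma linear_focus_zero (g : R) (X Y : R -> R) :
  (forall t, is_derive X t (2 * g * X t - Y t)) ->
  (forall t, is_derive Y t ((1 + g ^ 2) * X t)) ->
  X 0 = 0 -> Y 0 = 0 -> forall t, X t = 0 /\ Y t = 0.
Proof.
  intros DX DY HX0 HY0.
  pose (N := fun t => exp (- (2 * g * t)) * (X t ^ 2 + (g * X t - Y t) ^ 2)).
  assert (DN : forall t, is_derive N t 0).
  { intros t. unfold N. auto_derive.
    - repeat split; try (eexists; apply DX); eexists; apply DY.
    - change (fun x => X x) with X. change (fun x => Y x) with Y.
      rewrite (is_derive_unique _ _ _ (DX t)), (is_derive_unique _ _ _ (DY t)). ring. }
  assert (HN : forall t, N t = 0).
  { intros t. rewrite (zero_derive_const N DN t). unfold N. rewrite HX0, HY0. ring. }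
  intros t. specialize (HN t). unfold N in HN.
  assert (He := exp_pos (- (2 * g * t))).
  assert (HX2 := pow2_ge_0 (X t)). assert (HY2 := pow2_ge_0 (g * X t - Y t)).
  assert (HX : X t ^ 2 = 0) by nra.
  assert (HY : (g * X t - Y t) ^ 2 = 0) by nra.
  assert (HX' : X t = 0) by nra. rewrite HX' in HY. split; nra.
Qed.

Lemma left_orbit_unique p x y x' y' :
  is_orbit (left_field p) x y -> is_orbit (left_field p) x' y' ->
  x 0 = x' 0 -> y 0 = y' 0 -> forall t, x t = x' t /\ y t = y' t.
Proof.
  intros H H' Hx Hy t.
  destruct (linear_focus_zero (gammaL p) (fun t => x t - x' t) (fun t => y t - y' t)) with (t := t); try lra.
  - intros s. destruct (H s) as [H1 _], (H' s) as [H2 _].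
    evar_last; [apply (is_derive_minus (K := R_AbsRing) (V := R_NormedModule)); eassumption|].
    unfold minus, plus, opp, left_field; simpl. ring.
  - intros s. destruct (H s) as [_ H1], (H' s) as [_ H2].
    evar_last; [apply (is_derive_minus (K := R_AbsRing) (V := R_NormedModule)); eassumption|].
    unfold minus, plus, opp, left_field; simpl. ring.
Qed.

Lemma left_half_return_unique p y0 y1 y1' :
  left_half_return p y0 y1 -> left_half_return p y0 y1' -> y1 = y1'.
Proof.
  intros (x & y & T & HO & Hx0 & Hy0 & HT & Hneg & HxT & HyT & _)
         (x' & y' & T' & HO' & Hx0' & Hy0' & HT' & Hneg' & HxT' & HyT' & _).
  assert (E : forall t, x t = x' t /\ y t = y' t)
    by (apply (left_orbit_unique p); congruence || assumption).
  destruct (Rtotal_order T T') as [h|[<-|h]].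
  - specialize (Hneg' T ltac:(lra)). rewrite <- (proj1 (E T)) in Hneg'. lra.
  - rewrite <- HyT, <- HyT'. apply E.
  - specialize (Hneg T' ltac:(lra)). rewrite (proj1 (E T')) in Hneg. lra.
Qed.

Lemma Rabs_atan_le x : Rabs (atan x) <= Rabs x.
Proof.
  destruct (MVT_gen atan 0 x (fun c => / (1 + c ^ 2))) as [c [_ E]].
  - intros t _. apply is_derive_Reals. auto_derive; [trivial|]. field. nra.
  - intros t _. apply derivable_continuous_pt, derivable_pt_atan.
  - rewrite atan_0, !Rminus_0_r in E. rewrite E, Rabs_mult.
    assert (0 < / (1 + c ^ 2) <= 1).
    { split; [apply Rinv_0_lt_compat; nra|]. rewrite <- Rinv_1. apply Rinv_le_contravar; nra. }
    rewrite (Rabs_pos_eq (/ _)) by lra. pose proof (Rabs_pos x). nra.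
Qed.

Lemma spiral_angle_bound G p x : pbound G p -> Rabs x <= safe G ->
  Rabs (atan (cA p * x / (1 + cB p * x))) <= / 4.
Proof.
  intros Hp Hx. destruct (safe_bounds G p x Hp Hx) as [H1 [_ H2]].
  eapply Rle_trans; [apply Rabs_atan_le|]. unfold Rdiv.
  rewrite Rabs_mult, (Rabs_pos_eq (/ _)) by (left; apply Rinv_0_lt_compat; lra).
  assert (/ (1 + cB p * x) <= 2).
  { rewrite <- (Rinv_inv 2). apply Rinv_le_contravar; lra. }
  pose proof (Rabs_pos (cA p * x)).
  assert (0 < / (1 + cB p * x)) by (apply Rinv_0_lt_compat; lra). nra.
Qed.

Lemma spiral_angle p x : 0 < 1 + cB p * x ->
  let a := atan (cA p * x / (1 + cB p * x)) in
  cos a * sqrt (cE p x) = 1 + cB p * x /\ sin a * sqrt (cE p x) = cA p * x.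
Proof.
  intros H a. unfold a. rewrite cos_atan, sin_atan.
  set (q := cA p * x / (1 + cB p * x)).
  assert (HE : cE p x = (1 + cB p * x)² * (1 + q²)).
  { rewrite cE_squares. unfold q, Rsqr. field. lra. }
  rewrite HE, sqrt_mult, sqrt_Rsqr by (try apply Rle_0_sqr; try lra; pose proof (Rle_0_sqr q); lra).
  assert (0 < sqrt (1 + q²)) by (apply sqrt_lt_R0; pose proof (Rle_0_sqr q); lra).
  split; [field; lra|]. unfold q at 1. field. split; lra.
Qed.

(** [Y] is y0 + [cB p], the imaginary part of -Z at the starting point (0, y0). *)
Definition orbit_x (p : params) (Y t : R) : R :=
  cA p + exp (gammaL p * t) * (- cA p * cos t - Y * sin t).

Definition orbit_y (p : params) (Y t : R) : R :=
  gammaL p * orbit_x p Y t - cB p + exp (gammaL p * t) * (Y * cos t - cA p * sin t).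

Lemma orbit_is_orbit p Y : is_orbit (left_field p) (orbit_x p Y) (orbit_y p Y).
Proof.
  intros t. unfold left_field, orbit_y, orbit_x; simpl.
  assert (HB : bb p = cB p + gammaL p * cA p) by (unfold cB; ring).
  assert (HA : alphaL p = (1 + gammaL p ^ 2) * cA p)
    by (unfold cA; field; pose proof (pow2_ge_0 (gammaL p)); nra).
  simpl in HA. rewrite HA, HB.
  split; (auto_derive; [trivial|ring]).
Qed.

Lemma Rabs_sin_le t : Rabs (sin t) <= 1.
Proof. apply Rabs_le. pose proof (SIN_bound t). lra. Qed.

Lemma Rabs_cos_le t : Rabs (cos t) <= 1.
Proof. apply Rabs_le. pose proof (COS_bound t). lra. Qed.

(** The abscissa without its positive factor exp (gammaL t): the sign is the same, and for large [Y]
    the function and its derivative are governed by - Y sin t and - Y cos t. *)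
Definition orbit_f (p : params) (Y t : R) : R :=
  cA p * exp (- (gammaL p * t)) - cA p * cos t - Y * sin t.

Definition orbit_f' (p : params) (Y t : R) : R :=
  - gammaL p * cA p * exp (- (gammaL p * t)) + cA p * sin t - Y * cos t.

Lemma orbit_f_increment p Y a b : a < b ->
  exists c, a <= c <= b /\ orbit_f p Y b - orbit_f p Y a = orbit_f' p Y c * (b - a).
Proof.
  intros Hab.
  assert (D : forall t, is_derive (orbit_f p Y) t (orbit_f' p Y t)).
  { intros t. unfold orbit_f, orbit_f'. auto_derive; [trivial|ring]. }
  destruct (MVT_gen (orbit_f p Y) a b (orbit_f' p Y)) as [c [Hc E]].
  - intros t _. apply D.
  - intros t _. apply continuity_pt_filterlim.
    apply (ex_derive_continuous (K := R_AbsRing) (V := R_NormedModule)). eexists. apply D.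
  - rewrite Rmin_left, Rmax_right in Hc by lra. now exists c.
Qed.

(** Three time ranges: up to pi/3 the cosine is at least 1/2 and [orbit_f] falls from 0; up to 2
    pi/3 the sine is at least 1/2 and - Y sin t dominates; beyond, the cosine is at most - 1/2 and
    [orbit_f] rises to its zero at T. K bounds the terms free of Y, with exp (6 G) because T < 4
    pi/3 < 6. *)
Lemma orbit_x_neg G p Y T : pbound G p ->
  2 * ((G + G ^ 2) * (exp (6 * G) + 1)) < Y ->
  2 * (PI / 3) < T < 4 * (PI / 3) -> orbit_x p Y T = 0 ->
  forall t, 0 < t < T -> orbit_x p Y t < 0.
Proof.
  intros Hp. set (K := (G + G ^ 2) * (exp (6 * G) + 1)). intros HY HT H0 t Ht.
  assert (HG := pbound_pos G p Hp).
  assert (HA := cA_bound G p Hp). assert (Hg : Rabs (gammaL p) <= G) by apply Hp.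
  assert (Hpi := PI_RGT_0). assert (Hpi4 := PI_4).
  assert (HE : forall s, 0 <= s <= T -> 0 < exp (- (gammaL p * s)) <= exp (6 * G)).
  { intros s Hs. split; [apply exp_pos|]. apply exp_le_compat.
    apply Rabs_le_between in Hg. nra. }
  assert (He6 := exp_pos (6 * G)).
  assert (HK : 0 <= K) by (unfold K; nra).
  assert (B0 : forall s, 0 <= s <= T -> orbit_f p Y s <= K - Y * sin s).
  { intros s Hs. unfold orbit_f. specialize (HE s Hs).
    enough (cA p * (exp (- (gammaL p * s)) - cos s) <= K) by lra.
    eapply Rle_trans; [apply Rle_abs|]. rewrite Rabs_mult.
    apply Rle_trans with (G * (exp (6 * G) + 1)); [|unfold K; nra].
    apply Rmult_le_compat; try apply Rabs_pos; auto.
    eapply Rle_trans; [apply Rabs_triang|]. rewrite Rabs_Ropp, (Rabs_pos_eq (exp _)) by lra.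
    pose proof (Rabs_cos_le s). lra. }
  assert (B1 : forall s, 0 <= s <= T -> Rabs (orbit_f' p Y s + Y * cos s) <= K).
  { intros s Hs. unfold orbit_f'. specialize (HE s Hs).
    replace (_ + _) with (cA p * (- gammaL p * exp (- (gammaL p * s)) + sin s)) by ring.
    rewrite Rabs_mult. apply Rle_trans with (G * (G * exp (6 * G) + 1)); [|unfold K; nra].
    apply Rmult_le_compat; try apply Rabs_pos; auto.
    eapply Rle_trans; [apply Rabs_triang|]. apply Rplus_le_compat; [|apply Rabs_sin_le].
    rewrite Rabs_mult, Rabs_Ropp, (Rabs_pos_eq (exp _)) by lra.
    apply Rmult_le_compat; try apply Rabs_pos; lra. }
  assert (Hfx : forall s, orbit_x p Y s = exp (gammaL p * s) * orbit_f p Y s).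
  { intros s. unfold orbit_x, orbit_f. rewrite exp_Ropp. field. apply Rgt_not_eq, exp_pos. }
  assert (HfT : orbit_f p Y T = 0).
  { rewrite Hfx in H0. pose proof (exp_pos (gammaL p * T)). nra. }
  assert (Hf0 : orbit_f p Y 0 = 0).
  { unfold orbit_f. rewrite Rmult_0_r, Ropp_0, exp_0, cos_0, sin_0. ring. }
  assert (Hc3 : cos (PI / 3) = / 2) by (rewrite cos_PI3; lra).
  rewrite Hfx. enough (orbit_f p Y t < 0) by (pose proof (exp_pos (gammaL p * t)); nra).
  destruct (Rle_lt_dec t (PI / 3)) as [h1|h1]; [|destruct (Rle_lt_dec t (2 * (PI / 3))) as [h2|h2]].
  - destruct (orbit_f_increment p Y 0 t ltac:(lra)) as [c [Hc E]].
    rewrite Hf0, !Rminus_0_r in E. rewrite E.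
    assert (Hcos : / 2 <= cos c) by (rewrite <- Hc3; apply cos_decr_1; lra).
    specialize (B1 c ltac:(lra)). apply Rabs_le_between in B1.
    assert (orbit_f' p Y c < 0) by nra. nra.
  - assert (Hsin : / 2 <= sin t).
    { rewrite sin_cos. destruct (Rle_lt_dec t (PI / 2)) as [h|h].
      - replace (- cos (PI / 2 + t)) with (cos (PI / 2 - t)).
        + rewrite <- Hc3. apply cos_decr_1; lra.
        + rewrite cos_shift. rewrite <- sin_cos. reflexivity.
      - rewrite <- Hc3, <- (cos_neg (PI / 3)). rewrite <- sin_cos.
        replace (sin t) with (cos (t - PI / 2)).
        + rewrite cos_neg. apply cos_decr_1; lra.
        + rewrite <- (cos_neg (t - PI / 2)). replace (- (t - PI / 2)) with (PI / 2 - t) by ring.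
          apply cos_shift. }
    specialize (B0 t ltac:(lra)). nra.
  - destruct (orbit_f_increment p Y t T ltac:(lra)) as [c [Hc E]].
    rewrite HfT in E.
    assert (Hcos : cos c <= - / 2).
    { rewrite <- Hc3, <- Rtrigo_facts.cos_pi_plus. destruct (Rle_lt_dec c PI) as [h|h].
      - rewrite (Rplus_comm PI). rewrite <- (cos_neg (PI / 3 + PI)).
        replace (- (PI / 3 + PI)) with (2 * (PI / 3) - 2 * PI) by field.
        rewrite cos_minus, cos_2PI, sin_2PI, Rmult_1_r, Rmult_0_r, Rplus_0_r.
        apply cos_decr_1; lra.
      - apply cos_incr_1; lra. }
    specialize (B1 c ltac:(lra)). apply Rabs_le_between in B1.
    assert (0 < orbit_f' p Y c) by nra. nra.
Qed.

(** Matching values of the first integral are realised by an actual half-turn. Besides the image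
    given by the series, this also certifies an image guessed by symmetry, as in [ret_odd]. *)
Lemma left_half_return_of_integral (G : R) : 0 <= G ->
  exists r, 0 < r /\ forall p u v, pbound G p -> 0 < u <= r -> - safe G <= v < 0 ->
    ln (- v) + log_spiral p v = ln u + log_spiral p u - gammaL p * PI ->
    left_half_return p (/ u) (/ v).
Proof.
  intros HG. set (K := (G + G ^ 2) * (exp (6 * G) + 1)).
  assert (HK : 0 <= K) by (unfold K; pose proof (exp_pos (6 * G)); nra).
  assert (Hs := safe_pos G HG).
  exists (Rmin (safe G) (/ (4 * K + 4))).
  assert (HKi : 0 < / (4 * K + 4)) by (apply Rinv_0_lt_compat; lra).
  split; [apply Rmin_glb_lt; lra|].
  intros p u v Hp Hu Hv Hint.
  assert (Hu1 : u <= safe G) by (eapply Rle_trans; [apply Hu|apply Rmin_l]).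
  assert (Hu2 : u <= / (4 * K + 4)) by (eapply Rle_trans; [apply Hu|apply Rmin_r]).
  assert (Hua : Rabs u <= safe G) by (rewrite Rabs_pos_eq; lra).
  assert (Hva : Rabs v <= safe G) by (rewrite Rabs_left; lra).
  destruct (safe_bounds G p u Hp Hua) as [Su _], (safe_bounds G p v Hp Hva) as [Sv _].
  assert (Au := spiral_angle_bound G p u Hp Hua). assert (Av := spiral_angle_bound G p v Hp Hva).
  destruct (spiral_angle p u ltac:(lra)) as [Cu Du], (spiral_angle p v ltac:(lra)) as [Cv Dv].
  assert (Eu := cE_pos p u Su). assert (Ev := cE_pos p v Sv).
  unfold log_spiral in Hint.
  set (a0 := atan (cA p * u / (1 + cB p * u))) in *.
  set (a1 := atan (cA p * v / (1 + cB p * v))) in *.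
  set (Y := (1 + cB p * u) / u).
  (* Z turns with unit speed, so the travel time is half a turn corrected by the deviations of the
     two end rays. Each is at most 1/4, hence T stays within 1/2 of pi. *)
  set (T := PI + (a1 - a0)).
  assert (Hpi := PI2_3_2).
  assert (HT : 2 * (PI / 3) < T < 4 * (PI / 3)).
  { apply Rabs_le_between in Au. apply Rabs_le_between in Av. unfold T. lra. }
  assert (Ru : 0 < sqrt (cE p u)) by (apply sqrt_lt_R0; lra).
  assert (Rv : 0 < sqrt (cE p v)) by (apply sqrt_lt_R0; lra).
  (* The integral relation exponentiated: the modulus of Z is multiplied by exp (gammaL T). *)
  assert (HexpT : exp (gammaL p * T) * (sqrt (cE p u) / u) = - (sqrt (cE p v) / v)).
  { replace (gammaL p * T) with (/ 2 * ln (cE p v) - ln (- v) - (/ 2 * ln (cE p u) - ln u))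
      by (unfold T; lra).
    assert (Hsq : forall z, 0 < z -> exp (/ 2 * ln z) = sqrt z)
      by (intros z Hz; rewrite <- Rpower_sqrt by exact Hz; reflexivity).
    unfold Rminus. rewrite Ropp_plus_distr, Ropp_involutive, !exp_plus, !exp_Ropp.
    rewrite !Hsq, !exp_ln by lra. field. repeat split; lra. }
  assert (HsinT : sin T = - sin (a1 - a0)) by (unfold T; rewrite Rplus_comm; apply neg_sin).
  assert (HcosT : cos T = - cos (a1 - a0)) by (unfold T; rewrite Rplus_comm; apply neg_cos).
  assert (HY : Y = cos a0 * (sqrt (cE p u) / u)) by (unfold Y; rewrite <- Cu; field; lra).
  assert (HA0 : cA p = sin a0 * (sqrt (cE p u) / u)).
  { replace (cA p) with (cA p * u / u) by (field; lra). rewrite <- Du. field; lra. }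
  assert (HA1 : cA p = sin a1 * (sqrt (cE p v) / v)).
  { replace (cA p) with (cA p * v / v) by (field; lra). rewrite <- Dv. field; lra. }
  assert (HV : / v + cB p = cos a1 * (sqrt (cE p v) / v)).
  { replace (/ v + cB p) with ((1 + cB p * v) / v) by (field; lra). rewrite <- Cv. field; lra. }
  assert (HxT : orbit_x p Y T = 0).
  { unfold orbit_x. rewrite HsinT, HcosT.
    assert (E : - cA p * - cos (a1 - a0) - Y * - sin (a1 - a0) = (sqrt (cE p u) / u) * sin a1).
    { rewrite HA0, HY at 1. replace (sin a1) with (sin (a0 + (a1 - a0))) by (f_equal; ring).
      rewrite sin_plus. ring. }
    rewrite E, <- Rmult_assoc, HexpT, HA1. ring. }
  assert (HyT : orbit_y p Y T = / v).
  { unfold orbit_y. rewrite HxT, HsinT, HcosT.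
    assert (E : Y * - cos (a1 - a0) - cA p * - sin (a1 - a0) = - ((sqrt (cE p u) / u) * cos a1)).
    { rewrite HA0, HY at 1. replace (cos a1) with (cos (a0 + (a1 - a0))) by (f_equal; ring).
      rewrite cos_plus. ring. }
    rewrite E. replace (exp (gammaL p * T) * _) with (- ((exp (gammaL p * T) * (sqrt (cE p u) / u)) * cos a1)) by ring.
    rewrite HexpT. lra. }
  exists (orbit_x p Y), (orbit_y p Y), T.
  split; [apply orbit_is_orbit|].
  assert (Hx0 : orbit_x p Y 0 = 0)
    by (unfold orbit_x; rewrite Rmult_0_r, exp_0, cos_0, sin_0; ring).
  split; [exact Hx0|].
  split.
  { unfold orbit_y. rewrite Hx0, !Rmult_0_r, exp_0, cos_0, sin_0. unfold Y. field. lra. }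
  split; [lra|]. split; [|split; [exact HxT|split; [exact HyT|apply Rinv_lt_0_compat; lra]]].
  apply (orbit_x_neg G p Y T Hp); auto. fold K.
  (* [Y] is at least 1/(2u), and u <= 1/(4K + 4) lifts this above 2K. *)
  apply Rlt_le_trans with (/ 2 * / u).
  - apply (Rmult_lt_reg_r u); [lra|]. replace (/ 2 * / u * u) with (/ 2) by (field; lra).
    assert ((4 * K + 4) * u <= 1).
    { apply (Rmult_le_reg_r (/ (4 * K + 4))); [exact HKi|]. rewrite Rmult_1_l.
      replace ((4 * K + 4) * u * / (4 * K + 4)) with u by (field; lra). exact Hu2. }
    lra.
  - unfold Y, Rdiv. apply Rmult_le_compat_r; [left; apply Rinv_0_lt_compat; lra|lra].
Qed.

Theorem half_return_uniform (G : R) : 0 <= G ->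
  exists r M, 0 < r /\ 0 <= M /\
    forall p u, pbound G p -> Rabs u <= r ->
      ret_facts G M p u /\ (0 < u -> left_half_return p (/ u) (/ ret p u)).
Proof.
  intros HG. destruct (ret_facts_uniform G HG) as [r1 [M [Hr1 [HM H1]]]].
  destruct (left_half_return_of_integral G HG) as [r2 [Hr2 H2]].
  exists (Rmin r1 r2), M. split; [now apply Rmin_glb_lt|]. split; [exact HM|].
  intros p u Hp Hu.
  assert (Hu1 : Rabs u <= r1) by (eapply Rle_trans; [exact Hu|apply Rmin_l]).
  assert (Hu2 : Rabs u <= r2) by (eapply Rle_trans; [exact Hu|apply Rmin_r]).
  assert (F := H1 p u Hp Hu1). split; [exact F|]. intros Hpos.
  assert (Fs := rf_safe_ret _ _ _ _ F). assert (Fn := rf_neg _ _ _ _ F).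
  assert (He := exp_pos (- (G * PI))).
  assert (Fi := rf_int _ _ _ _ F).
  apply H2; auto.
  - rewrite Rabs_pos_eq in Hu2; lra.
  - split; [apply Rabs_le_between in Fs; lra|]. unfold ret. nra.
  - unfold ret at 1. replace (- (u * ret_slope p u)) with (u * - ret_slope p u) by ring.
    rewrite ln_mult by lra. lra.
Qed.

(** * The right half-return map by time reversal *)

(* (x, y, t) |-> (-x, y, -t) exchanges the two half-planes. *)
Definition mirror (p : params) : params :=
  Params (- gammaR p) (- gammaL p) (- alphaR p) (- alphaL p) (- bb p).

Lemma pbound_mirror G p : pbound G p -> pbound G (mirror p).
Proof. unfold pbound, mirror; simpl. rewrite !Rabs_Ropp. tauto. Qed.

Lemma right_half_return_mirror p y0 y1 :
  right_half_return p y0 y1 <-> left_half_return (mirror p) y0 y1.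
Proof.
  assert (D : forall (f : R -> R) t l, is_derive f (- t) l -> is_derive (fun s => f (- s)) t (- l)).
  { intros f t l H. evar_last.
    - apply (is_derive_comp f (fun s => - s)); [exact H|].
      apply (is_derive_opp (K := R_AbsRing) (V := R_NormedModule)), is_derive_id.
    - unfold scal, opp, one; simpl. unfold mult; simpl. ring. }
  assert (D' : forall (f : R -> R) t l, is_derive f (- t) l -> is_derive (fun s => - f (- s)) t l).
  { intros f t l H. evar_last.
    - apply (is_derive_opp (K := R_AbsRing) (V := R_NormedModule)), D, H.
    - unfold opp; simpl. ring. }
  split; intros (x & y & T & HO & H0 & Hy & HT & Hs & HxT & HyT & Hn);
    exists (fun t => - x (- t)), (fun t => y (- t)), T.
  - split.
    { intros t. destruct (HO (- t)) as [H1 H2]. split.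
      - evar_last; [apply D', H1|]. unfold left_field, right_field; simpl. ring.
      - evar_last; [apply D, H2|]. unfold left_field, right_field; simpl. ring. }
    rewrite Ropp_0. repeat split; auto; try lra.
    intros t Ht. specialize (Hs (- t) ltac:(lra)). lra.
  - split.
    { intros t. destruct (HO (- t)) as [H1 H2]. split.
      - evar_last; [apply D', H1|]. unfold left_field, right_field; simpl. ring.
      - evar_last; [apply D, H2|]. unfold left_field, right_field; simpl. ring. }
    rewrite Ropp_0, Ropp_involutive. repeat split; auto; try lra.
    intros t Ht. specialize (Hs (- t) ltac:(lra)). lra.
Qed.

(** * Orders of vanishing and the displacement series *)

(** A vanishing order that does not mention Taylor coefficients, so that [gap], which is never
    expanded in a series, can determine it. *)
Definition has_order (f : R -> R) (n : nat) : Prop :=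
  exists delta c C, 0 < delta /\ 0 < c /\
    forall u, 0 < u < delta -> c * u ^ n <= Rabs (f u) <= C * u ^ n.

Lemma has_order_le f n m : has_order f n -> has_order f m -> (m <= n)%nat.
Proof.
  intros (d1 & c & C1 & Hd1 & Hc & H1) (d2 & c2 & C & Hd2 & _ & H2).
  destruct (Nat.le_gt_cases m n) as [h|h]; [exact h|exfalso].
  set (u := Rmin (Rmin (d1 / 2) (d2 / 2)) (Rmin (/ 2) (c / (2 * (Rabs C + 1))))).
  pose proof (Rabs_pos C). pose proof (Rle_abs C).
  assert (Hq : 0 < c / (2 * (Rabs C + 1))) by (apply Rdiv_lt_0_compat; lra).
  assert (Hu : 0 < u) by (unfold u; repeat apply Rmin_glb_lt; lra).
  assert (u <= d1 / 2) by (unfold u; eapply Rle_trans; [apply Rmin_l|apply Rmin_l]).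
  assert (u <= d2 / 2) by (unfold u; eapply Rle_trans; [apply Rmin_l|apply Rmin_r]).
  assert (u <= / 2) by (unfold u; eapply Rle_trans; [apply Rmin_r|apply Rmin_l]).
  assert (Huc : u <= c / (2 * (Rabs C + 1))) by (unfold u; eapply Rle_trans; [apply Rmin_r|apply Rmin_r]).
  specialize (H1 u ltac:(lra)). specialize (H2 u ltac:(lra)).
  replace m with (S n + (m - S n))%nat in H2 by lia. rewrite pow_add in H2.
  assert (Hp : 0 < u ^ n) by now apply pow_lt.
  assert (Hp1 : u ^ (m - S n) <= 1) by (rewrite <- (pow1 (m - S n)); apply pow_incr; lra).
  assert (Hp2 : 0 < u ^ (m - S n)) by now apply pow_lt.
  assert (c * u ^ n <= (Rabs C + 1) * u * u ^ n).
  { eapply Rle_trans; [apply H1|]. eapply Rle_trans; [apply H2|]. simpl.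
    replace (C * (u * u ^ n * u ^ (m - S n))) with ((u * u ^ n) * (C * u ^ (m - S n))) by ring.
    replace ((Rabs C + 1) * u * u ^ n) with ((u * u ^ n) * (Rabs C + 1)) by ring.
    apply Rmult_le_compat_l; [nra|]. apply Rle_trans with (Rabs C * u ^ (m - S n)); nra. }
  assert (c <= (Rabs C + 1) * u) by nra.
  assert ((Rabs C + 1) * u <= c / 2).
  { apply Rle_trans with ((Rabs C + 1) * (c / (2 * (Rabs C + 1)))); [nra|]. right. field. lra. }
  lra.
Qed.

Lemma has_order_unique f n m : has_order f n -> has_order f m -> n = m.
Proof.
  intros H1 H2. pose proof (has_order_le _ _ _ H1 H2). pose proof (has_order_le _ _ _ H2 H1). lia.
Qed.

Lemma has_order_ext f g n delta : 0 < delta -> (forall u, 0 < u < delta -> f u = g u) ->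
  has_order f n -> has_order g n.
Proof.
  intros Hd E (d & c & C & H0 & Hc & H). exists (Rmin d delta), c, C.
  split; [now apply Rmin_glb_lt|]. split; [exact Hc|]. intros u Hu.
  assert (u < d) by (eapply Rlt_le_trans; [apply Hu|apply Rmin_l]).
  assert (u < delta) by (eapply Rlt_le_trans; [apply Hu|apply Rmin_r]).
  rewrite <- E by lra. apply H; lra.
Qed.

Lemma has_order_nonzero f n delta : 0 < delta -> has_order f n ->
  exists u, 0 < u < delta /\ f u <> 0.
Proof.
  intros Hd (d & c & C & H0 & Hc & H).
  exists (Rmin (d / 2) (delta / 2)).
  assert (Hu : 0 < Rmin (d / 2) (delta / 2)) by (apply Rmin_glb_lt; lra).
  pose proof (Rmin_l (d / 2) (delta / 2)). pose proof (Rmin_r (d / 2) (delta / 2)).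
  split; [lra|]. intros E. specialize (H (Rmin (d / 2) (delta / 2)) ltac:(lra)). rewrite E, Rabs_R0 in H.
  assert (0 < Rmin (d / 2) (delta / 2) ^ n) by now apply pow_lt. nra.
Qed.

Lemma CV_radius_decr_n (a : nat -> R) n : CV_radius (PS_decr_n a n) = CV_radius a.
Proof.
  induction n as [|n IH].
  - apply CV_radius_ext. reflexivity.
  - rewrite <- IH, <- (CV_radius_decr_1 (PS_decr_n a n)). apply CV_radius_ext. intros k.
    unfold PS_decr_1, PS_decr_n. f_equal. lia.
Qed.

(** After division by u^n a series with nonzero constant term is left, and continuity at 0 keeps it
    within a factor 2 of that term. *)
Lemma PSeries_has_order (a : nat -> R) n : Rbar_lt 0 (CV_radius a) ->
  (forall i, (i < n)%nat -> a i = 0) -> a n <> 0 -> has_order (PSeries a) n.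
Proof.
  intros Hr Hz Hn.
  assert (Hc : continuity_pt (PSeries (PS_decr_n a n)) 0).
  { apply PSeries_continuity. rewrite CV_radius_decr_n, Rabs_R0. exact Hr. }
  assert (Ha : 0 < Rabs (a n)) by now apply Rabs_pos_lt.
  destruct (Hc (Rabs (a n) / 2) ltac:(lra)) as [d [Hd H]].
  exists d, (Rabs (a n) / 2), (2 * Rabs (a n)). split; [exact Hd|]. split; [lra|].
  intros u Hu. rewrite (PSeries_decr_n_aux a n u Hz).
  assert (Hp : 0 < u ^ n) by (apply pow_lt; lra).
  rewrite Rabs_mult, (Rabs_pos_eq (u ^ n)) by lra.
  assert (Hu' : Rabs (PSeries (PS_decr_n a n) u - a n) < Rabs (a n) / 2).
  { specialize (H u). simpl in H. unfold Rdist in H.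
    rewrite PSeries_0 in H. unfold PS_decr_n in H at 2. rewrite Nat.add_0_r in H. apply H.
    split; [split; [exact I|lra]|]. rewrite Rminus_0_r, Rabs_pos_eq; lra. }
  set (w := PSeries (PS_decr_n a n) u) in *.
  assert (Rabs (a n) - Rabs w <= Rabs (w - a n))
    by (rewrite (Rabs_minus_sym w); apply Rabs_triang_inv).
  assert (Rabs w - Rabs (a n) <= Rabs (w - a n)) by apply Rabs_triang_inv.
  nra.
Qed.

Lemma first_nonzero (a : nat -> R) :
  (forall i, a i = 0) \/ exists n, a n <> 0 /\ forall i, (i < n)%nat -> a i = 0.
Proof.
  destruct (classic (exists n, a n <> 0)) as [[n Hn]|H].
  - right. revert Hn. induction n as [n IH] using (well_founded_induction Wf_nat.lt_wf). intros Hn.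
    destruct (classic (exists m, (m < n)%nat /\ a m <> 0)) as [[m [Hm Hm']]|H].
    + now apply (IH m).
    + exists n. split; [exact Hn|]. intros i Hi. apply NNPP. intros Hne. apply H. now exists i.
  - left. intros i. apply NNPP. intros Hne. apply H. now exists i.
Qed.

Lemma PSeries_zero_coef (a : nat -> R) delta : Rbar_lt 0 (CV_radius a) -> 0 < delta ->
  (forall u, 0 < u < delta -> PSeries a u = 0) -> forall i, a i = 0.
Proof.
  intros Hr Hd H. destruct (first_nonzero a) as [H0|[n [Hn Hz]]]; [exact H0|exfalso].
  destruct (has_order_nonzero _ _ delta Hd (PSeries_has_order a n Hr Hz Hn)) as [u [Hu Hne]].
  now apply Hne, H.
Qed.

Lemma CV_radius_minus_pos (a b : nat -> R) :
  Rbar_lt 0 (CV_radius a) -> Rbar_lt 0 (CV_radius b) -> Rbar_lt 0 (CV_radius (PS_minus a b)).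
Proof.
  intros Ha Hb. unfold PS_minus.
  refine (Rbar_lt_le_trans (Finite 0) _ _ _ (CV_radius_plus a (PS_opp b))). rewrite CV_radius_opp.
  destruct (CV_radius a), (CV_radius b); simpl in *; auto. now apply Rmin_glb_lt.
Qed.

Lemma PSeries_minus_near_0 (a b : nat -> R) :
  Rbar_lt 0 (CV_radius a) -> Rbar_lt 0 (CV_radius b) ->
  exists delta, 0 < delta /\ forall u, 0 < u < delta ->
    PSeries (PS_minus a b) u = PSeries a u - PSeries b u.
Proof.
  intros Ha Hb.
  destruct (Rbar_lt_between _ _ Ha) as [y [Hy1 Hy2]].
  destruct (Rbar_lt_between _ _ Hb) as [z [Hz1 Hz2]].
  exists (Rmin y z). split; [now apply Rmin_glb_lt|]. intros u Hu.
  apply PSeries_minus; apply CV_radius_inside; rewrite Rabs_pos_eq by lra.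
  - apply Rbar_lt_trans with y; [|exact Hy2]. simpl. eapply Rlt_le_trans; [apply Hu|apply Rmin_l].
  - apply Rbar_lt_trans with z; [|exact Hz2]. simpl. eapply Rlt_le_trans; [apply Hu|apply Rmin_r].
Qed.

(** A functional relation gives both series the same values at all small u > 0, and these determine
    every coefficient. The existentially quantified series of the definitions can thus be replaced
    by [disp_coef]. *)
Lemma germ_unique (H : R -> R -> Prop) l l' :
  (forall y0 y y', H y0 y -> H y0 y' -> y = y') ->
  is_germ_at_infinity H l -> is_germ_at_infinity H l' -> forall i, l i = l' i.
Proof.
  intros Hfun (R1 & _ & d1 & Hd1 & H1) (R2 & _ & d2 & Hd2 & H2) i.
  destruct (PSeries_minus_near_0 l l' R1 R2) as [d [Hd E]].
  assert (Hz : PS_minus l l' i = 0).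
  { apply (PSeries_zero_coef _ (Rmin d (Rmin d1 d2))).
    - now apply CV_radius_minus_pos.
    - repeat apply Rmin_glb_lt; lra.
    - intros u [Hu0 Hu]. pose proof (Rmin_l d (Rmin d1 d2)). pose proof (Rmin_r d (Rmin d1 d2)).
      pose proof (Rmin_l d1 d2). pose proof (Rmin_r d1 d2).
      rewrite E by lra.
      destruct (H1 u ltac:(lra)) as [y [Hy ->]]. destruct (H2 u ltac:(lra)) as [y' [Hy' ->]].
      rewrite (Hfun _ _ _ Hy Hy'). ring. }
  unfold PS_minus, PS_plus, PS_opp, plus, opp in Hz; simpl in Hz. lra.
Qed.

Lemma right_half_return_unique p y0 y1 y1' :
  right_half_return p y0 y1 -> right_half_return p y0 y1' -> y1 = y1'.
Proof. rewrite !right_half_return_mirror. apply left_half_return_unique. Qed.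

Lemma pbound_exists p : exists G, 0 <= G /\ pbound G p.
Proof.
  exists (Rabs (gammaL p) + Rabs (gammaR p) + Rabs (alphaL p) + Rabs (alphaR p) + Rabs (bb p)).
  pose proof (Rabs_pos (gammaL p)). pose proof (Rabs_pos (gammaR p)).
  pose proof (Rabs_pos (alphaL p)). pose proof (Rabs_pos (alphaR p)). pose proof (Rabs_pos (bb p)).
  split; [lra|]. unfold pbound. repeat split; lra.
Qed.

Lemma ret_eq p u : PSeries (PS_incr_1 (ret_coef p)) u = ret p u.
Proof. apply PSeries_incr_1. Qed.

Lemma ret_germ p : is_germ_at_infinity (left_half_return p) (PS_incr_1 (ret_coef p)).
Proof.
  destruct (pbound_exists p) as [G [HG Hp]].
  destruct (half_return_uniform G HG) as [r [M [Hr [HM H]]]].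
  split; [|split].
  - rewrite CV_radius_incr_1.
    destruct (H p 0 Hp) as [F _]; [rewrite Rabs_R0; lra|].
    pose proof (rf_radius _ _ _ _ F) as Hrad. now rewrite Rabs_R0 in Hrad.
  - reflexivity.
  - exists r. split; [exact Hr|]. intros u Hu.
    destruct (H p u Hp) as [F L]; [rewrite Rabs_pos_eq; lra|].
    exists (/ ret p u). split; [apply L; lra|]. rewrite ret_eq, Rinv_inv. reflexivity.
Qed.

Lemma is_germ_ext (H H' : R -> R -> Prop) l :
  (forall y0 y, H y0 y <-> H' y0 y) -> is_germ_at_infinity H l -> is_germ_at_infinity H' l.
Proof.
  intros E (R1 & H0 & d & Hd & Hl). split; [exact R1|]. split; [exact H0|].
  exists d. split; [exact Hd|]. intros u Hu. destruct (Hl u Hu) as [y [Hy Ey]].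
  exists y. split; [now apply E|exact Ey].
Qed.

Lemma right_germ p : is_germ_at_infinity (right_half_return p) (PS_incr_1 (ret_coef (mirror p))).
Proof.
  apply (is_germ_ext (left_half_return (mirror p))); [|apply ret_germ].
  intros. symmetry. apply right_half_return_mirror.
Qed.

Definition disp_coef (p : params) : nat -> R :=
  PS_minus (PS_incr_1 (ret_coef p)) (PS_incr_1 (ret_coef (mirror p))).

Definition disp (p : params) (u : R) : R := ret p u - ret (mirror p) u.

Lemma disp_coef_series p : displacement_series p (disp_coef p).
Proof.
  exists (PS_incr_1 (ret_coef p)), (PS_incr_1 (ret_coef (mirror p))).
  split; [apply ret_germ|]. split; [apply right_germ|].
  intros i. unfold disp_coef, PS_minus, PS_plus, PS_opp, plus, opp; simpl. ring.
Qed.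

Lemma displacement_series_unique p a : displacement_series p a -> forall i, a i = disp_coef p i.
Proof.
  intros (l & r & Hl & Hr & E) i. rewrite E.
  rewrite (germ_unique _ _ _ (left_half_return_unique p) Hl (ret_germ p) i).
  rewrite (germ_unique _ _ _ (right_half_return_unique p) Hr (right_germ p) i).
  unfold disp_coef, PS_minus, PS_plus, PS_opp, plus, opp; simpl. ring.
Qed.

Lemma disp_coef_radius p : Rbar_lt 0 (CV_radius (disp_coef p)).
Proof. apply CV_radius_minus_pos; [apply (ret_germ p)|apply (ret_germ (mirror p))]. Qed.

Lemma disp_coef_PSeries p : exists delta, 0 < delta /\ forall u, 0 < u < delta ->
  PSeries (disp_coef p) u = disp p u.
Proof.
  destruct (PSeries_minus_near_0 (PS_incr_1 (ret_coef p)) (PS_incr_1 (ret_coef (mirror p))))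
    as [d [Hd E]]; [apply (ret_germ p)|apply (ret_germ (mirror p))|].
  exists d. split; [exact Hd|]. intros u Hu. unfold disp_coef, disp.
  now rewrite E, !ret_eq.
Qed.

Lemma disp_coef_0 p : disp_coef p 0 = 0.
Proof. unfold disp_coef, PS_minus, PS_plus, PS_opp, plus, opp; simpl. unfold zero; simpl. ring. Qed.

Lemma disp_coef_1 p : disp_coef p 1 = exp (gammaR p * PI) - exp (- gammaL p * PI).
Proof.
  change (slope0 p + - slope0 (mirror p) = exp (gammaR p * PI) - exp (- gammaL p * PI)).
  unfold slope0; simpl. rewrite !Ropp_involutive. ring.
Qed.

Lemma disp_coef_1_zero p : disp_coef p 1 = 0 <-> gammaL p + gammaR p = 0.
Proof.
  rewrite disp_coef_1. pose proof PI_RGT_0. split; intros H0.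
  - assert (E : gammaR p * PI = - gammaL p * PI) by (apply exp_inv; lra). nra.
  - replace (gammaR p) with (- gammaL p) by lra. ring.
Qed.

Lemma half_returns_near_infinity p : exists delta, 0 < delta /\ forall u, 0 < u < delta ->
  left_half_return p (/ u) (/ ret p u) /\ right_half_return p (/ u) (/ ret (mirror p) u).
Proof.
  destruct (pbound_exists p) as [G [HG Hp]].
  destruct (half_return_uniform G HG) as [r [M [Hr [HM H]]]].
  exists r. split; [exact Hr|]. intros u Hu.
  assert (Hu' : Rabs u <= r) by (rewrite Rabs_pos_eq; lra).
  rewrite right_half_return_mirror. split.
  - apply (H p u Hp Hu'). lra.
  - apply (H (mirror p) u (pbound_mirror _ _ Hp) Hu'). lra.
Qed.

Lemma weak_focus_has_order p k : infinity_weak_focus p k -> has_order (disp p) (S k).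
Proof.
  intros (Hk & a & Ha & Hz & Hn).
  destruct (disp_coef_PSeries p) as [d [Hd E]].
  apply (has_order_ext _ _ _ d Hd E). apply PSeries_has_order; [apply disp_coef_radius| |].
  - intros i Hi. rewrite <- (displacement_series_unique p a Ha). apply Hz. lia.
  - now rewrite <- (displacement_series_unique p a Ha).
Qed.

Lemma weak_focus_trace p k : infinity_weak_focus p k -> gammaL p + gammaR p = 0.
Proof.
  intros (Hk & a & Ha & Hz & Hn). apply disp_coef_1_zero.
  rewrite <- (displacement_series_unique p a Ha). now apply Hz.
Qed.

Lemma weak_focus_or_center p : gammaL p + gammaR p = 0 ->
  (exists k, infinity_weak_focus p k) \/ infinity_center p.
Proof.
  intros Hs. destruct (first_nonzero (disp_coef p)) as [H0|[n [Hn Hz]]].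
  - right. destruct (disp_coef_PSeries p) as [d [Hd E]].
    destruct (half_returns_near_infinity p) as [d' [Hd' H]].
    exists (Rmin d d'). split; [now apply Rmin_glb_lt|]. intros u [Hu0 Hu].
    pose proof (Rmin_l d d'). pose proof (Rmin_r d d').
    destruct (H u ltac:(lra)) as [HL HR].
    exists (/ ret p u), (/ ret (mirror p) u). split; [exact HL|]. split; [exact HR|].
    rewrite !Rinv_inv. fold (disp p u). rewrite <- E by lra.
    rewrite (PSeries_ext _ (fun _ => 0)) by exact H0. symmetry. apply PSeries_const_0.
  - left. destruct n as [|[|k]].
    + now rewrite disp_coef_0 in Hn.
    + now apply disp_coef_1_zero in Hs.
    + exists (S k). split; [lia|]. exists (disp_coef p). split; [apply disp_coef_series|].
      split; [|exact Hn]. intros i Hi. apply Hz. lia.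
Qed.

(** The way back from sizes to coefficients: either some weak-focus order exists, and vanishing
    orders are unique, or Delta is 0 near infinity, against the lower bound. *)
Lemma has_order_weak_focus p k : gammaL p + gammaR p = 0 ->
  has_order (disp p) (S k) -> infinity_weak_focus p k.
Proof.
  intros Hs Ho. destruct (weak_focus_or_center p Hs) as [[j Hj]|(d & Hd & Hc)].
  - pose proof (has_order_unique _ _ _ Ho (weak_focus_has_order p j Hj)) as E.
    injection E as ->. exact Hj.
  - exfalso. destruct (half_returns_near_infinity p) as [d' [Hd' H]].
    destruct (has_order_nonzero _ _ (Rmin d d') (Rmin_glb_lt _ _ _ Hd Hd') Ho) as [u [[Hu0 Hu] Hne]].
    pose proof (Rmin_l d d'). pose proof (Rmin_r d d').
    destruct (H u ltac:(lra)) as [HL HR].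
    destruct (Hc u ltac:(lra)) as (y1 & y2 & HL' & HR' & E).
    rewrite <- (left_half_return_unique _ _ _ _ HL HL'), <- (right_half_return_unique _ _ _ _ HR HR') in E.
    rewrite !Rinv_inv in E. apply Hne. unfold disp. lra.
Qed.

(** The cases s = 1 and s = -1 give the two stability claims. The sign of y1 - y2 = - (l - l') / (u
    l l') is opposite to that of l - l', which at u = 0 has the sign of gammaL + gammaR and moves by
    at most 2 M u. *)
Lemma stability_sign p s : 0 < s * (gammaL p + gammaR p) ->
  exists delta, 0 < delta /\ forall u, 0 < u < delta ->
    exists y1 y2, left_half_return p (/ u) y1 /\ right_half_return p (/ u) y2 /\ s * (y1 - y2) < 0.
Proof.
  intros Hs. destruct (pbound_exists p) as [G [HG Hp]].
  destruct (half_return_uniform G HG) as [r [M [Hr [HM H]]]].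
  assert (Hp' := pbound_mirror G p Hp).
  set (gap := s * (slope0 p - slope0 (mirror p))).
  assert (Hgap : 0 < gap).
  { unfold gap, slope0; simpl. rewrite Ropp_involutive. pose proof PI_RGT_0.
    assert (s <> 0) by (intros ->; lra).
    destruct (Rlt_le_dec 0 s).
    - assert (exp (- gammaL p * PI) < exp (gammaR p * PI)) by (apply exp_increasing; nra). nra.
    - assert (exp (gammaR p * PI) < exp (- gammaL p * PI)) by (apply exp_increasing; nra). nra. }
  pose proof (Rabs_pos s).
  assert (Hq : 0 < gap / (2 * (M + 1) * (Rabs s + 1))) by (apply Rdiv_lt_0_compat; nra).
  exists (Rmin r (gap / (2 * (M + 1) * (Rabs s + 1)))). split; [now apply Rmin_glb_lt|].
  intros u [Hu0 Hu].
  assert (Hu1 : u < r) by (eapply Rlt_le_trans; [exact Hu|apply Rmin_l]).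
  assert (Hu2 : u < gap / (2 * (M + 1) * (Rabs s + 1))) by (eapply Rlt_le_trans; [exact Hu|apply Rmin_r]).
  destruct (H p u Hp) as [F L]; [rewrite Rabs_pos_eq; lra|].
  destruct (H (mirror p) u Hp') as [F' L']; [rewrite Rabs_pos_eq; lra|].
  exists (/ ret p u), (/ ret (mirror p) u). split; [apply L; lra|].
  split; [apply right_half_return_mirror, L'; lra|].
  pose proof (rf_near _ _ _ _ F) as N. pose proof (rf_near _ _ _ _ F') as N'.
  pose proof (rf_neg _ _ _ _ F) as V. pose proof (rf_neg _ _ _ _ F') as V'.
  pose proof (exp_pos (- (G * PI))). rewrite (Rabs_pos_eq u) in N, N' by lra.
  set (l := ret_slope p u) in *. set (l' := ret_slope (mirror p) u) in *.
  assert (Hd : 0 < s * (l - l')).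
  { replace (s * (l - l')) with (gap + s * ((l - slope0 p) - (l' - slope0 (mirror p)))) by (unfold gap; ring).
    enough (Hlt : Rabs (s * ((l - slope0 p) - (l' - slope0 (mirror p)))) < gap)
      by (apply Rabs_lt_between in Hlt; lra).
    rewrite Rabs_mult. apply Rle_lt_trans with ((Rabs s + 1) * (2 * (M + 1) * u)).
    - apply Rmult_le_compat; try apply Rabs_pos; [lra|].
      eapply Rle_trans; [apply Rabs_triang|]. rewrite Rabs_Ropp. nra.
    - apply (Rmult_lt_compat_l (2 * (M + 1) * (Rabs s + 1))) in Hu2; [|nra].
      replace (2 * (M + 1) * (Rabs s + 1) * (gap / (2 * (M + 1) * (Rabs s + 1)))) with gap in Hu2
        by (field; lra). lra. }
  unfold ret. fold l l'.
  replace (s * (/ (u * l) - / (u * l'))) with (- (s * (l - l') * / (u * (l * l')))) by (field; lra).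
  assert (0 < l * l') by nra.
  assert (0 < / (u * (l * l'))) by (apply Rinv_0_lt_compat, Rmult_lt_0_compat; lra).
  assert (0 < s * (l - l') * / (u * (l * l'))) by now apply Rmult_lt_0_compat. lra.
Qed.

(** * The gap function *)

(* The increment of the right first integral, corrected by gammaR pi, between u and
   its image under the left map. *)
Definition gap (p : params) (u : R) : R :=
  - ln (- ret_slope p u) + log_spiral (mirror p) u - log_spiral (mirror p) (ret p u)
  + gammaR p * PI.

Lemma gap_0 p : gap p 0 = (gammaL p + gammaR p) * PI.
Proof.
  unfold gap, ret. rewrite ret_slope_0, Rmult_0_l. unfold slope0.
  rewrite Ropp_involutive, ln_exp. ring.
Qed.

Lemma cE_upper G p x : pbound G p -> Rabs x <= safe G -> cE p x <= 2.
Proof.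
  intros Hp Hx. rewrite cE_squares. destruct (safe_bounds G p x Hp Hx) as [_ [_ H3]].
  pose proof (mult_safe G (cB p) x (pbound_pos G p Hp) (cB_bound G p Hp) Hx) as H1.
  apply Rabs_le_between in H1. apply Rabs_le_between in H3. nra.
Qed.

Lemma bb_upper G p x : pbound G p -> Rabs x <= safe G -> Rabs (bb p * x) <= / 8.
Proof.
  intros Hp Hx. pose proof (pbound_pos G p Hp). apply (mult_safe G); auto.
  assert (Rabs (bb p) <= G) by apply Hp. nra.
Qed.

(** With phi the right first integral at the image point, as a function of minus the slope, [rf_int]
    for the mirrored system turns [gap p u] into phi(m') - phi(m). K is phi' at an intermediate
    point, and its bounds come from 1/4 <= E <= 2 and 1/2 <= 1 + b v <= 9/8 for the mirrored
    data. *)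
Lemma gap_displacement G M p u : 0 <= M -> pbound G p ->
  ret_facts G M p u -> ret_facts G M (mirror p) u ->
  exists K, / (4 * (M + 1)) <= K <= 9 / exp (- (G * PI)) /\
    gap p u = K * (ret_slope p u - ret_slope (mirror p) u).
Proof.
  intros HM Hp F F'. assert (Hp' := pbound_mirror G p Hp).
  set (d := exp (- (G * PI))). assert (Hd : 0 < d) by apply exp_pos.
  assert (N := rf_neg _ _ _ _ F). assert (N' := rf_neg _ _ _ _ F'). fold d in N, N'.
  assert (B := rf_bound _ _ _ _ F). assert (B' := rf_bound _ _ _ _ F').
  assert (S := rf_safe_ret _ _ _ _ F). assert (S' := rf_safe_ret _ _ _ _ F').
  assert (I := rf_int _ _ _ _ F').
  set (q := mirror p) in *. unfold gap, ret in *. fold q.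
  set (m := - ret_slope p u) in *. set (m' := - ret_slope q u) in *.
  replace (ret_slope p u) with (- m) in * by (unfold m; ring).
  replace (ret_slope q u) with (- m') in * by (unfold m'; ring).
  rewrite Rabs_Ropp in B, B'.
  pose (phi := fun x => ln x + log_spiral q (u * - x)).
  pose (dphi := fun x => (1 + bb q * (u * - x)) / (x * cE q (u * - x))).
  assert (Hin : forall x, Rmin m m' <= x <= Rmax m m' ->
            d / 2 <= x <= M /\ Rabs (u * - x) <= safe G).
  { intros x Hx.
    assert (Hx1 : d / 2 <= x <= M).
    { apply Rabs_le_between in B. apply Rabs_le_between in B'.
      unfold Rmin, Rmax in Hx. destruct (Rle_dec m m'); lra. }
    split; [exact Hx1|]. rewrite Rabs_mult, Rabs_Ropp in S, S' |- *.
    rewrite (Rabs_pos_eq m) in S by lra. rewrite (Rabs_pos_eq m') in S' by lra. rewrite (Rabs_pos_eq x) by lra.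
    pose proof (Rabs_pos u). unfold Rmin, Rmax in Hx. destruct (Rle_dec m m'); nra. }
  assert (D : forall x, Rmin m m' <= x <= Rmax m m' -> is_derive phi x (dphi x)).
  { intros x Hx. destruct (Hin x Hx) as [H1 H2].
    destruct (safe_bounds G q _ Hp' H2) as [S1 [S2 _]].
    assert (E1 := cE_pos q _ S1). assert (D1 := is_derive_log_spiral q _ S1).
    unfold phi, dphi. evar_last.
    - apply (is_derive_plus (K := R_AbsRing) (V := R_NormedModule)).
      + apply is_derive_ln. lra.
      + apply (is_derive_comp (log_spiral q) (fun x => u * - x)); [exact D1|].
        auto_derive; [trivial|reflexivity].
    - unfold plus, scal; simpl. unfold mult; simpl. unfold cE in *. field. split; lra. }
  destruct (MVT_gen phi m m' dphi) as [c [Hc E]].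
  - intros x Hx. apply D. lra.
  - intros x Hx. apply continuity_pt_filterlim.
    apply (ex_derive_continuous (K := R_AbsRing) (V := R_NormedModule)). eexists. now apply D.
  - destruct (Hin c Hc) as [H1 H2].
    destruct (safe_bounds G q _ Hp' H2) as [S1 [S2 _]].
    assert (E1 := cE_pos q _ S1). assert (E2 := cE_upper G q _ Hp' H2).
    assert (U := bb_upper G q _ Hp' H2). apply Rabs_le_between in U.
    exists (dphi c). split.
    + unfold dphi. set (e := cE q (u * - c)) in *. set (n := 1 + bb q * (u * - c)) in *.
      assert (0 < c * e) by (apply Rmult_lt_0_compat; lra).
      assert (c * e <= M * 2) by (apply Rmult_le_compat; lra).
      assert (d / 2 * / 4 <= c * e) by (apply Rmult_le_compat; lra).
      split.
      * unfold Rdiv. apply Rle_trans with (/ 2 * / (c * e)).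
        -- rewrite <- Rinv_mult. apply Rinv_le_contravar; lra.
        -- apply Rmult_le_compat_r; [left; now apply Rinv_0_lt_compat|lra].
      * apply Rle_trans with ((9 / 8) * / (c * e)).
        -- apply Rmult_le_compat_r; [left; now apply Rinv_0_lt_compat|unfold n; lra].
        -- replace (9 / d) with (9 / 8 * / (d / 8)) by (field; lra).
           apply Rmult_le_compat_l; [lra|]. apply Rinv_le_contravar; lra.
    + unfold phi in E. unfold q in I at 3. simpl in I. lra.
Qed.

Definition pneg (e : pexpr) : pexpr := Pmul (Pcst (-1)) e.
Definition psub (e1 e2 : pexpr) : pexpr := Padd e1 (pneg e2).

(* Variables: u, the slope l of the left map and its first two derivatives, gammaL,
   gammaR, alphaL, alphaR, b, 1/(1+gammaL^2), 1/(1+gammaR^2). *)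
Definition venv (p : params) (u l l' l'' : R) (i : nat) : R :=
  match i with
  | 0%nat => u | 1%nat => l | 2%nat => l' | 3%nat => l''
  | 4%nat => gammaL p | 5%nat => gammaR p | 6%nat => alphaL p | 7%nat => alphaR p
  | 8%nat => bb p
  | 9%nat => / (1 + gammaL p ^ 2) | 10%nat => / (1 + gammaR p ^ 2)
  | _ => 0
  end.

Definition xAL := Pmul (Pvar 6) (Pvar 9).
Definition xBL := psub (Pvar 8) (Pmul (Pvar 4) xAL).
Definition xCL := Padd (Pmul xAL xAL) (Pmul xBL xBL).
Definition xAR := pneg (Pmul (Pvar 7) (Pvar 10)).
Definition xBR := psub (Pmul (Pvar 5) xAR) (Pvar 8).
Definition xCR := Padd (Pmul xAR xAR) (Pmul xBR xBR).

(* a and a + f are the coefficients of (1 - b u) E_L(u) and (1 + b u) E_R(u). *)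
Definition xa1 := psub (Pmul (Pcst 2) xBL) (Pvar 8).
Definition xa2 := psub xCL (Pmul (Pcst 2) (Pmul (Pvar 8) xBL)).
Definition xa3 := pneg (Pmul (Pvar 8) xCL).
Definition xf1 := psub (Padd (Pvar 8) (Pmul (Pcst 2) xBR)) xa1.
Definition xf2 := psub (Padd xCR (Pmul (Pcst 2) (Pmul (Pvar 8) xBR))) xa2.
Definition xf3 := psub (Pmul (Pvar 8) xCR) xa3.

(* With v = u l, the quotient by v - u of
   (1 - b u) E_L(u) (1 + b v) E_R(v) - (1 - b v) E_L(v) (1 + b u) E_R(u). *)
Definition xS : pexpr :=
  let u := Pvar 0 in let l := Pvar 1 in
  let s := Pmul u (Padd (Pcst 1) l) in let q := Pmul u (Pmul u l) in
  Padd xf1 (Padd (Pmul xf2 s) (Padd (Pmul xf3 (psub (Pmul s s) q))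
    (Padd (Pmul (psub (Pmul xa1 xf2) (Pmul xa2 xf1)) q)
    (Padd (Pmul (psub (Pmul xa1 xf3) (Pmul xa3 xf1)) (Pmul q s))
          (Pmul (psub (Pmul xa2 xf3) (Pmul xa3 xf2)) (Pmul q q)))))).

(** The total derivative along the graph of l. No variable stands for the third derivative of l, so
    [Pvar 3] is sent to a dummy 0 and the result is guaranteed under [var3_free] only. *)
Fixpoint pderiv (e : pexpr) : pexpr :=
  match e with
  | Pvar 0 => Pcst 1
  | Pvar 1 => Pvar 2
  | Pvar 2 => Pvar 3
  | Pvar _ => Pcst 0
  | Pcst _ => Pcst 0
  | Padd e1 e2 => Padd (pderiv e1) (pderiv e2)
  | Pmul e1 e2 => Padd (Pmul (pderiv e1) e2) (Pmul e1 (pderiv e2))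
  end.

Fixpoint var3_free (e : pexpr) : Prop :=
  match e with
  | Pvar i => i <> 3%nat
  | Pcst _ => True
  | Padd e1 e2 | Pmul e1 e2 => var3_free e1 /\ var3_free e2
  end.

Definition orbit_env (p : params) (u : R) : nat -> R :=
  venv p u (ret_slope p u) (ret_slope' p u) (ret_slope'' p u).

Lemma is_derive_peval G M p u e : ret_facts G M p u -> var3_free e ->
  is_derive (fun t => peval (orbit_env p t) e) u (peval (orbit_env p u) (pderiv e)).
Proof.
  intros F. assert (D := rf_der _ _ _ _ F). assert (D' := rf_der' _ _ _ _ F).
  induction e as [i|r|e1 IH1 e2 IH2|e1 IH1 e2 IH2]; simpl.
  - intros Hi. destruct i as [|[|[|[|i]]]]; simpl.
    + apply (is_derive_id (K := R_AbsRing)).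
    + exact D.
    + exact D'.
    + now elim Hi.
    + apply (is_derive_ext (fun _ => orbit_env p u (4 + i))).
      * intros t. do 7 (destruct i as [|i]; [reflexivity|]). reflexivity.
      * apply (is_derive_const (K := R_AbsRing) (V := R_NormedModule)).
  - intros _. apply (is_derive_const (K := R_AbsRing) (V := R_NormedModule)).
  - intros [H1 H2]. apply (is_derive_plus (K := R_AbsRing) (V := R_NormedModule)); auto.
  - intros [H1 H2]. apply (is_derive_mult (fun t => peval (orbit_env p t) e1)); auto.
    intros; apply Rmult_comm.
Qed.

Lemma mirror_weight p : / (1 + gammaL (mirror p) ^ 2) = / (1 + gammaR p ^ 2).
Proof. simpl. f_equal. ring. Qed.

Lemma cA_mirror p : cA (mirror p) = - (alphaR p * / (1 + gammaR p ^ 2)).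
Proof. unfold cA, Rdiv. rewrite mirror_weight. simpl. ring. Qed.

Lemma cB_mirror p : cB (mirror p) = gammaR p * cA (mirror p) - bb p.
Proof. unfold cB. simpl. ring. Qed.

Lemma peval_xS p u l l' l'' :
  let b := bb p in let a1 := 2 * cB p - b in let a2 := cC p - 2 * b * cB p in
  let a3 := - (b * cC p) in
  let f1 := b + 2 * cB (mirror p) - a1 in
  let f2 := cC (mirror p) + 2 * b * cB (mirror p) - a2 in
  let f3 := b * cC (mirror p) - a3 in
  peval (venv p u l l' l'') xS =
  f1 + f2 * (u + u * l) + f3 * (u ^ 2 * (1 + l + l ^ 2)) + (a1 * f2 - a2 * f1) * (u ^ 2 * l)
  + (a1 * f3 - a3 * f1) * (u ^ 3 * l * (1 + l)) + (a2 * f3 - a3 * f2) * (u ^ 4 * l ^ 2).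
Proof.
  cbn -[pow Rinv]. unfold cC. rewrite cB_mirror, cA_mirror. unfold cB, cA, Rdiv.
  set (w := / (1 + gammaL p ^ 2)). set (w' := / (1 + gammaR p ^ 2)). ring.
Qed.

Definition gap_weight (p : params) (u : R) : R :=
  (1 - ret_slope p u) /
  (cE (mirror p) u * cE p u * cE (mirror p) (ret p u) * (1 + bb p * ret p u)).

(** With v = u l, the derivative is (1 - b u) / (u E_R(u)) minus v' (1 - b v) / (v E_R(v)), and the
    left equation gives v' = (1 + b u) v E_L(v) / ((1 + b v) u E_L(u)). Over a common denominator
    the numerator is antisymmetric in u and v, hence divisible by v - u = u (l - 1), whose factor u
    cancels the pole at u = 0. *)
Lemma is_derive_gap G M p u : pbound G p -> ret_facts G M p u ->
  is_derive (gap p) u (- (gap_weight p u * peval (orbit_env p u) xS)).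
Proof.
  intros Hp F. assert (Hp' := pbound_mirror G p Hp).
  assert (D := rf_der _ _ _ _ F). assert (O := rf_ode _ _ _ _ F).
  assert (N := rf_neg _ _ _ _ F). pose proof (exp_pos (- (G * PI))).
  assert (Su := rf_safe _ _ _ _ F). assert (Sv := rf_safe_ret _ _ _ _ F).
  destruct (safe_bounds G p u Hp Su) as [Lu [Bu _]].
  destruct (safe_bounds G p _ Hp Sv) as [Lv [Bv _]].
  destruct (safe_bounds G (mirror p) u Hp' Su) as [Ru _].
  destruct (safe_bounds G (mirror p) _ Hp' Sv) as [Rv _].
  assert (ELu := cE_pos p u Lu). assert (ERu := cE_pos _ u Ru). assert (ERv := cE_pos _ _ Rv).
  assert (D1 := is_derive_log_spiral _ _ Ru). assert (D2 := is_derive_log_spiral _ _ Rv).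
  assert (D4 : is_derive (ret p) u (ret_slope p u + u * ret_slope' p u)).
  { unfold ret. evar_last.
    - apply (is_derive_mult (fun x => x) (ret_slope p)); [apply is_derive_id|exact D|].
      intros; apply Rmult_comm.
    - unfold plus, mult, one; simpl. ring. }
  set (s := peval (orbit_env p u) xS).
  unfold gap. evar_last.
  - apply (is_derive_plus (K := R_AbsRing) (V := R_NormedModule));
      [|apply (is_derive_const (K := R_AbsRing) (V := R_NormedModule))].
    apply (is_derive_minus (K := R_AbsRing) (V := R_NormedModule)).
    + apply (is_derive_plus (K := R_AbsRing) (V := R_NormedModule)); [|exact D1].
      apply (is_derive_opp (K := R_AbsRing) (V := R_NormedModule)).
      apply (is_derive_comp ln (fun t => - ret_slope p t)).
      * apply is_derive_ln. lra.
      * apply (is_derive_opp (K := R_AbsRing) (V := R_NormedModule)). exact D.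
    + apply (is_derive_comp (log_spiral (mirror p)) (ret p)); [exact D2|exact D4].
  - unfold minus, plus, opp, scal, zero; simpl. unfold mult; simpl.
    set (l := ret_slope p u) in *. set (l' := ret_slope' p u) in *.
    assert (Hl : l' = l * (l - 1) * ((2 * cB p - bb p) + cC p * (1 + l) * u + bb p * cC p * l * u ^ 2)
                   / ((1 + bb p * ret p u) * cE p u)) by (rewrite <- O; field; lra).
    rewrite Hl. unfold gap_weight, s, orbit_env. rewrite peval_xS. cbv zeta. fold l.
    unfold ret in *. fold l in Lv, Bv, Rv, ERv |- *. unfold cE in *. simpl bb.
    field. repeat split; lra.
Qed.

(** The coefficients f1, f2, f3 of [peval_xS] in closed form. For the second, completing a square
    gives cC + 2 b cB = alphaR^2 / (1 + gammaR^2) - b^2 for the mirrored data, and the left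
    counterpart carries the same b^2. *)
Definition lead1 (p : params) : R :=
  2 * (gammaL p * cA p + gammaR p * cA (mirror p) - bb p).
Definition lead2 (p : params) : R :=
  alphaR p ^ 2 / (1 + gammaR p ^ 2) - alphaL p ^ 2 / (1 + gammaL p ^ 2).
Definition lead3 (p : params) : R := bb p * (cC (mirror p) + cC p).

Definition xSder (j : nat) : pexpr := Nat.iter j pderiv xS.

(* The value of the j-th derivative of xS at infinity when the previous ones vanish. *)
Definition lead_value (p : params) (j : nat) : R :=
  match j with
  | 0%nat => lead1 p
  | 1%nat => lead2 p * (1 + slope0 p)
  | _ => 2 * lead3 p * (1 + slope0 p + slope0 p ^ 2)
  end.

Definition leading (p : params) (j : nat) : Prop :=
  lead_value p j <> 0 /\
  (j = 0%nat \/ (j = 1%nat /\ lead1 p = 0) \/ (j = 2%nat /\ lead1 p = 0 /\ lead2 p = 0)).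

Lemma xSder_values p l' l'' :
  let v := venv p 0 (slope0 p) l' l'' in
  peval v (xSder 0) = lead1 p /\
  peval v (xSder 1) = lead2 p * (1 + slope0 p) /\
  peval v (xSder 2) = 2 * lead3 p * (1 + slope0 p + slope0 p ^ 2) + 2 * lead2 p * l'
     + 2 * ((2 * cB p - bb p) * lead2 p - (cC p - 2 * bb p * cB p) * lead1 p) * slope0 p.
Proof.
  cbv zeta.
  pose (a1 := 2 * cB p - bb p). pose (a2 := cC p - 2 * bb p * cB p).
  (* Below, the inverse weights become atoms for [ring]; their relation to g has to be supplied by
     this identity. *)
  assert (W : forall g, g ^ 2 * / (1 + g ^ 2) = 1 - / (1 + g ^ 2)).
  { intros g. field. pose proof (pow2_ge_0 g). lra. }
  set (s := slope0 p).
  assert (E0 : peval (venv p 0 s l' l'') (xSder 0) = lead1 p).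
  { unfold lead1. rewrite cA_mirror. unfold cA, Rdiv. cbn -[pow Rinv]. ring. }
  assert (E1 : peval (venv p 0 s l' l'') (xSder 1) = lead2 p * (1 + s)).
  { unfold lead2, Rdiv. cbn -[pow Rinv].
    assert (W1 := W (gammaL p)). assert (W2 := W (gammaR p)).
    set (w := / (1 + gammaL p ^ 2)) in *. set (w' := / (1 + gammaR p ^ 2)) in *.
    match goal with |- ?A = _ => replace A with
      ((1 + s) * (alphaR p ^ 2 * w' * (w' + gammaR p ^ 2 * w') - alphaL p ^ 2 * w * (w + gammaL p ^ 2 * w))) by ring end.
    rewrite W1, W2. ring. }
  assert (E2 : peval (venv p 0 s l' l'') (xSder 2) =
     2 * lead3 p * (1 + s + s ^ 2) + 2 * lead2 p * l' + 2 * (a1 * lead2 p - a2 * lead1 p) * s).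
  { unfold lead1, lead2, lead3, a1, a2, cC. rewrite cB_mirror, cA_mirror. unfold cB, cA, Rdiv.
    cbn -[pow Rinv].
    assert (W1 := W (gammaL p)). assert (W2 := W (gammaR p)).
    set (w := / (1 + gammaL p ^ 2)) in *. set (w' := / (1 + gammaR p ^ 2)) in *.
    replace (alphaR p ^ 2 * w') with (alphaR p ^ 2 * w' * (w' + gammaR p ^ 2 * w'))
      by (rewrite W2; ring).
    replace (alphaL p ^ 2 * w) with (alphaL p ^ 2 * w * (w + gammaL p ^ 2 * w))
      by (rewrite W1; ring).
    ring. }
  split; [exact E0|]. split; [exact E1|exact E2].
Qed.

Lemma xSder_leading p j l' l'' : leading p j ->
  peval (venv p 0 (slope0 p) l' l'') (xSder j) = lead_value p j.
Proof.
  destruct (xSder_values p l' l'') as [E0 [E1 E2]].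
  intros [_ [-> | [[-> H1] | [-> [H1 H2]]]]].
  - exact E0.
  - exact E1.
  - rewrite E2, H1, H2. simpl. ring.
Qed.

Lemma xSder_var3_free j : (j < 2)%nat -> var3_free (xSder j).
Proof.
  intros Hj. destruct j as [|[|j]]; [| |lia]; simpl; repeat split; discriminate.
Qed.

(** * Signs near infinity *)

(** As [has_order], but f also keeps the sign of s near 0; that sign decides which perturbation
    creates a sign change. *)
Definition signed_order (s : R) (f : R -> R) (n : nat) : Prop :=
  exists delta c C, 0 < delta /\ 0 < c /\
    forall u, 0 < u < delta -> c * u ^ n <= s * f u <= C * u ^ n.

Lemma signed_order_has_order s f n : s <> 0 -> signed_order s f n -> has_order f n.
Proof.
  intros Hs (d & c & C & Hd & Hc & H). pose proof (Rabs_pos_lt s Hs) as Hs'.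
  exists d, (c / Rabs s), (C / Rabs s). split; [exact Hd|].
  split; [now apply Rdiv_lt_0_compat|]. intros u Hu. specialize (H u Hu).
  assert (0 < u ^ n) by (apply pow_lt; lra).
  assert (E : Rabs (f u) = (s * f u) / Rabs s).
  { replace (s * f u) with (Rabs s * Rabs (f u)); [field; lra|].
    rewrite <- Rabs_mult. apply Rabs_pos_eq. nra. }
  rewrite E. unfold Rdiv. assert (0 < / Rabs s) by now apply Rinv_0_lt_compat. split; nra.
Qed.

(** Both bounds are integrated: s f - k u^(n+1)/(n+1) vanishes at 0, and by the mean value theorem
    it has the sign of s f' - k x^n at an intermediate x, for k = c and for k = C. *)
Lemma signed_order_integral s f f' n r : 0 < r -> f 0 = 0 ->
  (forall t, 0 <= t < r -> is_derive f t (f' t)) ->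
  signed_order s f' n -> signed_order s f (S n).
Proof.
  intros Hr H0 D (d & c & C & Hd & Hc & H).
  assert (Hn : 0 < INR (S n)) by (apply lt_0_INR; lia).
  exists (Rmin d r), (c / INR (S n)), (C / INR (S n)).
  split; [now apply Rmin_glb_lt|]. split; [now apply Rdiv_lt_0_compat|].
  intros u [Hu0 Hu]. pose proof (Rmin_l d r). pose proof (Rmin_r d r).
  assert (K : forall k, exists x, 0 < x < u /\
     s * f u - k / INR (S n) * u ^ S n = (s * f' x - k * x ^ n) * u).
  { intros k.
    destruct (MVT_cor2 (fun t => s * f t - k / INR (S n) * t ^ S n)
                       (fun t => s * f' t - k * t ^ n) 0 u Hu0) as [x [E Hx]].
    - intros t Ht. apply is_derive_Reals.
      evar_last.
      + apply (is_derive_minus (K := R_AbsRing) (V := R_NormedModule)).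
        * apply is_derive_scal, D. lra.
        * apply is_derive_scal, (is_derive_pow (fun t => t)), is_derive_id.
      + unfold minus, plus, opp, one; cbn -[INR pow]. field. lra.
    - exists x. split; [exact Hx|]. rewrite H0, Rmult_0_r, pow_i, Rmult_0_r, !Rminus_0_r in E by lia.
      exact E. }
  destruct (K c) as [x [Hx Ex]], (K C) as [y [Hy Ey]].
  pose proof (H x ltac:(lra)). pose proof (H y ltac:(lra)). split; nra.
Qed.

Lemma signed_order_mult s f w n r w1 w2 : 0 < r -> 0 < w1 ->
  (forall u, 0 < u < r -> w1 <= w u <= w2) ->
  signed_order s f n -> signed_order s (fun u => w u * f u) n.
Proof.
  intros Hr Hw1 Hw (d & c & C & Hd & Hc & H).
  exists (Rmin d r), (w1 * c), (w2 * C).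
  split; [now apply Rmin_glb_lt|]. split; [now apply Rmult_lt_0_compat|].
  intros u [Hu0 Hu]. pose proof (Rmin_l d r). pose proof (Rmin_r d r).
  specialize (H u ltac:(lra)). specialize (Hw u ltac:(lra)).
  assert (0 < u ^ n) by (apply pow_lt; lra).
  replace (s * (w u * f u)) with (w u * (s * f u)) by ring. rewrite !Rmult_assoc.
  assert (0 < c * u ^ n) by now apply Rmult_lt_0_compat.
  split; apply Rmult_le_compat; lra.
Qed.

Lemma signed_order_opp s f n : signed_order s f n -> signed_order (- s) (fun u => - f u) n.
Proof.
  intros (d & c & C & Hd & Hc & H). exists d, c, C. split; [exact Hd|]. split; [exact Hc|].
  intros u Hu. replace (- s * - f u) with (s * f u) by ring. now apply H.
Qed.

(** * Increasing sequences of zeros *)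

(** A chain of index n has n + 1 zeros, numbered from 0 to n. *)
Definition chain (a b : R) (f : R -> R) (n : nat) (z : nat -> R) : Prop :=
  (forall i, (i < n)%nat -> z i < z (S i)) /\
  (forall i, (i <= n)%nat -> a < z i < b /\ f (z i) = 0).

Lemma chain_Rolle a b f f' n z :
  (forall x, a < x < b -> is_derive f x (f' x)) ->
  chain a b f (S n) z -> exists z', chain a b f' n z'.
Proof.
  intros D [Hz Hz'].
  (* The bound on i stands under the existential so that choice returns a total sequence; indices
     beyond n get the dummy 0. *)
  assert (H : forall i, exists x, (i <= n)%nat -> z i < x < z (S i) /\ f' x = 0).
  { intros i. destruct (Compare_dec.le_dec i n) as [Hi|Hi]; [|exists 0; lia].
    destruct (Hz' i ltac:(lia)) as [H1 H2], (Hz' (S i) ltac:(lia)) as [H3 H4].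
    specialize (Hz i ltac:(lia)).
    destruct (MVT_cor2 f f' (z i) (z (S i)) Hz) as [x [E Hx]].
    - intros t Ht. apply is_derive_Reals, D. lra.
    - exists x. intros _. split; [exact Hx|]. rewrite H2, H4 in E. nra. }
  destruct (functional_choice _ H) as [z' Hz''].
  exists z'. split.
  - intros i Hi. destruct (Hz'' i ltac:(lia)), (Hz'' (S i) ltac:(lia)). lra.
  - intros i Hi. destruct (Hz'' i ltac:(lia)) as [H1 H2].
    pose proof (Hz' i ltac:(lia)). pose proof (Hz' (S i) ltac:(lia)). split; [lra|exact H2].
Qed.

Lemma chain_increasing a b f n z i j : chain a b f n z -> (i < j <= n)%nat -> z i < z j.
Proof.
  intros [Hz _] [Hij Hj]. induction Hij as [|j Hij IH]; [apply Hz; lia|].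
  apply Rlt_trans with (z j); [apply IH; lia|apply Hz; lia].
Qed.

(** When no longer chain exists, this forces every zero of f in the interval to be a term of the
    chain. *)
Lemma chain_insert a b f n z v : chain a b f n z -> a < v < b -> f v = 0 ->
  (forall i, (i <= n)%nat -> z i <> v) -> exists z', chain a b f (S n) z'.
Proof.
  intros [Hz Hz'] Hv Hfv Hne.
  (* Terms below v keep their index, v follows, the others move up by one. The outer [else] serves
     index n + 1, which receives v or the old last term. *)
  exists (fun i => if (i <=? n)%nat then
            if Rlt_dec (z i) v then z i
            else match i with O => v | S j => if Rlt_dec (z j) v then v else z j end
          else if Rlt_dec (z n) v then v else z n).
  split.
  - intros i Hi. cbv beta iota. destruct (Nat.leb_spec i n); [|lia].
    destruct (Nat.leb_spec (S i) n) as [Hs|Hs].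
    + pose proof (Hz i ltac:(lia)).
      destruct (Rlt_dec (z i) v) as [h|h].
      * destruct (Rlt_dec (z (S i)) v); lra.
      * specialize (Hne i ltac:(lia)).
        destruct (Rlt_dec (z (S i)) v) as [h'|h']; [lra|].
        destruct i as [|i]; [lra|]. pose proof (Hz i ltac:(lia)).
        destruct (Rlt_dec (z i) v); lra.
    + replace n with i in * by lia. specialize (Hne i ltac:(lia)).
      destruct (Rlt_dec (z i) v) as [h|h]; [lra|].
      destruct i as [|i]; [lra|]. specialize (Hz i ltac:(lia)).
      destruct (Rlt_dec (z i) v); lra.
  - intros i Hi. destruct (Nat.leb_spec i n).
    + destruct (Rlt_dec (z i) v); [now apply Hz'|].
      destruct i as [|i]; [now split|]. destruct (Rlt_dec (z i) v); [now split|]. apply Hz'; lia.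
    + destruct (Rlt_dec (z n) v); [now split|]. now apply Hz'.
Qed.

Lemma chain_of_sign_changes a b f n w :
  (forall x, a < x < b -> continuity_pt f x) ->
  (forall i, (i <= S n)%nat -> a < w i < b) ->
  (forall i, (i <= n)%nat -> w i < w (S i) /\ f (w i) * f (w (S i)) < 0) ->
  exists z, chain a b f n z /\ forall i, (i <= n)%nat -> w i < z i < w (S i).
Proof.
  intros Hc Hw Hs.
  assert (H : forall i, exists x, (i <= n)%nat -> w i < x < w (S i) /\ f x = 0).
  { intros i. destruct (Compare_dec.le_dec i n) as [Hi|Hi]; [|exists 0; lia].
    destruct (Hs i Hi) as [H1 H2].
    assert (Hin : forall x, w i <= x <= w (S i) -> a < x < b).
    { intros x Hx. pose proof (Hw i ltac:(lia)). pose proof (Hw (S i) ltac:(lia)). lra. }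
    assert (E : exists x, w i <= x <= w (S i) /\ f x = 0).
    { destruct (Rlt_dec (f (w i)) 0) as [h|h].
      - destruct (Ranalysis5.IVT_interv f (w i) (w (S i))) as [x Hx]; auto; [nra|].
        now exists x.
      - destruct (Ranalysis5.IVT_interv (fun x => - f x) (w i) (w (S i))) as [x [Hx Ex]]; auto.
        + intros x Hx. apply continuity_pt_opp. auto.
        + assert (f (w i) <> 0) by (intros E; rewrite E in H2; lra). lra.
        + nra.
        + exists x. split; [exact Hx|lra]. }
    destruct E as [x [Hx Ex]]. exists x. intros _. split; [|exact Ex].
    assert (x <> w i) by (intros ->; rewrite Ex in H2; lra).
    assert (x <> w (S i)) by (intros ->; rewrite Ex in H2; lra). lra. }
  destruct (functional_choice _ H) as [z Hz]. exists z. split; [split|].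
  - intros i Hi. destruct (Hz i ltac:(lia)), (Hz (S i) ltac:(lia)). lra.
  - intros i Hi. destruct (Hz i Hi) as [H1 H2]. split; [|exact H2].
    pose proof (Hw i ltac:(lia)). pose proof (Hw (S i) ltac:(lia)). lra.
  - intros i Hi. now apply Hz.
Qed.

(** * Uniform estimates near infinity in a ball of parameters *)

Definition uniform_returns (G r M : R) : Prop :=
  0 < r /\ 0 <= M /\ forall q u, pbound G q -> Rabs u <= r ->
    ret_facts G M q u /\ (0 < u -> left_half_return q (/ u) (/ ret q u)).

Lemma params_close_le e e' p q : e <= e' -> params_close e p q -> params_close e' p q.
Proof. unfold params_close. intros He H. repeat split; lra. Qed.

Lemma params_close_refl e p : 0 < e -> params_close e p p.
Proof. intros He. unfold params_close. rewrite !Rminus_diag, Rabs_R0. lra. Qed.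

Lemma params_close_trans e e' p q s :
  params_close e p q -> params_close e' q s -> params_close (e + e') p s.
Proof.
  unfold params_close. intros (A1 & A2 & A3 & A4 & A5) (B1 & B2 & B3 & B4 & B5).
  assert (T : forall x y z, Rabs (y - x) < e -> Rabs (z - y) < e' -> Rabs (z - x) < e + e').
  { intros x y z H1 H2. replace (z - x) with ((y - x) + (z - y)) by ring.
    eapply Rle_lt_trans; [apply Rabs_triang|]. lra. }
  repeat split; eapply T; eassumption.
Qed.

Lemma local_setup p : exists G r M, uniform_returns G r M /\
  forall q, params_close 1 p q -> pbound G q.
Proof.
  destruct (pbound_exists p) as [G0 [HG0 Hp]].
  destruct (half_return_uniform (G0 + 1) ltac:(lra)) as [r [M [Hr [HM H]]]].
  exists (G0 + 1), r, M. split; [now split|].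
  intros q (A1 & A2 & A3 & A4 & A5). destruct Hp as (B1 & B2 & B3 & B4 & B5).
  assert (T : forall x y, Rabs (y - x) < 1 -> Rabs x <= G0 -> Rabs y <= G0 + 1).
  { intros x y H1 H2. replace y with ((y - x) + x) by ring.
    eapply Rle_trans; [apply Rabs_triang|]. lra. }
  repeat split; eapply T; eassumption.
Qed.

Lemma uniform_mirror G r M q u : uniform_returns G r M -> pbound G q -> Rabs u <= r ->
  ret_facts G M q u /\ ret_facts G M (mirror q) u.
Proof.
  intros (_ & _ & H) Hq Hu. split; apply H; auto. now apply pbound_mirror.
Qed.

Lemma weight_diff G a b : Rabs a <= G -> Rabs b <= G ->
  Rabs (/ (1 + a ^ 2) - / (1 + b ^ 2)) <= 2 * G * Rabs (a - b).
Proof.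
  intros Ha Hb. pose proof (pow2_ge_0 a). pose proof (pow2_ge_0 b).
  replace (_ - _) with ((a - b) * (- (a + b) * (/ (1 + a ^ 2) * / (1 + b ^ 2)))) by (field; lra).
  rewrite Rabs_mult, Rmult_comm. apply Rmult_le_compat_r; [apply Rabs_pos|].
  rewrite Rabs_mult, Rabs_Ropp.
  assert (W : forall x, 0 <= x -> 0 < / (1 + x) <= 1).
  { intros x Hx. split; [apply Rinv_0_lt_compat; lra|].
    rewrite <- Rinv_1. apply Rinv_le_contravar; lra. }
  pose proof (W _ H). pose proof (W _ H0).
  rewrite (Rabs_pos_eq (_ * _)) by nra.
  assert (Rabs (a + b) <= 2 * G) by (eapply Rle_trans; [apply Rabs_triang|]; lra).
  pose proof (Rabs_pos (a + b)). rewrite <- (Rmult_1_r (2 * G)).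
  apply Rmult_le_compat; nra.
Qed.

Lemma slope0_continuous p eta : 0 < eta ->
  exists eps, 0 < eps /\ forall q, params_close eps p q -> Rabs (slope0 q - slope0 p) <= eta.
Proof.
  intros He.
  assert (C : continuity_pt (fun g => - exp (- g * PI)) (gammaL p)).
  { apply continuity_pt_filterlim.
    apply (ex_derive_continuous (K := R_AbsRing) (V := R_NormedModule) (fun g => - exp (- g * PI))).
    auto_derive. trivial. }
  destruct (C eta He) as [eps [Heps H]]. exists eps. split; [exact Heps|].
  intros q Hq. destruct (Req_dec (gammaL p) (gammaL q)) as [E|E].
  - unfold slope0. rewrite E, Rminus_diag, Rabs_R0. lra.
  - left. apply (H (gammaL q)). split; [now split|]. apply Hq.
Qed.

(** Only u, l and the parameters are moved to their values at p and u = 0; l' and l'' are known to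
    be bounded only, and stay as they are. This suffices, as in each case of [leading] the value of
    S^(j) at infinity does not involve them. *)
Lemma orbit_env_near p G r M eta : uniform_returns G r M ->
  (forall q, params_close 1 p q -> pbound G q) -> 0 < eta ->
  exists eps, 0 < eps <= 1 /\ eps <= r /\ forall q u, params_close eps p q -> Rabs u <= eps ->
    forall i, Rabs (orbit_env q u i
                    - venv p 0 (slope0 p) (ret_slope' q u) (ret_slope'' q u) i) <= eta.
Proof.
  intros (Hr & HM & H) HG He.
  destruct (slope0_continuous p (eta / 2) ltac:(lra)) as [e1 [He1 H1]].
  assert (Hp := HG p (params_close_refl 1 p Rlt_0_1)). assert (HG0 := pbound_pos G p Hp).
  set (e2 := eta / (2 * (M + G + 1))).
  assert (He2 : 0 < e2) by (apply Rdiv_lt_0_compat; lra).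
  assert (Eta : (M + G + 1) * e2 = eta / 2) by (unfold e2; field; lra).
  exists (Rmin (Rmin 1 r) (Rmin e1 e2)).
  set (eps := Rmin (Rmin 1 r) (Rmin e1 e2)).
  assert (Heps : 0 < eps) by (unfold eps; repeat apply Rmin_glb_lt; lra).
  assert (L1 : eps <= 1) by (unfold eps; eapply Rle_trans; [apply Rmin_l|apply Rmin_l]).
  assert (L2 : eps <= r) by (unfold eps; eapply Rle_trans; [apply Rmin_l|apply Rmin_r]).
  assert (L3 : eps <= e1) by (unfold eps; eapply Rle_trans; [apply Rmin_r|apply Rmin_l]).
  assert (L4 : eps <= e2) by (unfold eps; eapply Rle_trans; [apply Rmin_r|apply Rmin_r]).
  split; [lra|]. split; [exact L2|]. intros q u Hq Hu i.
  assert (Hqb := HG q (params_close_le _ _ _ _ L1 Hq)).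
  destruct (H q u Hqb ltac:(lra)) as [F _].
  assert (N := rf_near _ _ _ _ F). specialize (H1 q (params_close_le _ _ _ _ L3 Hq)).
  assert (eps <= eta / 2) by nra.
  assert (2 * G * eps <= eta) by nra.
  assert (M * Rabs u <= eta / 2) by (pose proof (Rabs_pos u); nra).
  destruct Hq as (A1 & A2 & A3 & A4 & A5).
  unfold orbit_env. destruct i as [|[|[|[|[|[|[|[|[|[|[|i]]]]]]]]]]]; cbn [venv];
    try (rewrite Rminus_diag, Rabs_R0; lra); try lra.
  - rewrite Rminus_0_r. lra.
  - replace (_ - _) with ((ret_slope q u - slope0 q) + (slope0 q - slope0 p)) by ring.
    eapply Rle_trans; [apply Rabs_triang|]. lra.
  - eapply Rle_trans; [apply (weight_diff G); [apply Hqb|apply Hp]|]. nra.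
  - eapply Rle_trans; [apply (weight_diff G); [apply Hqb|apply Hp]|]. nra.
Qed.

Lemma venv_bounded G p u l l' l'' B : pbound G p -> Rabs u <= B -> Rabs l <= B ->
  Rabs l' <= B -> Rabs l'' <= B -> G <= B -> 1 <= B ->
  forall i, Rabs (venv p u l l' l'' i) <= B.
Proof.
  intros (A1 & A2 & A3 & A4 & A5) Hu Hl Hl' Hl'' HB HB1 i.
  assert (W : forall g, Rabs (/ (1 + g ^ 2)) <= B).
  { intros g. pose proof (pow2_ge_0 g).
    rewrite Rabs_pos_eq by (left; apply Rinv_0_lt_compat; lra).
    apply Rle_trans with (/ 1); [apply Rinv_le_contravar|]; lra. }
  destruct i as [|[|[|[|[|[|[|[|[|[|[|i]]]]]]]]]]]; cbn [venv]; auto; try lra.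
  rewrite Rabs_R0. lra.
Qed.

Lemma peval_near p G r M e eta : uniform_returns G r M ->
  (forall q, params_close 1 p q -> pbound G q) -> 0 < eta ->
  exists eps, 0 < eps <= 1 /\ eps <= r /\ forall q u, params_close eps p q -> Rabs u <= eps ->
    Rabs (peval (orbit_env q u) e
          - peval (venv p 0 (slope0 p) (ret_slope' q u) (ret_slope'' q u)) e) <= eta.
Proof.
  intros U HG He.
  assert (Hp := HG p (params_close_refl 1 p Rlt_0_1)). assert (HG0 := pbound_pos G p Hp).
  set (B := 1 + r + M + G + exp (G * PI)).
  destruct (peval_lipschitz e B) as [C [HC L]].
  assert (He' : 0 < eta / (C + 1)) by (apply Rdiv_lt_0_compat; lra).
  destruct (orbit_env_near p G r M _ U HG He') as [eps [Heps [Her H]]].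
  exists eps. split; [exact Heps|]. split; [exact Her|]. intros q u Hq Hu.
  destruct U as (Hr & HM & U).
  assert (Hqb := HG q (params_close_le _ _ _ _ (proj2 Heps) Hq)).
  destruct (U q u Hqb ltac:(lra)) as [F _].
  pose proof (exp_pos (G * PI)).
  assert (S := slope0_bounds G p Hp). pose proof (exp_pos (- (G * PI))).
  pose proof (rf_bound _ _ _ _ F). pose proof (rf_bound' _ _ _ _ F).
  pose proof (rf_bound'' _ _ _ _ F).
  eapply Rle_trans; [apply (L _ _ (eta / (C + 1)))|].
  - apply (venv_bounded G); auto; unfold B; lra.
  - apply (venv_bounded G); auto; unfold B; try lra.
    + rewrite Rabs_R0. lra.
    + rewrite Rabs_left; lra.
  - now apply H.
  - apply Rle_trans with ((C + 1) * (eta / (C + 1))); [nra|]. right. field. lra.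
Qed.

(** The sign of S^(j) persists on one neighbourhood of p and u = 0 together, the same for all nearby
    parameters; the uniform zero count rests on it. *)
Lemma xSder_near p G r M j : uniform_returns G r M ->
  (forall q, params_close 1 p q -> pbound G q) -> leading p j ->
  exists eps, 0 < eps <= 1 /\ eps <= r /\ forall q u, params_close eps p q -> Rabs u <= eps ->
    lead_value p j ^ 2 / 2 <= lead_value p j * peval (orbit_env q u) (xSder j)
       <= 2 * lead_value p j ^ 2.
Proof.
  intros U HG Hl. set (v := lead_value p j). assert (Hv : v <> 0) by apply Hl.
  assert (Hv' := Rabs_pos_lt v Hv).
  destruct (peval_near p G r M (xSder j) (Rabs v / 2) U HG ltac:(lra)) as [eps [Heps [Her H]]].
  exists eps. split; [exact Heps|]. split; [exact Her|]. intros q u Hq Hu.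
  specialize (H q u Hq Hu). rewrite (xSder_leading p j _ _ Hl) in H. fold v in H.
  set (w := peval _ _) in *.
  assert (Rabs (v * (w - v)) <= v ^ 2 / 2).
  { rewrite Rabs_mult, <- (pow2_abs v). nra. }
  apply Rabs_le_between in H0. nra.
Qed.

Lemma gap_weight_bounds G M p u : 0 <= M -> pbound G p -> ret_facts G M p u ->
  / 16 <= gap_weight p u <= 128 * (M + 1).
Proof.
  intros HM Hp F. assert (Hp' := pbound_mirror G p Hp).
  assert (N := rf_neg _ _ _ _ F). pose proof (exp_pos (- (G * PI))).
  assert (B := rf_bound _ _ _ _ F). apply Rabs_le_between in B.
  assert (Su := rf_safe _ _ _ _ F). assert (Sv := rf_safe_ret _ _ _ _ F).
  destruct (safe_bounds G p u Hp Su) as [Lu _].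
  destruct (safe_bounds G p _ Hp Sv) as [_ [Bv _]].
  destruct (safe_bounds G (mirror p) u Hp' Su) as [Ru _].
  destruct (safe_bounds G (mirror p) _ Hp' Sv) as [Rv _].
  assert (X1 := cE_pos p u Lu). assert (X2 := cE_pos _ u Ru). assert (X3 := cE_pos _ _ Rv).
  assert (Y1 := cE_upper G p u Hp Su). assert (Y2 := cE_upper G _ u Hp' Su).
  assert (Y3 := cE_upper G _ _ Hp' Sv).
  assert (Y4 := bb_upper G p _ Hp Sv). apply Rabs_le_between in Y4.
  unfold gap_weight.
  set (e1 := cE (mirror p) u) in *. set (e2 := cE p u) in *.
  set (e3 := cE (mirror p) (ret p u)) in *. set (e4 := bb p * ret p u) in *.
  assert (P1 : / 16 <= e1 * e2 <= 4) by nra.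
  assert (P2 : / 8 <= e3 * (1 + e4) <= 9 / 4) by nra.
  assert (P3 : / 128 <= e1 * e2 * e3 * (1 + e4) <= 9).
  { rewrite Rmult_assoc. split; [apply Rle_trans with (/ 16 * / 8)|apply Rle_trans with (4 * (9 / 4))];
      try lra; apply Rmult_le_compat; lra. }
  set (D := e1 * e2 * e3 * (1 + e4)) in *.
  assert (Q : / 9 <= / D <= 128).
  { split; [apply Rinv_le_contravar; lra|]. rewrite <- (Rinv_inv 128). apply Rinv_le_contravar; lra. }
  unfold Rdiv. split.
  - apply Rle_trans with (1 * / 9); [lra|]. apply Rmult_le_compat; lra.
  - rewrite (Rmult_comm 128). apply Rmult_le_compat; lra.
Qed.

(** K varies with u but stays between fixed positive bounds. The extra factor u turns order n of
    [gap] into order n + 1 of Delta. *)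
Lemma gap_disp G r M p : uniform_returns G r M -> pbound G p ->
  exists k1 k2, 0 < k1 /\ forall u, 0 < u <= r ->
    exists K, k1 <= K <= k2 /\ disp p u * K = gap p u * u.
Proof.
  intros U Hp. exists (/ (4 * (M + 1))), (9 / exp (- (G * PI))).
  assert (HM : 0 <= M) by apply U.
  split; [apply Rinv_0_lt_compat; lra|]. intros u Hu.
  destruct (uniform_mirror G r M p u U Hp) as [F F']; [rewrite Rabs_pos_eq; lra|].
  destruct (gap_displacement G M p u HM Hp F F') as [K [HK E]].
  exists K. split; [exact HK|]. rewrite E. unfold disp, ret. ring.
Qed.

Lemma gap_sign G r M p s u : uniform_returns G r M -> pbound G p -> 0 < u <= r ->
  (0 < s * gap p u <-> 0 < s * disp p u).
Proof.
  intros U Hp Hu. destruct (gap_disp G r M p U Hp) as [k1 [k2 [Hk H]]].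
  destruct (H u Hu) as [K [HK E]].
  assert (E1 : s * disp p u * K = s * gap p u * u) by (rewrite !Rmult_assoc, E; reflexivity).
  split; intros H0.
  - assert (0 < s * disp p u * K) by (rewrite E1; apply Rmult_lt_0_compat; lra). nra.
  - assert (0 < s * gap p u * u) by (rewrite <- E1; apply Rmult_lt_0_compat; lra). nra.
Qed.

Lemma gap_zero G r M p u : uniform_returns G r M -> pbound G p -> 0 < u <= r ->
  (gap p u = 0 <-> disp p u = 0).
Proof.
  intros U Hp Hu. destruct (gap_disp G r M p U Hp) as [k1 [k2 [Hk H]]].
  destruct (H u Hu) as [K [HK E]]. split; intros H0; rewrite H0 in E; nra.
Qed.

Lemma gap_order_disp G r M p s n : uniform_returns G r M -> pbound G p -> s <> 0 ->
  signed_order s (gap p) n -> has_order (disp p) (S n).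
Proof.
  intros U Hp Hs Ho. destruct (gap_disp G r M p U Hp) as [k1 [k2 [Hk H]]].
  destruct (signed_order_has_order s _ n Hs Ho) as (d & c & C & Hd & Hc & Hg).
  assert (Hr : 0 < r) by apply U.
  assert (Hk2 : k1 <= k2) by (destruct (H r ltac:(lra)) as [K [HK _]]; lra).
  exists (Rmin d r), (c / k2), (C / k1).
  split; [now apply Rmin_glb_lt|]. split; [apply Rdiv_lt_0_compat; lra|].
  intros u [Hu0 Hu]. pose proof (Rmin_l d r). pose proof (Rmin_r d r).
  specialize (Hg u ltac:(lra)). destruct (H u ltac:(lra)) as [K [HK E]].
  assert (HE : Rabs (disp p u) = Rabs (gap p u) * u * / K).
  { replace (disp p u) with (gap p u * u * / K) by (rewrite <- E; field; lra).
    rewrite !Rabs_mult, (Rabs_pos_eq u), (Rabs_pos_eq (/ K));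
      [reflexivity|left; apply Rinv_0_lt_compat|]; lra. }
  rewrite HE. simpl pow.
  assert (Hun : 0 < u ^ n) by (apply pow_lt; lra).
  assert (J1 : / k2 <= / K) by (apply Rinv_le_contravar; lra).
  assert (J2 : / K <= / k1) by (apply Rinv_le_contravar; lra).
  assert (J0 : 0 < / k2) by (apply Rinv_0_lt_compat; lra).
  assert (HC : 0 <= C * u ^ n) by (pose proof (Rabs_pos (gap p u)); lra).
  split.
  - replace (c / k2 * (u * u ^ n)) with (c * u ^ n * u * / k2) by (unfold Rdiv; ring).
    apply Rmult_le_compat; try lra; [|apply Rmult_le_compat_r; lra].
    apply Rmult_le_pos; [|lra]. apply Rmult_le_pos; lra.
  - replace (C / k1 * (u * u ^ n)) with (C * u ^ n * u * / k1) by (unfold Rdiv; ring).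
    apply Rmult_le_compat; try lra; [|apply Rmult_le_compat_r; lra].
    apply Rmult_le_pos; [|lra]. apply Rabs_pos.
Qed.

(** S^(j) has order 0, and each integration from a zero value at u = 0 raises the order by one: from
    S^(j) up to S, then to [gap], where gap 0 = 0 because the trace sum vanishes. The sign flips
    once, through the minus in [is_derive_gap]. *)
Lemma leading_gap_order p j : gammaL p + gammaR p = 0 -> leading p j ->
  signed_order (- lead_value p j) (gap p) (S j).
Proof.
  intros Hs Hl. destruct (local_setup p) as (G & r & M & U & HG).
  assert (Hp := HG p (params_close_refl 1 p Rlt_0_1)).
  destruct (xSder_near p G r M j U HG Hl) as [eps [Heps [Her H]]].
  set (v := lead_value p j) in *. assert (Hv : v <> 0) by apply Hl.
  assert (Hr : 0 < r) by apply U. assert (HM : 0 <= M) by apply U.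
  assert (F : forall t, 0 <= t < r -> ret_facts G M p t).
  { intros t Ht. apply U; [exact Hp|]. rewrite Rabs_pos_eq; lra. }
  pose (Sj := fun i u => peval (orbit_env p u) (xSder i)).
  assert (Base : signed_order v (Sj j) 0).
  { exists eps, (v ^ 2 / 2), (2 * v ^ 2). split; [lra|].
    split; [pose proof (pow2_gt_0 v Hv); lra|]. intros u Hu. rewrite pow_O, !Rmult_1_r.
    apply H; [apply params_close_refl; lra|rewrite Rabs_pos_eq; lra]. }
  assert (Step : forall i n, (i < 2)%nat -> Sj i 0 = 0 -> signed_order v (Sj (S i)) n ->
                 signed_order v (Sj i) (S n)).
  { intros i n Hi H0. apply (signed_order_integral v (Sj i) (Sj (S i)) n r Hr H0).
    intros t Ht. apply (is_derive_peval G M); [now apply F|now apply xSder_var3_free]. }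
  destruct (xSder_values p (ret_slope' p 0) (ret_slope'' p 0)) as [Z0 [Z1 _]].
  rewrite <- ret_slope_0 in Z0, Z1 at 1.
  assert (HS : signed_order v (Sj 0%nat) j).
  { destruct Hl as [_ [-> | [[-> H1] | [-> [H1 H2]]]]].
    - exact Base.
    - apply Step; [lia|exact (eq_trans Z0 H1)|exact Base].
    - apply Step; [lia|exact (eq_trans Z0 H1)|]. apply Step; [lia| |exact Base].
      transitivity (lead2 p * (1 + slope0 p)); [exact Z1|rewrite H2; ring]. }
  assert (HF : signed_order (- v) (fun u => - (gap_weight p u * Sj 0%nat u)) j).
  { apply signed_order_opp. apply (signed_order_mult v _ _ j r (/ 16) (128 * (M + 1))); try lra; auto.
    intros u Hu. apply (gap_weight_bounds G); auto. apply F. lra. }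
  apply (signed_order_integral (- v) (gap p) (fun u => - (gap_weight p u * Sj 0%nat u)) j r Hr); [| |exact HF].
  - rewrite gap_0, Hs. ring.
  - intros t Ht. apply (is_derive_gap G M); auto.
Qed.

Lemma leading_weak_focus p j : gammaL p + gammaR p = 0 -> leading p j ->
  infinity_weak_focus p (S j).
Proof.
  intros Hs Hl. apply has_order_weak_focus; [exact Hs|].
  destruct (local_setup p) as (G & r & M & U & HG).
  apply (gap_order_disp G r M p (- lead_value p j)); auto.
  - apply HG, params_close_refl, Rlt_0_1.
  - destruct Hl. lra.
  - now apply leading_gap_order.
Qed.

(** * Weak foci and centers *)

(** The first alternative is symmetry of the system under (x, y, t) to (-x, y, -t), the second gives
    each field the symmetry (x, y, t) to (x, -y, -t). *)
Definition reversible (p : params) : Prop :=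
  mirror p = p \/ (gammaL p = 0 /\ gammaR p = 0 /\ bb p = 0).

Lemma leading_or_reversible p : gammaL p + gammaR p = 0 ->
  (exists j, leading p j) \/ reversible p.
Proof.
  intros Hs. assert (HgR : gammaR p = - gammaL p) by lra.
  destruct (Req_dec (lead1 p) 0) as [H1|H1]; [|left; exists 0%nat; split; auto].
  assert (Hw : 0 < / (1 + gammaL p ^ 2)).
  { apply Rinv_0_lt_compat. pose proof (pow2_ge_0 (gammaL p)). lra. }
  assert (E1 : bb p = gammaL p * (alphaL p + alphaR p) * / (1 + gammaL p ^ 2)).
  { unfold lead1 in H1. rewrite cA_mirror, HgR in H1. unfold cA, Rdiv in H1.
    replace ((- gammaL p) ^ 2) with (gammaL p ^ 2) in H1 by ring. lra. }
  destruct (Req_dec (gammaL p) 0) as [Hg|Hg].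
  { right. right. rewrite HgR, E1, Hg. repeat split; ring. }
  (* This factor of [lead_value p 1] vanishes exactly when gammaL = 0, hence the separate treatment
     of that case above. *)
  assert (Hsl : 1 + slope0 p <> 0).
  { unfold slope0. intros E. apply Hg. pose proof PI_RGT_0.
    assert (- gammaL p * PI = 0) by (apply exp_inv; rewrite exp_0; lra). nra. }
  destruct (Req_dec (lead2 p) 0) as [H2|H2].
  - destruct (Req_dec (lead3 p) 0) as [H3|H3].
    + right. left.
      (* [lead3] is b times a sum of four squares; if the sum vanishes, then cA = cB = 0 and b = cB
         + gammaL cA = 0 all the same. *)
      assert (Hb : bb p = 0).
      { unfold lead3 in H3. apply Rmult_integral in H3. destruct H3 as [H3|H3]; [exact H3|].
        unfold cC in H3. assert (cA p = 0) by nra. assert (B0 : cB p = 0) by nra.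
        unfold cB in B0. rewrite H in B0. lra. }
      rewrite Hb in E1. symmetry in E1.
      apply Rmult_integral in E1. destruct E1 as [E1|E1]; [|lra].
      apply Rmult_integral in E1. destruct E1 as [E1|E1]; [lra|].
      unfold mirror. destruct p as [gL gR aL aR b]; simpl in *. f_equal; lra.
    + left. exists 2%nat. split; [|auto]. simpl.
      apply Rmult_integral_contrapositive_currified; [lra|]. nra.
  - left. exists 1%nat. split; [|auto]. simpl. now apply Rmult_integral_contrapositive_currified.
Qed.

(** Here cB = 0, so E is even and the arctangent drops out: v = - u satisfies the integral relation,
    and uniqueness of the return identifies it with [ret]. *)
Lemma ret_odd p : gammaL p = 0 -> bb p = 0 ->
  exists delta, 0 < delta /\ forall u, 0 < u < delta -> ret p u = - u.
Proof.
  intros Hg Hb. destruct (pbound_exists p) as [G [HG Hp]].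
  destruct (left_half_return_of_integral G HG) as [r [Hr H]].
  destruct (half_returns_near_infinity p) as [d [Hd H']].
  assert (Hs := safe_pos G HG).
  exists (Rmin d (Rmin r (safe G))). split; [repeat apply Rmin_glb_lt; lra|].
  intros u [Hu0 Hu]. pose proof (Rmin_l d (Rmin r (safe G))). pose proof (Rmin_r d (Rmin r (safe G))).
  pose proof (Rmin_l r (safe G)). pose proof (Rmin_r r (safe G)).
  assert (HB : cB p = 0) by (unfold cB; rewrite Hg, Hb; ring).
  assert (L : left_half_return p (/ u) (/ - u)).
  { apply H; auto; try lra. rewrite Ropp_involutive. unfold log_spiral, cE. rewrite Hg, HB.
    replace (1 + 2 * 0 * - u + cC p * (- u) ^ 2) with (1 + 2 * 0 * u + cC p * u ^ 2) by ring. ring. }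
  destruct (H' u ltac:(lra)) as [L' _].
  pose proof (left_half_return_unique _ _ _ _ L L') as E.
  rewrite <- (Rinv_inv (ret p u)), <- E. apply Rinv_inv.
Qed.

Lemma reversible_disp p : reversible p ->
  exists delta, 0 < delta /\ forall u, 0 < u < delta -> disp p u = 0.
Proof.
  intros [E|[E1 [E2 E3]]].
  - exists 1. split; [lra|]. intros u _. unfold disp. rewrite E. ring.
  - destruct (ret_odd p E1 E3) as [d [Hd H]].
    destruct (ret_odd (mirror p)) as [d' [Hd' H']]; [simpl; lra|simpl; lra|].
    exists (Rmin d d'). split; [now apply Rmin_glb_lt|]. intros u [Hu0 Hu].
    pose proof (Rmin_l d d'). pose proof (Rmin_r d d').
    unfold disp. rewrite H, H' by lra. ring.
Qed.

(** Orders above 3 are excluded because without a leading value the system is reversible, and then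
    Delta vanishes near infinity. *)
Lemma weak_focus_leading p k : infinity_weak_focus p k -> exists j, k = S j /\ leading p j.
Proof.
  intros Hk. assert (Hs := weak_focus_trace p k Hk). assert (Ho := weak_focus_has_order p k Hk).
  destruct (leading_or_reversible p Hs) as [[j Hj]|Hr].
  - exists j. split; [|exact Hj].
    assert (Ho' := weak_focus_has_order p _ (leading_weak_focus p j Hs Hj)).
    pose proof (has_order_unique _ _ _ Ho Ho'). lia.
  - exfalso. destruct (reversible_disp p Hr) as [d [Hd H]].
    destruct (has_order_nonzero _ _ d Hd Ho) as [u [Hu Hne]]. now apply Hne, H.
Qed.

Lemma weak_focus_orders k :
  (exists p, infinity_weak_focus p k) <-> (k = 1 \/ k = 2 \/ k = 3)%nat.
Proof.
  assert (Ex : forall p j, leading p j -> gammaL p + gammaR p = 0 ->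
            exists p, infinity_weak_focus p (S j)).
  { intros p j Hl Hs. exists p. now apply leading_weak_focus. }
  split.
  - intros [p Hp]. destruct (weak_focus_leading p k Hp) as [j [-> [_ Hj]]]. lia.
  - assert (Hs1 : 1 + slope0 (Params 1 (-1) 0 1 (/ 2)) <> 0).
    { unfold slope0; simpl. intros E. pose proof PI_RGT_0.
      assert (- (1) * PI = 0) by (apply exp_inv; rewrite exp_0; lra). lra. }
    (* In the first witness b = 1 alone gives lead1 = -2. In the others gammaL = 1 and b = (alphaL +
       alphaR)/2 annihilate lead1; alphaR^2 differs from alphaL^2 in the second and equals it in the
       third, where b = 1 keeps lead3 nonzero. *)
    intros [-> | [-> | ->]].
    + apply (Ex (Params 0 0 0 0 1)); [|simpl; lra].
      split; [|auto]. simpl. unfold lead1, cA; simpl. lra.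
    + apply (Ex (Params 1 (-1) 0 1 (/ 2))); [|simpl; lra]. split.
      * simpl. apply Rmult_integral_contrapositive_currified; [|exact Hs1].
        unfold lead2; simpl. lra.
      * right. left. split; [reflexivity|]. unfold lead1, cA; simpl. field.
    + apply (Ex (Params 1 (-1) 1 1 1)); [|simpl; lra]. split.
      * simpl. set (s := slope0 _). apply Rmult_integral_contrapositive_currified; [|nra].
        unfold lead3, cC, cB, cA; simpl. intros E. field_simplify in E; lra.
      * right. right. split; [reflexivity|]. unfold lead1, lead2, cA; simpl. split; field.
Qed.

(** * Bounding the number of limit cycles *)

(** By Rolle, j + 2 zeros of [gap] would give j + 1 zeros of S and finally a zero of S^(j), which
    keeps its sign on (0, eps) for every q of the ball. *)
Lemma gap_zero_count p j G r M : uniform_returns G r M ->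
  (forall q, params_close 1 p q -> pbound G q) -> leading p j ->
  exists eps, 0 < eps <= 1 /\ eps <= r /\ forall q z, params_close eps p q ->
    ~ chain 0 eps (gap q) (S j) z.
Proof.
  intros U HG Hl. destruct (xSder_near p G r M j U HG Hl) as [eps [Heps [Her H]]].
  exists eps. split; [exact Heps|]. split; [exact Her|]. intros q z Hq Hz.
  assert (Hqb := HG q (params_close_le _ _ _ _ (proj2 Heps) Hq)).
  assert (HM : 0 <= M) by apply U.
  assert (F : forall t, 0 < t < eps -> ret_facts G M q t).
  { intros t Ht. apply U; [exact Hqb|]. rewrite Rabs_pos_eq; lra. }
  assert (Hne : forall t, 0 < t < eps -> peval (orbit_env q t) (xSder j) <> 0).
  { intros t Ht E. specialize (H q t Hq). rewrite E in H.
    pose proof (pow2_gt_0 _ (proj1 Hl)). rewrite Rabs_pos_eq in H; lra. }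
  destruct (chain_Rolle _ _ _ _ _ _ (fun x Hx => is_derive_gap G M q x Hqb (F x Hx)) Hz) as [z1 Hz1].
  assert (Hz2 : chain 0 eps (fun t => peval (orbit_env q t) (xSder 0)) j z1).
  { destruct Hz1 as [A B]. split; [exact A|]. intros i Hi. destruct (B i Hi) as [B1 B2].
    split; [exact B1|]. pose proof (gap_weight_bounds G M q _ HM Hqb (F _ B1)).
    change (xSder 0) with xS. nra. }
  assert (Hd : forall i, (i < 2)%nat -> forall x, 0 < x < eps ->
    is_derive (fun t => peval (orbit_env q t) (xSder i)) x (peval (orbit_env q x) (xSder (S i)))).
  { intros i Hi x Hx. apply (is_derive_peval G M); [now apply F|now apply xSder_var3_free]. }
  assert (End : forall z, ~ chain 0 eps (fun t => peval (orbit_env q t) (xSder j)) 0 z).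
  { intros z' [_ B]. destruct (B 0%nat (le_n 0)) as [B1 B2]. now apply (Hne _ B1). }
  destruct Hl as [_ [-> | [[-> _] | [-> _]]]].
  - exact (End _ Hz2).
  - destruct (chain_Rolle _ _ _ _ _ _ (Hd 0%nat ltac:(lia)) Hz2) as [z3 Hz3]. exact (End _ Hz3).
  - destruct (chain_Rolle _ _ _ _ _ _ (Hd 0%nat ltac:(lia)) Hz2) as [z3 Hz3].
    destruct (chain_Rolle _ _ _ _ _ _ (Hd 1%nat ltac:(lia)) Hz3) as [z4 Hz4]. exact (End _ Hz4).
Qed.

(** * Perturbations *)

Definition line (p d : params) (t : R) : params :=
  Params (gammaL p + t * gammaL d) (gammaR p + t * gammaR d) (alphaL p + t * alphaL d)
         (alphaR p + t * alphaR d) (bb p + t * bb d).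

Lemma mirror_line p d t : mirror (line p d t) = line (mirror p) (mirror d) t.
Proof. unfold mirror, line; simpl. f_equal; ring. Qed.

Lemma line_close p d eps : 0 < eps ->
  exists tau, 0 < tau /\ forall t, Rabs t < tau -> params_close eps p (line p d t).
Proof.
  intros He. destruct (pbound_exists d) as [D [HD Hd]].
  exists (eps / (D + 1)). split; [apply Rdiv_lt_0_compat; lra|]. intros t Ht.
  assert (T : forall a, Rabs a <= D -> Rabs (t * a) < eps).
  { intros a Ha. rewrite Rabs_mult. apply Rle_lt_trans with (Rabs t * (D + 1)).
    - apply Rmult_le_compat_l; [apply Rabs_pos|lra].
    - apply (Rmult_lt_compat_r (D + 1)) in Ht; [|lra].
      replace (eps / (D + 1) * (D + 1)) with eps in Ht by (field; lra). exact Ht. }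
  destruct Hd as (A1 & A2 & A3 & A4 & A5).
  unfold params_close, line; simpl.
  repeat split; match goal with |- Rabs (?a + ?b - ?a) < _ =>
    replace (a + b - a) with b by ring; apply T; assumption end.
Qed.

(* The left first integral separates points of the negative axis, so comparing
   the image of u with v does not require computing it. *)
Definition ret_test (p : params) (u v : R) : R :=
  ln (- v) + log_spiral p v - (ln u + log_spiral p u - gammaL p * PI).

Lemma ret_test_sign G M p u v : pbound G p -> ret_facts G M p u -> 0 < u ->
  - safe G <= v < 0 -> exists k, 0 < k /\ ret_test p u v = k * (ret p u - v).
Proof.
  intros Hp F Hu Hv.
  assert (N := rf_neg _ _ _ _ F). pose proof (exp_pos (- (G * PI))).
  assert (Sr := rf_safe_ret _ _ _ _ F). apply Rabs_le_between in Sr.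
  assert (I := rf_int _ _ _ _ F).
  assert (Hr : ret p u < 0) by (unfold ret; nra).
  pose (f := fun x => ln (- x) + log_spiral p x).
  pose (f' := fun x => (1 + bb p * x) / (x * cE p x)).
  assert (E0 : ret_test p u v = f v - f (ret p u)).
  { unfold ret_test, f. unfold ret at 1.
    replace (- (u * ret_slope p u)) with (u * - ret_slope p u) by ring.
    rewrite ln_mult by lra. lra. }
  assert (D : forall x, Rmin (ret p u) v <= x <= Rmax (ret p u) v ->
            is_derive f x (f' x) /\ f' x < 0).
  { intros x Hx.
    assert (Hx' : - safe G <= x < 0) by (unfold Rmin, Rmax in Hx; destruct (Rle_dec (ret p u) v); lra).
    destruct (safe_bounds G p x Hp) as [S1 [S2 _]]; [apply Rabs_le; lra|].
    assert (E := cE_pos p x S1). split.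
    - unfold f. evar_last.
      + apply (is_derive_plus (K := R_AbsRing) (V := R_NormedModule)).
        * apply (is_derive_comp ln (fun x => - x)); [apply is_derive_ln; lra|].
          apply (is_derive_opp (K := R_AbsRing) (V := R_NormedModule)), is_derive_id.
        * now apply is_derive_log_spiral.
      + unfold plus, scal, opp, one; simpl. unfold mult; simpl. unfold f', cE in *. field. split; lra.
    - unfold f', Rdiv. assert (x * cE p x < 0) by nra.
      assert (/ (x * cE p x) < 0) by now apply Rinv_lt_0_compat. nra. }
  destruct (MVT_gen f (ret p u) v f') as [c [Hc E]].
  - intros x Hx. apply D. lra.
  - intros x Hx. apply continuity_pt_filterlim.
    apply (ex_derive_continuous (K := R_AbsRing) (V := R_NormedModule)). eexists. now apply D.
  - exists (- f' c). split; [destruct (D c Hc); lra|]. rewrite E0, E. ring.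
Qed.

Lemma ret_test_line_continuous G p d u v : pbound G p -> Rabs u <= safe G -> Rabs v <= safe G ->
  continuity_pt (fun t => ret_test (line p d t) u v) 0.
Proof.
  intros Hp Hu Hv.
  assert (S : forall x, Rabs x <= safe G ->
    continuity_pt (fun t => log_spiral (line p d t) x) 0).
  { intros x Hx. destruct (safe_bounds G p x Hp Hx) as [S1 _]. assert (E := cE_pos p x S1).
    apply continuity_pt_filterlim.
    apply (ex_derive_continuous (K := R_AbsRing) (V := R_NormedModule)
             (fun t => log_spiral (line p d t) x)).
    unfold log_spiral, cE, cC, cB, cA, Rdiv in *. cbn -[pow].
    pose proof (pow2_ge_0 (gammaL p)).
    auto_derive. rewrite !Rmult_0_l, !Rplus_0_r. simpl in *. repeat split; lra. }
  assert (T : forall k x, Rabs x <= safe G ->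
    continuity_pt (fun t => k + log_spiral (line p d t) x) 0).
  { intros k x Hx. apply (continuity_pt_plus (fun _ => k) (fun t => log_spiral (line p d t) x)); auto.
    apply continuity_pt_const. intros ? ?. reflexivity. }
  apply (continuity_pt_minus (fun t => ln (- v) + log_spiral (line p d t) v)
    (fun t => ln u + log_spiral (line p d t) u - gammaL (line p d t) * PI)); auto.
  apply (continuity_pt_minus (fun t => ln u + log_spiral (line p d t) u)
    (fun t => gammaL (line p d t) * PI)); auto.
  apply continuity_pt_filterlim.
  apply (ex_derive_continuous (K := R_AbsRing) (V := R_NormedModule)
           (fun t => gammaL (line p d t) * PI)).
  cbn. auto_derive. trivial.
Qed.

Lemma continuity_pt_sign f s : continuity_pt f 0 -> 0 < s * f 0 ->
  exists tau, 0 < tau /\ forall t, Rabs t < tau -> 0 < s * f t.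
Proof.
  intros C H. assert (s <> 0) by (intros ->; lra). assert (Hs := Rabs_pos_lt s H0).
  destruct (C (s * f 0 / Rabs s)) as [tau [Ht K]]; [now apply Rdiv_lt_0_compat|].
  exists tau. split; [exact Ht|]. intros t Ht'.
  destruct (Req_dec 0 t) as [<-|Hne]; [exact H|].
  specialize (K t). simpl in K. unfold Rdist in K.
  assert (K' : Rabs (f t - f 0) < s * f 0 / Rabs s).
  { apply K. split; [now split|]. now rewrite Rminus_0_r. }
  apply (Rmult_lt_compat_l (Rabs s)) in K'; [|exact Hs].
  replace (Rabs s * (s * f 0 / Rabs s)) with (s * f 0) in K' by (field; lra).
  rewrite <- Rabs_mult in K'. apply Rabs_lt_between in K'. lra.
Qed.

Lemma ret_sign_persists G r M p d s u v tau0 : uniform_returns G r M -> 0 < tau0 ->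
  (forall t, Rabs t < tau0 -> pbound G (line p d t)) -> 0 < u <= r -> - safe G <= v < 0 ->
  0 < s * (ret p u - v) ->
  exists tau, 0 < tau /\ forall t, Rabs t < tau -> 0 < s * (ret (line p d t) u - v).
Proof.
  intros U Ht0 HG Hu Hv Hs.
  assert (Hu' : Rabs u <= r) by (rewrite Rabs_pos_eq; lra).
  assert (Fl : forall t, Rabs t < tau0 -> ret_facts G M (line p d t) u).
  { intros t Ht. apply U; auto. }
  assert (E0 : line p d 0 = p).
  { destruct p; unfold line; simpl. f_equal; ring. }
  assert (H0 : Rabs 0 < tau0) by (rewrite Rabs_R0; exact Ht0).
  assert (Hp := HG 0 H0). assert (F := Fl 0 H0). rewrite E0 in Hp, F.
  destruct (continuity_pt_sign (fun t => ret_test (line p d t) u v) s) as [tau [Ht K]].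
  - apply (ret_test_line_continuous G); [exact Hp|apply (rf_safe _ _ _ _ F)|apply Rabs_le; lra].
  - rewrite E0. destruct (ret_test_sign G M p u v Hp F ltac:(lra) Hv) as [k [Hk ->]].
    replace (s * (k * (ret p u - v))) with (k * (s * (ret p u - v))) by ring.
    now apply Rmult_lt_0_compat.
  - exists (Rmin tau tau0). split; [now apply Rmin_glb_lt|]. intros t Hlt.
    pose proof (Rmin_l tau tau0). pose proof (Rmin_r tau tau0).
    specialize (K t ltac:(lra)).
    destruct (ret_test_sign G M _ u v (HG t ltac:(lra)) (Fl t ltac:(lra)) ltac:(lra) Hv)
      as [k [Hk E]].
    simpl in K. rewrite E in K.
    replace (s * (k * (ret (line p d t) u - v))) with (k * (s * (ret (line p d t) u - v))) in K by ring.
    nra.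
Qed.

(** The midpoint of the left and right images separates them at p, and [ret_sign_persists] keeps
    each image on its own side of this fixed point for small t. *)
Lemma gap_sign_persists G r M p d s u tau0 : uniform_returns G r M -> 0 < tau0 ->
  (forall t, Rabs t < tau0 -> pbound G (line p d t)) -> 0 < u <= r ->
  0 < s * gap p u ->
  exists tau, 0 < tau /\ forall t, Rabs t < tau -> 0 < s * gap (line p d t) u.
Proof.
  intros U Ht0 HG Hu Hs.
  assert (E0 : line p d 0 = p).
  { destruct p; unfold line; simpl. f_equal; ring. }
  assert (Hp : pbound G p) by (rewrite <- E0; apply HG; rewrite Rabs_R0; exact Ht0).
  apply (gap_sign G r M p s u U Hp Hu) in Hs. unfold disp in Hs.
  assert (Hu' : Rabs u <= r) by (rewrite Rabs_pos_eq; lra).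
  destruct (uniform_mirror G r M p u U Hp Hu') as [F F'].
  assert (N := rf_neg _ _ _ _ F). assert (N' := rf_neg _ _ _ _ F').
  pose proof (exp_pos (- (G * PI))).
  assert (S := rf_safe_ret _ _ _ _ F). assert (S' := rf_safe_ret _ _ _ _ F').
  apply Rabs_le_between in S. apply Rabs_le_between in S'.
  assert (R1 : ret p u < 0) by (unfold ret; nra).
  assert (R2 : ret (mirror p) u < 0) by (unfold ret; nra).
  set (v := (ret p u + ret (mirror p) u) / 2).
  assert (Hv : - safe G <= v < 0) by (unfold v; lra).
  destruct (ret_sign_persists G r M p d s u v tau0 U Ht0 HG Hu Hv) as [t1 [Ht1 K1]];
    [unfold v; lra|].
  destruct (ret_sign_persists G r M (mirror p) (mirror d) (- s) u v tau0 U Ht0) as [t2 [Ht2 K2]];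
    auto; [|unfold v; lra|].
  - intros t Ht. rewrite <- mirror_line. now apply pbound_mirror, HG.
  - exists (Rmin (Rmin t1 t2) tau0). split; [repeat apply Rmin_glb_lt; lra|]. intros t Hlt.
    pose proof (Rmin_l (Rmin t1 t2) tau0). pose proof (Rmin_r (Rmin t1 t2) tau0).
    pose proof (Rmin_l t1 t2). pose proof (Rmin_r t1 t2).
    apply (gap_sign G r M); auto; [apply HG; lra|].
    specialize (K1 t ltac:(lra)). specialize (K2 t ltac:(lra)). rewrite <- mirror_line in K2.
    unfold disp. lra.
Qed.

(** * Crossing periodic orbits and zeros of the gap function *)

Lemma displacement_disp G r M q u : uniform_returns G r M -> pbound G q -> 0 < u <= r ->
  displacement q u 0 -> gap q u = 0.
Proof.
  intros U Hq Hu (y1 & y2 & H1 & H2 & E). apply (gap_zero G r M q u U Hq Hu).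
  assert (Hu' : Rabs u <= r) by (rewrite Rabs_pos_eq; lra).
  destruct U as (_ & _ & U).
  destruct (U q u Hq Hu') as [_ L]. destruct (U (mirror q) u (pbound_mirror _ _ Hq) Hu') as [_ R].
  apply right_half_return_mirror in H2.
  rewrite <- (left_half_return_unique _ _ _ _ (L ltac:(lra)) H1) in E.
  rewrite <- (left_half_return_unique _ _ _ _ (R ltac:(lra)) H2) in E.
  rewrite !Rinv_inv in E. unfold disp. lra.
Qed.

Lemma crossing_of_gap_zero G r M q u : uniform_returns G r M -> pbound G q -> 0 < u <= r ->
  gap q u = 0 -> crossing_periodic_orbit q u.
Proof.
  intros U Hq Hu E. apply (gap_zero G r M q u U Hq Hu) in E. unfold disp in E.
  assert (Hu' : Rabs u <= r) by (rewrite Rabs_pos_eq; lra).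
  destruct U as (_ & _ & U).
  destruct (U q u Hq Hu') as [F L]. destruct (U (mirror q) u (pbound_mirror _ _ Hq) Hu') as [_ R].
  assert (N := rf_neg _ _ _ _ F). pose proof (exp_pos (- (G * PI))).
  (* At y = 1/x the product of the first components is y^2 - b^2, and |b x| <= 1/8. *)
  assert (C : forall x, x <> 0 -> Rabs x <= safe G -> crossing_point q (/ x)).
  { intros x Hx Hs. pose proof (bb_upper G q x Hq Hs) as B. apply Rabs_le_between in B.
    unfold crossing_point, left_field, right_field; simpl.
    replace (_ * _) with ((1 - (bb q * x) ^ 2) * (/ x) ^ 2) by (field; exact Hx).
    apply Rmult_lt_0_compat; [nra|]. apply pow2_gt_0. now apply Rinv_neq_0_compat. }
  split; [lra|]. exists (/ ret q u). split; [apply L; lra|]. split; [|split].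
  - apply right_half_return_mirror. replace (ret q u) with (ret (mirror q) u) by lra. apply R; lra.
  - apply C; [lra|apply (rf_safe _ _ _ _ F)].
  - apply C; [|apply (rf_safe_ret _ _ _ _ F)]. unfold ret. nra.
Qed.

Lemma crossing_displacement q u : crossing_periodic_orbit q u -> displacement q u 0.
Proof.
  intros (_ & y & H1 & H2 & _). exists y, y. split; [exact H1|]. split; [exact H2|ring].
Qed.

Lemma list_isolation (us : list R) (u : R) :
  exists rho, 0 < rho /\ forall v, In v us -> v <> u -> rho <= Rabs (v - u).
Proof.
  induction us as [|x us [rho [Hr H]]].
  - exists 1. split; [lra|]. intros v [].
  - destruct (Req_dec x u) as [E|E].
    + exists rho. split; [exact Hr|]. intros v [<-|Hv] Hne; [contradiction|auto].
    + exists (Rmin rho (Rabs (x - u))).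
      split; [apply Rmin_glb_lt; [exact Hr|apply Rabs_pos_lt; lra]|].
      intros v [<-|Hv] Hne; [apply Rmin_r|]. eapply Rle_trans; [apply Rmin_l|auto].
Qed.

(** The j + 1 zeros cannot be augmented, so they are all the zeros of [gap] in (0, delta), hence all
    crossing periodic orbits there; isolation follows from finiteness. *)
Lemma limit_cycles_of_zeros G r M q delta j z : uniform_returns G r M -> pbound G q ->
  0 < delta <= r -> (forall z', ~ chain 0 delta (gap q) (S j) z') ->
  chain 0 delta (gap q) j z ->
  let us := map z (seq 0 (S j)) in
  NoDup us /\ length us = S j /\
  (forall u, In u us <-> 0 < u < delta /\ crossing_limit_cycle q u).
Proof.
  intros U Hq Hd Hno Hz us.
  assert (Hin : forall v, In v us <-> exists i, (i <= j)%nat /\ z i = v).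
  { intros v. unfold us. rewrite in_map_iff. split.
    - intros [i [E Hi]]. apply in_seq in Hi. exists i. split; [lia|exact E].
    - intros [i [Hi E]]. exists i. split; [exact E|]. apply in_seq. lia. }
  assert (Hzero : forall v, 0 < v < delta -> gap q v = 0 -> In v us).
  { intros v Hv E. apply NNPP. intros Hn.
    destruct (chain_insert 0 delta (gap q) j z v Hz Hv E) as [z' Hz'].
    - intros i Hi Ez. apply Hn, Hin. now exists i.
    - exact (Hno _ Hz'). }
  assert (Hus : forall v, In v us -> 0 < v < delta /\ gap q v = 0).
  { intros v Hv. apply Hin in Hv. destruct Hv as [i [Hi <-]]. now apply Hz. }
  split; [|split].
  - unfold us. apply NoDup_map_NoDup_ForallPairs; [|apply seq_NoDup].
    intros i i' Hi Hi' E. apply in_seq in Hi. apply in_seq in Hi'.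
    destruct (Nat.lt_total i i') as [h|[h|h]]; [|exact h|].
    + pose proof (chain_increasing _ _ _ _ _ i i' Hz ltac:(lia)). lra.
    + pose proof (chain_increasing _ _ _ _ _ i' i Hz ltac:(lia)). lra.
  - unfold us. now rewrite length_map, length_seq.
  - intros u. split.
    + intros Hu. destruct (Hus u Hu) as [Hb E]. split; [exact Hb|].
      split; [apply (crossing_of_gap_zero G r M); auto; lra|].
      destruct (list_isolation us u) as [rho [Hrho Hiso]].
      (* The second bound keeps v below delta, where zeros are known to belong to the list. *)
      exists (Rmin rho (delta - u)). split; [apply Rmin_glb_lt; lra|].
      intros v Hv [Hv1 Hv2] Hdis.
      pose proof (Rmin_l rho (delta - u)). pose proof (Rmin_r rho (delta - u)).
      assert (v < delta) by (pose proof (Rle_abs (v - u)); lra).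
      apply (displacement_disp G r M) in Hdis; auto; [|lra].
      specialize (Hiso v (Hzero v ltac:(lra) Hdis)).
      destruct (Req_dec v u) as [->|Hne]; [rewrite Rminus_diag, Rabs_R0 in Hv1; lra|].
      specialize (Hiso Hne). lra.
    + intros [Hb [Hc _]]. apply Hzero; [exact Hb|].
      apply (displacement_disp G r M); auto; [lra|]. now apply crossing_displacement.
Qed.

(** * Successive perturbations *)

(** There are n + 1 points and n sign changes; [w 0] is nearest to infinity, and the next point is
    inserted below it. *)
Definition alternating (e : R) (q : params) (n : nat) (w : nat -> R) : Prop :=
  (forall i, (i <= n)%nat -> 0 < w i < e /\ gap q (w i) <> 0) /\
  (forall i, (i < n)%nat -> w i < w (S i) /\ gap q (w i) * gap q (w (S i)) < 0).

Lemma signed_order_point s f n e : 0 < e -> signed_order s f n ->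
  exists x, 0 < x < e /\ 0 < s * f x.
Proof.
  intros He (d & c & C & Hd & Hc & H). exists (Rmin (d / 2) (e / 2)).
  assert (0 < Rmin (d / 2) (e / 2)) by (apply Rmin_glb_lt; lra).
  pose proof (Rmin_l (d / 2) (e / 2)). pose proof (Rmin_r (d / 2) (e / 2)).
  split; [lra|]. eapply Rlt_le_trans; [|apply H; lra].
  apply Rmult_lt_0_compat; [exact Hc|]. now apply pow_lt.
Qed.

Lemma signs_persist G r M q d tau0 w n : uniform_returns G r M -> 0 < tau0 ->
  (forall t, Rabs t < tau0 -> pbound G (line q d t)) ->
  (forall i, (i <= n)%nat -> 0 < w i <= r /\ gap q (w i) <> 0) ->
  exists tau, 0 < tau /\ forall t, Rabs t < tau -> forall i, (i <= n)%nat ->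
    0 < gap q (w i) * gap (line q d t) (w i).
Proof.
  intros U Ht HG Hw.
  assert (One : forall i, (i <= n)%nat -> exists tau, 0 < tau /\ forall t, Rabs t < tau ->
            0 < gap q (w i) * gap (line q d t) (w i)).
  { intros i Hi. destruct (Hw i Hi) as [H1 H2].
    apply (gap_sign_persists G r M q d _ (w i) tau0); auto. nra. }
  clear Hw. induction n as [|n IH].
  - destruct (One 0%nat (le_n 0)) as [tau [H0 H]]. exists tau. split; [exact H0|].
    intros t Hlt i Hi. replace i with 0%nat by lia. auto.
  - destruct IH as [t1 [H1 K1]]; [intros; apply One; lia|].
    destruct (One (S n) (le_n _)) as [t2 [H2 K2]].
    exists (Rmin t1 t2). split; [now apply Rmin_glb_lt|]. intros t Hlt i Hi.
    pose proof (Rmin_l t1 t2). pose proof (Rmin_r t1 t2).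
    destruct (Nat.eq_dec i (S n)) as [->|Hne]; [apply K2; lra|apply K1; [lra|lia]].
Qed.

Lemma opposite_signs (s a b c : R) : 0 < s * c -> s * a < 0 -> 0 < a * b -> c * b < 0.
Proof.
  intros H1 H2 H3. apply Rnot_le_lt. intros H.
  assert (0 < (s * c) * (a * b)) by now apply Rmult_lt_0_compat.
  assert ((s * a) * (c * b) <= 0) by nra. lra.
Qed.

(** A small t preserves the signs at the old points, while the new behaviour of [gap] at u = 0
    forces the opposite sign somewhere below [w 0]. *)
Lemma perturb_step G r M q d n w e eta : uniform_returns G r M ->
  0 < eta -> (forall q', params_close eta q q' -> pbound G q') -> e <= r ->
  alternating e q n w ->
  (forall tau, 0 < tau -> exists t s m, Rabs t < tau /\ s * gap q (w 0%nat) < 0 /\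
     signed_order s (gap (line q d t)) m) ->
  exists t w', params_close eta q (line q d t) /\ alternating e (line q d t) (S n) w'.
Proof.
  intros U Heta HG Her [Ha1 Ha2] Hs.
  destruct (line_close q d eta Heta) as [t0 [Ht0 Hc]].
  destruct (signs_persist G r M q d t0 w n U Ht0) as [t1 [Ht1 K]].
  - intros t Ht. now apply HG, Hc.
  - intros i Hi. destruct (Ha1 i Hi) as [H1 H2]. split; [lra|exact H2].
  - destruct (Hs (Rmin t0 t1) (Rmin_glb_lt _ _ _ Ht0 Ht1)) as (t & s & m & Ht & Hneg & Ho).
    pose proof (Rmin_l t0 t1). pose proof (Rmin_r t0 t1).
    specialize (K t ltac:(lra)). specialize (Hc t ltac:(lra)).
    destruct (Ha1 0%nat ltac:(lia)) as [Hw0 _].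
    destruct (signed_order_point s _ m (w 0%nat) ltac:(lra) Ho) as [x [Hx Hsx]].
    exists t, (fun i => match i with O => x | S i => w i end).
    split; [exact Hc|]. split.
    + intros [|i] Hi.
      * split; [lra|]. intros E. rewrite E in Hsx. lra.
      * destruct (Ha1 i ltac:(lia)) as [H1 _]. split; [exact H1|].
        intros E. specialize (K i ltac:(lia)). rewrite E in K. lra.
    + intros [|i] Hi.
      * split; [lra|]. exact (opposite_signs _ _ _ _ Hsx Hneg (K 0%nat ltac:(lia))).
      * destruct (Ha2 i ltac:(lia)) as [H1 H2]. split; [exact H1|].
        exact (opposite_signs _ _ _ _ (K i ltac:(lia)) H2 (K (S i) ltac:(lia))).
Qed.

Lemma small_signed (a tau : R) : a <> 0 -> 0 < tau -> exists t, Rabs t < tau /\ t * a < 0.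
Proof.
  intros Ha Ht. destruct (Rdichotomy _ _ Ha) as [h|h].
  - exists (tau / 2). rewrite Rabs_pos_eq by lra. split; nra.
  - exists (- (tau / 2)). rewrite Rabs_Ropp, Rabs_pos_eq by lra. split; nra.
Qed.

(** The value of [gap] at u = 0 becomes t pi, and t is given the sign opposite to [gap q w]; so m =
    0 and s = t. *)
Lemma perturb_trace q w : gammaL q + gammaR q = 0 -> gap q w <> 0 ->
  forall tau, 0 < tau -> exists t s m, Rabs t < tau /\ s * gap q w < 0 /\
    signed_order s (gap (line q (Params 0 1 0 0 0) t)) m.
Proof.
  intros Hs Hne tau Htau. destruct (small_signed _ tau Hne Htau) as [t [Ht Hneg]].
  assert (Ht0 : t <> 0) by (intros ->; lra). assert (Hpi := PI_RGT_0).
  exists t, t, 0%nat. split; [exact Ht|]. split; [exact Hneg|].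
  set (q' := line q (Params 0 1 0 0 0) t).
  assert (E : gap q' 0 = t * PI).
  { rewrite gap_0. unfold q'; simpl. replace (gammaL q) with (- gammaR q) by lra. ring. }
  destruct (local_setup q') as (G & r & M & U & HG).
  assert (Hq : pbound G q') by apply HG, params_close_refl, Rlt_0_1.
  assert (C : continuity_pt (gap q') 0).
  { apply continuity_pt_filterlim.
    apply (ex_derive_continuous (K := R_AbsRing) (V := R_NormedModule)). eexists.
    apply (is_derive_gap G M); [exact Hq|]. apply U; [exact Hq|].
    rewrite Rabs_R0. left. apply U. }
  assert (Htp : 0 < t * (t * PI)) by (assert (0 < t * t) by nra; nra).
  destruct (C (Rabs (t * PI) / 2)) as [d [Hd H]].
  { assert (0 < Rabs (t * PI)) by (apply Rabs_pos_lt; nra). lra. }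
  exists d, (t * (t * PI) / 2), (2 * (t * (t * PI))). split; [exact Hd|]. split; [lra|].
  intros u Hu. rewrite pow_O, !Rmult_1_r. specialize (H u). simpl in H. unfold Rdist in H.
  rewrite E in H. assert (K : Rabs (gap q' u - t * PI) < Rabs (t * PI) / 2).
  { apply H. split; [split; [exact I|lra]|]. rewrite Rminus_0_r, Rabs_pos_eq; lra. }
  assert (K' : Rabs (t * (gap q' u - t * PI)) <= t * (t * PI) / 2).
  { rewrite Rabs_mult. replace (t * (t * PI)) with (Rabs t * Rabs (t * PI)).
    - pose proof (Rabs_pos t). nra.
    - rewrite <- Rabs_mult. apply Rabs_pos_eq. lra. }
  apply Rabs_le_between in K'. lra.
Qed.

(** The trace sum stays 0 and [lead1] becomes - 2 t, so [gap] starts like a positive multiple of t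
    u. *)
Lemma perturb_b q w : gammaL q + gammaR q = 0 -> lead1 q = 0 -> gap q w <> 0 ->
  forall tau, 0 < tau -> exists t s m, Rabs t < tau /\ s * gap q w < 0 /\
    signed_order s (gap (line q (Params 0 0 0 0 1) t)) m.
Proof.
  intros Hs H1 Hne tau Htau. destruct (small_signed _ tau Hne Htau) as [t [Ht Hneg]].
  assert (Ht0 : t <> 0) by (intros ->; lra).
  set (q' := line q (Params 0 0 0 0 1) t).
  assert (E : lead1 q' = - (2 * t)).
  { transitivity (lead1 q - 2 * t); [|rewrite H1; ring].
    unfold lead1. rewrite !cA_mirror. unfold cA, q'; simpl. rewrite !Rmult_0_r, !Rplus_0_r. ring. }
  assert (Hl : leading q' 0) by (split; [simpl; lra|auto]).
  exists t, (- lead_value q' 0), 1%nat. split; [exact Ht|]. split; [simpl; rewrite E; lra|].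
  apply leading_gap_order; [unfold q'; simpl; lra|exact Hl].
Qed.

(** For zero trace sum, lead1 = 0 reads b = gammaL (alphaL + alphaR) / (1 + gammaL^2); the
    b-component of d preserves this equation while alphaR moves. Since lead3 is nonzero, so is b,
    and with it gammaL and alphaR, whence [lead2] becomes nonzero to first order in t. *)
Lemma perturb_alphaR q w : gammaL q + gammaR q = 0 -> leading q 2 -> gap q w <> 0 ->
  let d := Params 0 0 0 1 (gammaL q / (1 + gammaL q ^ 2)) in
  (forall t, lead1 (line q d t) = 0) /\
  forall tau, 0 < tau -> exists t s m, Rabs t < tau /\ s * gap q w < 0 /\
    signed_order s (gap (line q d t)) m.
Proof.
  intros Hs [Hv [?|[[? _]|[_ [H1 H2]]]]] Hne d; try discriminate.
  assert (HgR : gammaR q = - gammaL q) by lra.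
  set (g := gammaL q) in *. set (W := / (1 + g ^ 2)).
  assert (Hg2 := pow2_ge_0 g).
  assert (HW : 0 < W) by (apply Rinv_0_lt_compat; lra).
  assert (L1 : forall t, lead1 (line q d t) = 0).
  { intros t. transitivity (lead1 q); [|exact H1]. unfold lead1. rewrite !cA_mirror.
    unfold cA, d, Rdiv. simpl. fold g. rewrite HgR, !Rmult_0_r, !Rplus_0_r.
    replace (- g * (- g * 1)) with (g * (g * 1)) by ring. ring. }
  split; [exact L1|].
  assert (Eb : bb q = g * (alphaL q + alphaR q) * W).
  { unfold lead1 in H1. rewrite cA_mirror, HgR in H1. unfold cA, Rdiv in H1. fold g in H1.
    replace ((- g) ^ 2) with (g ^ 2) in H1 by ring. fold W in H1. lra. }
  assert (Hb : bb q <> 0).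
  { intros E. apply Hv. simpl. unfold lead3. rewrite E. ring. }
  assert (E2 : (alphaR q ^ 2 - alphaL q ^ 2) * W = 0).
  { unfold lead2, Rdiv in H2. rewrite HgR in H2. fold g in H2.
    replace ((- g) ^ 2) with (g ^ 2) in H2 by ring. fold W in H2. lra. }
  assert (Ea : alphaR q ^ 2 = alphaL q ^ 2) by nra.
  assert (HaR : alphaR q <> 0).
  { intros E. assert (alphaL q = 0) by nra. apply Hb. rewrite Eb, E, H. ring. }
  assert (Hg : g <> 0) by (intros E; apply Hb; rewrite Eb, E; ring).
  assert (Hsl : 1 + slope0 q <> 0).
  { unfold slope0. fold g. intros E. apply Hg. pose proof PI_RGT_0.
    assert (- g * PI = 0) by (apply exp_inv; rewrite exp_0; lra). nra. }
  set (c := (1 + slope0 q) * gap q w).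
  assert (Hc : c <> 0) by now apply Rmult_integral_contrapositive_currified.
  intros tau Htau.
  (* The first bound yields |t| < tau, the second |x c| <= 1, so that the quadratic term in t cannot
     outweigh the linear one: 2 + x c stays positive. The factor alphaR c in t makes the linear term
     a square times x. *)
  set (x := Rmin (tau / (2 * (Rabs (alphaR q * c) + 1))) (/ (Rabs c + 1))).
  assert (Hx : 0 < x).
  { pose proof (Rabs_pos (alphaR q * c)). pose proof (Rabs_pos c).
    apply Rmin_glb_lt; [apply Rdiv_lt_0_compat; lra|apply Rinv_0_lt_compat; lra]. }
  set (t := x * (alphaR q * c)).
  assert (Ht : Rabs t < tau).
  { pose proof (Rabs_pos (alphaR q * c)). unfold t. rewrite Rabs_mult, Rabs_pos_eq by lra.
    apply Rle_lt_trans with (tau / (2 * (Rabs (alphaR q * c) + 1)) * (Rabs (alphaR q * c) + 1)).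
    - apply Rmult_le_compat; try lra. apply Rmin_l.
    - replace (_ * _) with (tau / 2) by (field; lra). lra. }
  assert (Hxc : - 1 <= x * c).
  { assert (Hle : Rabs (x * c) <= 1).
    { pose proof (Rabs_pos c). rewrite Rabs_mult, Rabs_pos_eq by lra.
      apply Rle_trans with (/ (Rabs c + 1) * (Rabs c + 1)).
      - apply Rmult_le_compat; try lra. apply Rmin_r.
      - right. field. lra. }
    apply Rabs_le_between in Hle. lra. }
  set (q' := line q d t).
  assert (E : lead2 q' = (2 * alphaR q * t + t ^ 2) * W).
  { unfold lead2, q', d, Rdiv; simpl. fold g. rewrite HgR, !Rmult_0_r, !Rplus_0_r, !Rmult_1_r.
    replace (- g * - g) with (g * g) by ring.
    replace (alphaL q * alphaL q) with (alphaR q * alphaR q) by nra.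
    unfold W. simpl. rewrite !Rmult_1_r. ring. }
  assert (Esl : slope0 q' = slope0 q) by (unfold slope0, q'; simpl; rewrite Rmult_0_r, Rplus_0_r; reflexivity).
  assert (Pos : 0 < lead_value q' 1 * gap q w).
  { simpl. rewrite E, Esl.
    replace ((2 * alphaR q * t + t ^ 2) * W * (1 + slope0 q) * gap q w)
      with (W * (x * (alphaR q * c) ^ 2 * (2 + x * c))) by (unfold t, c; ring).
    apply Rmult_lt_0_compat; [exact HW|]. apply Rmult_lt_0_compat; [|lra].
    apply Rmult_lt_0_compat; [exact Hx|]. apply pow2_gt_0.
    now apply Rmult_integral_contrapositive_currified. }
  assert (Hl : leading q' 1).
  { split; [intros E0; rewrite E0 in Pos; lra|]. right. left. split; [reflexivity|apply L1]. }
  exists t, (- lead_value q' 1), 2%nat. split; [exact Ht|]. split; [lra|].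
  apply leading_gap_order; [unfold q'; simpl; fold g; lra|exact Hl].
Qed.

(** The perturbations run from the highest leading value down to the trace sum, so that each leaves
    at zero the quantities that the next ones will move; each adds one sign change. *)
Lemma alternating_perturbation p j G r M e eta : uniform_returns G r M ->
  (forall q, params_close 1 p q -> pbound G q) -> gammaL p + gammaR p = 0 -> leading p j ->
  0 < e <= r -> 0 < eta <= 1 ->
  exists q w, params_close eta p q /\ alternating e q (S j) w.
Proof.
  intros U HG Hs Hl He Heta.
  (* At most three perturbations are composed. *)
  set (h := eta / 3). assert (Hh : 0 < h) by (unfold h; lra).
  destruct (signed_order_point _ _ _ e (proj1 He) (leading_gap_order p j Hs Hl)) as [x [Hx Hgx]].
  assert (A0 : alternating e p 0 (fun _ => x)).
  { split; [|lia]. intros i _. split; [exact Hx|]. intros E. rewrite E in Hgx. lra. }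
  assert (B : forall q e', params_close e' p q -> e' + h <= 1 ->
            forall q', params_close h q q' -> pbound G q').
  { intros q e' Hq He' q' Hq'. apply HG, (params_close_le _ _ _ _ He').
    now apply (params_close_trans e' h p q). }
  assert (Final : forall q n w e', params_close e' p q -> e' + h <= eta ->
            gammaL q + gammaR q = 0 -> alternating e q n w ->
            exists q w, params_close eta p q /\ alternating e q (S n) w).
  { intros q n w e' Hq He' Hsq Ha.
    destruct (perturb_step G r M q _ n w e h U Hh (B q e' Hq ltac:(lra)) (proj2 He) Ha
                (perturb_trace q _ Hsq (proj2 (proj1 Ha 0%nat ltac:(lia))))) as (t & w' & Hc & Ha').
    exists (line q (Params 0 1 0 0 0) t), w'. split; [|exact Ha'].
    apply (params_close_le _ _ _ _ He'), (params_close_trans _ _ _ _ _ Hq Hc). }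
  assert (Middle : forall q n w e', params_close e' p q -> e' + h + h <= eta ->
            gammaL q + gammaR q = 0 -> lead1 q = 0 -> alternating e q n w ->
            exists q w, params_close eta p q /\ alternating e q (S (S n)) w).
  { intros q n w e' Hq He' Hsq H1 Ha.
    destruct (perturb_step G r M q _ n w e h U Hh (B q e' Hq ltac:(lra)) (proj2 He) Ha
                (perturb_b q _ Hsq H1 (proj2 (proj1 Ha 0%nat ltac:(lia))))) as (t & w' & Hc & Ha').
    apply (Final (line q (Params 0 0 0 0 1) t) (S n) w' (e' + h)); auto.
    - exact (params_close_trans _ _ _ _ _ Hq Hc).
    - simpl. lra. }
  assert (Hpp : forall e', 0 < e' -> params_close e' p p) by (intros; now apply params_close_refl).
  destruct (proj2 Hl) as [-> | [[-> H1] | [-> [H1 H2]]]].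
  - apply (Final p 0%nat (fun _ => x) h); auto. unfold h; lra.
  - apply (Middle p 0%nat (fun _ => x) h); auto. unfold h; lra.
  - destruct (perturb_alphaR p x Hs Hl) as [L1 HS].
    { intros E. rewrite E in Hgx. lra. }
    assert (Hcl : forall q', params_close h p q' -> pbound G q').
    { intros q' Hq'. apply HG. apply (params_close_le h); [unfold h; lra|exact Hq']. }
    destruct (perturb_step G r M p _ 0%nat (fun _ => x) e h U Hh Hcl (proj2 He) A0 HS)
      as (t & w' & Hc & Ha').
    apply (Middle _ 1%nat w' h Hc); auto; [unfold h; lra|simpl; lra].
Qed.

(** The sign changes give at least j + 1 zeros, and the zero count on (0, delta), fixed before eps,
    gives at most as many. *)
Lemma weak_focus_bifurcates p k : infinity_weak_focus p k -> bifurcates_big_limit_cycles p k.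
Proof.
  intros Hk. assert (Hs := weak_focus_trace p k Hk).
  destruct (weak_focus_leading p k Hk) as [j [-> Hl]]. clear Hk.
  destruct (local_setup p) as (G & r & M & U & HG).
  destruct (gap_zero_count p j G r M U HG Hl) as [delta [Hd [Hdr Hcount]]].
  exists delta. split; [lra|]. intros eps Heps.
  (* Points below e lie in the fixed neighbourhood and also below eps, which sends the cycles to
     infinity with the perturbation. *)
  set (e := Rmin delta eps).
  assert (He : 0 < e) by (apply Rmin_glb_lt; lra).
  assert (E1 : e <= delta) by apply Rmin_l. assert (E2 : e <= eps) by apply Rmin_r.
  destruct (alternating_perturbation p j G r M e e U HG Hs Hl) as (q & w & Hq & [Ha1 Ha2]); try lra.
  exists q. split; [exact (params_close_le _ _ _ _ E2 Hq)|].
  assert (Hqb : pbound G q) by (apply HG, (params_close_le e); [lra|exact Hq]).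
  destruct (chain_of_sign_changes 0 delta (gap q) j w) as [z [Hz Hzw]].
  - intros x Hx. apply continuity_pt_filterlim.
    apply (ex_derive_continuous (K := R_AbsRing) (V := R_NormedModule)). eexists.
    apply (is_derive_gap G M); [exact Hqb|]. apply U; [exact Hqb|]. rewrite Rabs_pos_eq; lra.
  - intros i Hi. destruct (Ha1 i Hi) as [H _]. lra.
  - intros i Hi. apply Ha2. lia.
  - exists (map z (seq 0 (S j))).
    destruct (limit_cycles_of_zeros G r M q delta j z U Hqb ltac:(lra)) as [N1 [N2 N3]]; auto.
    { intros z'. apply Hcount. exact (params_close_le _ _ _ _ E1 Hq). }
    repeat split; auto; try apply N3; auto.
    intros u Hu. apply in_map_iff in Hu. destruct Hu as [i [<- Hi]]. apply in_seq in Hi.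
    destruct (Hzw i ltac:(lia)) as [_ Hlt]. destruct (Ha1 (S i) ltac:(lia)) as [[_ Hw] _]. lra.
Qed.

Theorem theorem4 :
  (forall p : params,
     (gammaL p + gammaR p > 0 -> infinity_hyperbolic p /\ infinity_stable p) /\
     (gammaL p + gammaR p < 0 -> infinity_hyperbolic p /\ infinity_unstable p) /\
     (gammaL p + gammaR p = 0 ->
        ~ infinity_hyperbolic p /\
        ((exists k, infinity_weak_focus p k) \/ infinity_center p))) /\
  (forall k : nat,
     (exists p : params, infinity_weak_focus p k) <->
     (k = 1 \/ k = 2 \/ k = 3)%nat) /\
  (forall (p : params) (k : nat),
     infinity_weak_focus p k -> bifurcates_big_limit_cycles p k).
Proof.
  split; [|split; [exact weak_focus_orders|exact weak_focus_bifurcates]].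
  intros p.
  assert (Hyp : gammaL p + gammaR p <> 0 -> infinity_hyperbolic p).
  { intros H. exists (disp_coef p). split; [apply disp_coef_series|].
    intros E. now apply H, disp_coef_1_zero. }
  split; [|split]; intros H.
  - split; [apply Hyp; lra|].
    destruct (stability_sign p 1 ltac:(lra)) as [d [Hd K]]. exists d. split; [exact Hd|].
    intros u Hu. destruct (K u Hu) as (y1 & y2 & A & B & C). exists y1, y2.
    split; [exact A|]. split; [exact B|lra].
  - split; [apply Hyp; lra|].
    destruct (stability_sign p (-1) ltac:(lra)) as [d [Hd K]]. exists d. split; [exact Hd|].
    intros u Hu. destruct (K u Hu) as (y1 & y2 & A & B & C). exists y1, y2.
    split; [exact A|]. split; [exact B|lra].
  - split; [|now apply weak_focus_or_center].
    intros (a & Ha & Hne). apply Hne.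
    rewrite (displacement_series_unique p a Ha). now apply disp_coef_1_zero.
Qed.
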